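(* Let $1<q<\infty$. If $\nu\in B_q$ is a radial weight, then $\nu\in\mathcal{D}$. Moreover, for every $\nu\in\mathcal{D}$ the maximal Bergman projection $$P^+_\nu(f)(z)=\int_{\mathbb{D}}f(\zeta)|B^\nu_z(\zeta)|\nu(\zeta)\,dA(\zeta),\quad z\in\mathbb{D},$$ is bounded from $L^q_\nu$ to $L^q_\nu$.
   Context: $\mathbb{D}$ is the open unit disc of $\mathbb{C}$ and $dA=dx\,dy/\pi$. A weight is a function $\nu:\mathbb{D}\to[0,\infty)$ integrable over $\mathbb{D}$; it is radial if $\nu(z)=\nu(|z|)$. $L^q_\nu$ is the space of measurable $f$ with $\|f\|_{L^q_\nu}=(\int_{\mathbb{D}}|f|^q\nu\,dA)^{1/q}<\infty$; $A^2_\nu$ is the space of analytic functions in $L^2_\nu$, and $B^\nu_z$ is the reproducing kernel of $A^2_\nu$ at $z$. For a radial weight, $\widehat{\nu}(r)=\int_r^1\nu(s)\,ds$, assumed throughout to be strictly positive for all $0\le r<1$. Classes of radial weights: $\nu\in\widehat{\mathcal{D}}$ if there is $C>1$ with $\widehat{\nu}(r)\le C\widehat{\nu}(\frac{1+r}{2})$ for all $0\le r<1$; $\nu\in\check{\mathcal{D}}$ if there are $K>1$, $C>1$ with $\widehat{\nu}(r)\ge C\widehat{\nu}(1-\frac{1-r}{K})$ for all $0\le r<1$; $\mathcal{D}=\widehat{\mathcal{D}}\cap\check{\mathcal{D}}$. For $\eta>-1$ let $P_\eta(f)(z)=(\eta+1)\int_{\mathbb{D}}f(\zeta)\frac{(1-|\zeta|^2)^\eta}{(1-z\overline{\zeta})^{2+\eta}}\,dA(\zeta)$.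 $B_q(\eta)$ is the class of weights $\nu$ such that $P_\eta:L^q_\nu\to L^q_\nu$ is bounded, and $B_q=\bigcup_{\eta>-1}B_q(\eta)$.
   Formalization: For a radial weight, $\widehat{\nu}(r)$ is required to be finite as well as positive for $0\le r<1$; otherwise $\nu(z)=1/|z|$, which lies in $B_q(0)$ but has $\widehat{\nu}(0)=\infty$, is not in $\mathcal{D}$. *)

(* Defs.v *)
From mathcomp Require Import all_boot all_order all_algebra.
From mathcomp Require Import all_classical all_reals all_analysis.
From mathcomp Require Import complex.

Set Implicit Arguments.
Unset Strict Implicit.
Unset Printing Implicit Defensive.

Import Order.TTheory GRing.Theory Num.Theory.
Import numFieldNormedType.Exports.

Local Open Scope classical_set_scope.
Local Open Scope ring_scope.

Section Disc.
Variable R : realType.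
Local Notation C := R[i].
Local Notation Re := complex.Re.
Local Notation Im := complex.Im.
Local Open Scope complex_scope.

(* Modulus, as an element of [R]; the library's [`|z|] lies in [R[i]]. *)
Definition modulus (z : C) : R := Re `|z|.

Definition disc : set C := [set z | modulus z < 1].

(* [R[i]] carries no sigma-algebra in the libraries, so the plane is modelled  *)
(* as [R * R] for measurability and integration, through [of_plane].           *)
Definition of_plane (p : R * R) : C := p.1 +i* p.2.

Definition planar_disc : set (R * R) := of_plane @^-1` disc.

Fact invpi_ge0 : (0 <= (pi : R)^-1)%R. Proof. by rewrite invr_ge0 pi_ge0. Qed.

(* dA = dx dy / pi *)
Definition dA : {measure set (measurableTypeR R * measurableTypeR R) -> \bar R} :=
  mscale (NngNum invpi_ge0)
    (@lebesgue_measure R \x @lebesgue_measure R)%E.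

Definition measurable_on_disc (f : C -> C) : Prop :=
  measurable_fun planar_disc (fun p => Re (f (of_plane p))) /\
  measurable_fun planar_disc (fun p => Im (f (of_plane p))).

Definition integrable_on_disc (f : C -> C) : Prop :=
  dA.-integrable planar_disc (fun p => (Re (f (of_plane p)))%:E) /\
  dA.-integrable planar_disc (fun p => (Im (f (of_plane p)))%:E).

Definition disc_integral (f : C -> C) : C :=
  Rintegral dA planar_disc (fun p => Re (f (of_plane p))) +i*
  Rintegral dA planar_disc (fun p => Im (f (of_plane p))).

(* Functions on the disc are total functions on [C] whose values outside the   *)
(* disc are never used.                                                        *)
Definition weight (nu : C -> R) : Prop :=
  (forall z, disc z -> 0 <= nu z) /\
  dA.-integrable planar_disc (fun p => (nu (of_plane p))%:E).

Definition radial (nu : C -> R) : Prop :=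
  forall z, disc z -> nu z = nu (modulus z)%:C.

Definition hat (nu : C -> R) (r : R) : \bar R :=
  (\int[@lebesgue_measure R]_(s in `[r, 1%R[) (nu s%:C)%:E)%E.

(* Integrability over the disc does not bound [hat nu 0], as nu(z) = 1/|z|     *)
(* shows; [hat nu] is required to take values in ]0, +oo[ on [0, 1[.           *)
Definition radial_weight (nu : C -> R) : Prop :=
  [/\ weight nu, radial nu &
      forall r : R, 0 <= r < 1 -> (0 < hat nu r < +oo)%E].

Definition Dhat (nu : C -> R) : Prop :=
  radial_weight nu /\
  exists2 c : R, 1 < c & forall r : R, 0 <= r < 1 ->
    (hat nu r <= c%:E * hat nu ((1 + r) / 2))%E.

Definition Dcheck (nu : C -> R) : Prop :=
  radial_weight nu /\
  exists k c : R, [/\ 1 < k, 1 < c & forall r : R, 0 <= r < 1 ->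
    (hat nu r >= c%:E * hat nu (1 - (1 - r) / k))%E].

Definition classD (nu : C -> R) : Prop := Dhat nu /\ Dcheck nu.

Definition Lq_norm (q : R) (nu : C -> R) (f : C -> C) : \bar R :=
  ((\int[dA]_(p in planar_disc)
      (modulus (f (of_plane p)) `^ q * nu (of_plane p))%:E) `^ q^-1)%E.

Definition Lq (q : R) (nu : C -> R) (f : C -> C) : Prop :=
  measurable_on_disc f /\ (Lq_norm q nu f < +oo)%E.

Definition analytic_on_disc (f : C -> C) : Prop :=
  forall z, disc z -> derivable (f : C^o -> C^o) z 1.

Definition bergman_space (nu : C -> R) (f : C -> C) : Prop :=
  analytic_on_disc f /\ Lq 2 nu f.

Definition is_reproducing_kernel (nu : C -> R) (z : C) (B : C -> C) : Prop :=
  bergman_space nu B /\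
  forall f, bergman_space nu f ->
    f z = disc_integral (fun w => f w * (B w)^* * (nu w)%:C).

(* B^nu_z, determined on the disc by [is_reproducing_kernel].                  *)
Definition bergman_kernel (nu : C -> R) (z : C) : C -> C :=
  xget (fun=> 0) [set B | is_reproducing_kernel nu z B].

Definition kernel_operator (K : C -> C -> C) (f : C -> C) (z : C) : C :=
  disc_integral (fun w => f w * K z w).

(* Boundedness on L^q_nu includes that the defining integral converges         *)
(* absolutely for every f in L^q_nu and every z in the disc; [disc_integral]   *)
(* alone would return a default value otherwise.                               *)
Definition bounded_on_Lq (q : R) (nu : C -> R) (K : C -> C -> C) : Prop :=
  exists2 c : R, 0 < c & forall f, Lq q nu f ->
    [/\ forall z, disc z -> integrable_on_disc (fun w => f w * K z w),
        Lq q nu (kernel_operator K f) &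
        (Lq_norm q nu (kernel_operator K f) <= c%:E * Lq_norm q nu f)%E].

(* Principal argument, in ]-pi, pi] *)
Definition Carg (z : C) : R :=
  if 0 <= Im z then acos (Re z / modulus z) else - acos (Re z / modulus z).

(* Principal branch of z^a, for z != 0 *)
Definition Cpow (z : C) (a : R) : C :=
  (modulus z `^ a)%:C * (cos (a * Carg z) +i* sin (a * Carg z)).

(* Kernel of P_eta; the base [1 - z * w^* ] has positive real part on the disc. *)
Definition P_kernel (eta : R) (z w : C) : C :=
  ((eta + 1) * (1 - modulus w ^+ 2) `^ eta)%:C / Cpow (1 - z * w^*) (2 + eta).

Definition classB_eta (q eta : R) (nu : C -> R) : Prop :=
  weight nu /\ bounded_on_Lq q nu (P_kernel eta).

Definition classB (q : R) (nu : C -> R) : Prop :=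
  exists2 eta : R, -1 < eta & classB_eta q eta nu.

(* Kernel of the maximal Bergman projection P^+_nu *)
Definition P_plus_kernel (nu : C -> R) (z w : C) : C :=
  (modulus (bergman_kernel nu z w) * nu w)%:C.

End Disc.

(* Main.v *)
From HB Require Import structures.
Require Import Defs.
From mathcomp Require Import all_boot all_order all_algebra.
From mathcomp Require Import all_classical all_reals all_analysis.
From mathcomp Require Import complex.
From mathcomp Require Import measurable_realfun.
From mathcomp Require Import zify ring lra.

(** Polar coordinates reduce both halves to the measure mu = 2 s nu(s) ds on
    ]0, 1[ and its tails T(r) = mu [r, 1[, which are comparable to hat nu
    away from 0.

    Necessity. Suppose that P_eta is bounded and let 0 < d <= 1. Take two
    sectors around the positive axis, of the same aperture proportional to d:
    S1, where 1 - d/2 <= |w| < 1 - d/4, and S2, where 1 - d <= |z| < 1. For z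
    in S2 and w in S1 the number 1 - z conj(w) has modulus at most 3 d, and an
    argument so small that its power 2 + eta is within 1 radian of that axis.
    Hence the real part of the kernel is at least of order d^-2
    ([P_kernel_lower]), while S1 has area of order d^2: the image of the
    indicator of S1 is bounded below on S2, by a constant independent of d.
    The norm inequality compares the nu-measures of S1 and S2, whose common
    angular factor cancels, and becomes
      T(1 - d) <= c (T(1 - d/2) - T(1 - d/4))        ([tail_middle]).
    Dropping the last term gives the doubling condition, and adding
    T(1 - d/4) to the difference gives the reverse condition for T with K = 4
    and constant 1 + 1/c; its iterates outweigh the factor 2 lost in the
    comparison of T with hat nu ([tail_classD]).

    Sufficiency. Monomials are orthogonal for a radial weight, so the kernel
    is B_z(w) = F(conj(z) w), where F(x) is the sum of the a_n x^n and 1/a_n is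
    the moment of mu of order 2 n. This requires that functions of the space
    are the sums of their Taylor series, which is proved from Goursat's
    theorem; Parseval's identity on circles then gives the reproducing
    property ([bergman_kernelE]). The central estimate is that the mean of |F|
    over the circle of radius r is O(1 / T(r)) ([kser_L1]). The doubling
    condition gives a_(n+1) - a_n = O(a_(n+1) / n) and bounds the sum of the
    a_n^2 x^n by O(1 / ((1 - x) T(x)^2)); with Parseval and Cauchy-Schwarz this
    shows that passing from the radius r to 1 - k (1 - r) changes the mean by
    O(1 / T(r)). Under the reverse condition T grows geometrically along these
    radii, so the changes add up to the claim.

    Boundedness is then Schur's test ([schur]) with powers of T(|z|) as test
    functions: the estimate of the means turns its hypothesis into
      int T(s)^-al / T(r s) dmu(s) <= A T(r)^-al,   0 < al < 1,
    which follows from geometric decay of T on blocks towards 1, and from its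
    geometric growth towards 0 ([tail_test]). *)

Set Implicit Arguments.
Unset Strict Implicit.
Unset Printing Implicit Defensive.
Import Order.TTheory GRing.Theory Num.Theory.
Import numFieldNormedType.Exports.
Local Open Scope classical_set_scope.
Local Open Scope ring_scope.

(** * Densities and substitutions for Lebesgue integrals *)

Section density.
Local Open Scope ereal_scope.
Context d (T : measurableType d) (R : realType) (mu : {measure set T -> \bar R}).
Variables (D : set T) (g : T -> R).
Hypotheses (mD : measurable D) (mg : measurable_fun D g)
  (g0 : forall x, D x -> (0 <= g x)%R).

(** The proofs are arguments, so that the measure structure declared below
    can find them in the term. *)
Definition density of measurable D & measurable_fun D g & (forall x, D x -> (0 <= g x)%R) :=
  fun A : set T => \int[mu]_(x in A `&` D) (g x)%:E.

Local Notation dens := (density mD mg g0).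

Let dens0 : dens set0 = 0. Proof. by rewrite /density set0I integral_set0. Qed.

Let dens_ge0 A : 0 <= dens A.
Proof. by apply: integral_ge0 => x [_ Dx]; rewrite lee_fin g0. Qed.

Let dens_sigma_additive : semi_sigma_additive dens.
Proof.
move=> F mF tF mUF; rewrite /density setI_bigcupl ge0_integral_bigcup//=.
- apply: is_cvg_ereal_nneg_natsum_cond => n _ _; exact: dens_ge0.
- by move=> k; exact: measurableI.
- apply/measurable_EFinP; apply: measurable_funS mg => //.
  by move=> x [k _ []].
- by move=> x [k _ [_ Dx]]; rewrite lee_fin g0.
- exact: trivIset_setIr.
Qed.

HB.instance Definition _ := isMeasure.Build _ _ _ dens dens0 dens_ge0 dens_sigma_additive.

Import HBNNSimple.

(** Both sides are continuous along monotone limits, and on simple functions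
    this is the definition. *)
Lemma ge0_integral_density (E : set T) (f : T -> \bar R) : measurable E ->
  measurable_fun E f -> (forall x, E x -> 0 <= f x) ->
  \int[dens]_(x in E) f x = \int[mu]_(x in E `&` D) (f x * (g x)%:E).
Proof.
move=> mE mf f0.
have mED : measurable (E `&` D) by exact: measurableI.
have mgED : measurable_fun (E `&` D) (fun x => (g x)%:E).
  by apply/measurable_EFinP; apply: measurable_funS mg => // x [].
pose h := nnsfun_approx mE mf.
have -> : \int[dens]_(x in E) f x = limn (fun n => \int[dens]_(x in E) (h n x)%:E).
  have fE x : E x -> f x = limn (fun n => (h n x)%:E).
    by move=> Ex; apply/esym/cvg_lim => //; apply: cvg_nnsfun_approx.
  under eq_integral => x /[!inE] /fE -> //.
  apply: monotone_convergence => //.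
  - by move=> n; apply/measurable_EFinP; apply: (measurable_funS measurableT).
  - by move=> n x Ex; rewrite lee_fin.
  - by move=> x Ex a b ab; rewrite lee_fin; exact/lefP/nd_nnsfun_approx.
have -> : \int[mu]_(x in E `&` D) (f x * (g x)%:E) =
    limn (fun n => \int[mu]_(x in E `&` D) ((h n x)%:E * (g x)%:E)).
  have fE x : (E `&` D) x -> f x * (g x)%:E = limn (fun n => (h n x)%:E * (g x)%:E).
    move=> [Ex Dx]; apply/esym/cvg_lim => //.
    under eq_fun do rewrite muleC; rewrite muleC.
    by apply: cvgeZl => //; apply: cvg_nnsfun_approx.
  under eq_integral => x /[!inE] /fE -> //.
  apply: monotone_convergence => //.
  - move=> n; apply: emeasurable_funM => //.
    by apply/measurable_EFinP; apply: (measurable_funS measurableT).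
  - by move=> n x [_ Dx]; rewrite mule_ge0// lee_fin ?g0.
  - move=> x [_ Dx] a b ab; rewrite lee_wpmul2r ?lee_fin ?g0//.
    exact/lefP/nd_nnsfun_approx.
congr (limn _); apply/funext => n.
under [LHS]eq_integral do rewrite fimfunE -fsumEFin//.
rewrite ge0_integral_fsum//; last 2 first.
- move=> r; apply/measurable_EFinP; apply: (measurable_funS measurableT) => //.
  by apply: measurable_funM.
- by move=> r x _; rewrite nnfun_muleindic_ge0.
transitivity (\int[mu]_(x in E `&` D) (\sum_(r \in range (h n)) ((r * \1_(h n @^-1` [set r]) x)%:E * (g x)%:E))).
  rewrite ge0_integral_fsum//; last 2 first.
  - move=> r; apply: emeasurable_funM => //; apply/measurable_EFinP; apply: (measurable_funS measurableT) => //.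
    by apply: measurable_funM.
  - by move=> r x [_ Dx]; rewrite mule_ge0 ?nnfun_muleindic_ge0// lee_fin g0.
  apply: eq_fsbigr => r /[!inE] -[x _ hxr].
  have r0 : (0 <= r)%R by rewrite -hxr.
  under eq_integral do rewrite EFinM; under [RHS]eq_integral do rewrite EFinM -muleA.
  rewrite !ge0_integralZl_EFin//; last 3 first.
  - by move=> y [_ Dy]; rewrite mule_ge0 ?lee_fin ?g0.
  - apply: emeasurable_funM => //; apply/measurable_EFinP; exact: (measurable_funS measurableT).
  - by apply/measurable_EFinP; exact: (measurable_funS measurableT).
  congr (_ * _); rewrite integral_indic// /density.
  have mr : measurable (h n @^-1` [set r]) by [].
  rewrite [LHS]integral_mkcond [RHS]integral_mkcond; apply: eq_integral => y _.
  rewrite !patchE !in_setI indicE.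
  by case: (y \in D); case: (y \in E); case: (y \in h n @^-1` [set r]); rewrite /= ?mul1e ?mul0e.
apply: eq_integral => x /[!inE] -[_ Dx].
by rewrite -ge0_mule_fsuml ?fsumEFin -?fimfunE// => r; rewrite nnfun_muleindic_ge0.
Qed.

End density.

Section affine.
Local Open Scope ereal_scope.
Context (R : realType).
Local Notation leb := (@lebesgue_measure R).

(** The image of c dx under x |-> c x + e gives ]a, b] the mass b - a, so it
    is Lebesgue measure. *)
Lemma ge0_integral_affine (c e : R) (f : R -> \bar R) : (0 < c)%R ->
  measurable_fun [set: measurableTypeR R] f -> (forall r, 0 <= f r) ->
  \int[leb]_y f y = \int[leb]_x (f (c * x + e)%R * c%:E).
Proof.
move=> c0 mf f0.
pose phi : measurableTypeR R -> measurableTypeR R := fun x => (c * x + e)%R.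
have mphi : measurable_fun setT phi by apply: measurable_funD => //; exact: measurable_funM.
have c0' : (0 <= c)%R by exact: ltW.
transitivity (\int[pushforward (mscale (NngNum c0') leb) phi]_y f y).
  apply: eq_measure_integral => A mA _; apply: lebesgue_measure_unique => //= _ [[a b]] _ <-.
  rewrite /pushforward /mscale /=.
  have -> : phi @^-1` `]a, b] = `]((a - e) / c)%R, ((b - e) / c)%R]%classic.
    by apply/seteqP; split => x /=; rewrite !in_itv/= /phi ltr_pdivrMr// ler_pdivlMr// ltrBlDr lerBrDr mulrC.
  rewrite !lebesgue_measure_itv/= !lte_fin ltr_pM2r ?invr_gt0// ltrD2r.
  case: ifPn => // _; rewrite ?mule0// -!EFinB -EFinM; congr (_%:E).
  by field; rewrite gt_eqF.
rewrite ge0_integral_pushforward// preimage_setT ge0_integral_mscale//=; last exact: measurableT_comp.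
rewrite -ge0_integralZl//; last exact: (measurableT_comp mf mphi).
by apply: eq_integral => x _ /=; rewrite muleC.
Qed.

Lemma ge0_integral_oppr (f : R -> \bar R) :
  measurable_fun [set: measurableTypeR R] f -> (forall r, 0 <= f r) ->
  \int[leb]_y f y = \int[leb]_x f (- x)%R.
Proof.
move=> mf f0.
transitivity (\int[pushforward leb (-%R : _ -> measurableTypeR R)]_y f y).
  by apply: eq_measure_integral => A mA _; apply/esym/lebesgue_measureN.
by rewrite ge0_integral_pushforward// preimage_setT.
Qed.

Local Notation half := (`](- (pi / 2))%R, (pi / 2)%R[%classic : set R).

Lemma cos_half (x : R) : half x -> (0 < cos x)%R.
Proof. by rewrite /= in_itv/= => xh; exact: cos_gt0_pihalf. Qed.

Lemma measurable_tan_half : measurable_fun (half : set (measurableTypeR R)) (@tan R).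
Proof.
apply: open_continuous_measurable_fun => //.
by move=> x /[!inE] /cos_half cx; apply: continuous_tan; rewrite gt_eqF.
Qed.

Lemma measurable_sec2_half :
  measurable_fun (half : set (measurableTypeR R)) (fun x : R => (cos x) ^- 2)%R.
Proof.
apply: open_continuous_measurable_fun => //.
move=> x /[!inE] /cos_half cx; apply: cvgV; first by rewrite gt_eqF ?exprn_gt0.
apply: (cvg_comp cos (fun z : R => z ^+ 2)%R); first exact: continuous_cos.
exact: exprn_continuous.
Qed.

Lemma sec2_ge0 (x : R) : half x -> (0 <= (cos x) ^- 2)%R.
Proof. by move=> _; rewrite invr_ge0 sqr_ge0. Qed.

Let measurable_half : measurable (half : set (measurableTypeR R)).
Proof. exact: measurable_itv. Qed.

Lemma sec2_integral (a b : R) : (a < b)%R ->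
  \int[leb]_(x in `](atan a), (atan b)]) ((cos x) ^- 2)%:E = (b - a)%:E.
Proof.
move=> ab.
have hatan (y : R) : half (atan y) by rewrite /= in_itv/= atan_gtNpi2 atan_ltpi2.
have ih x : (atan a <= x <= atan b)%R -> half x.
  move=> /andP[ax xb]; rewrite /= in_itv/= (lt_le_trans (atan_gtNpi2 a))//=.
  exact: le_lt_trans (atan_ltpi2 b).
have c0 x : (atan a <= x <= atan b)%R -> cos x != 0%R.
  by move=> /ih /cos_half cx; rewrite gt_eqF.
rewrite integral_itv_obnd_cbnd; last first.
  apply/measurable_EFinP; apply: measurable_funS (measurable_sec2_half) => //.
  by move=> x /=; rewrite in_itv/= => /andP[ax xb]; apply: ih; rewrite (ltW ax).
rewrite (@continuous_FTC2 _ _ (@tan R))//.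
- by rewrite !atanK EFinB.
- exact: lt_atan.
- apply: continuous_in_subspaceT => x /[!inE]/=; rewrite in_itv/= => xab.
  apply: cvgV; first by rewrite expf_neq0// c0.
  apply: (cvg_comp cos (fun z : R => z ^+ 2)%R); first exact: continuous_cos.
  exact: exprn_continuous.
- split=> [x||].
  + rewrite in_itv/= => /andP[ax xb]; apply: derivable_tan; apply: c0.
    by rewrite !ltW.
  + apply: cvg_at_right_filter; apply: continuous_tan; apply: c0.
    by rewrite lexx ltW ?lt_atan.
  + apply: cvg_at_left_filter; apply: continuous_tan; apply: c0.
    by rewrite lexx ltW ?lt_atan.
- move=> x; rewrite in_itv/= => /andP[ax xb].
  have cx : cos x != 0%R by apply: c0; rewrite !ltW.
  by rewrite derive1E; have D := is_derive_tan cx; rewrite derive_val.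
Qed.

(** The measure dt / (cos t)^2 gives ]atan a, atan b] the mass b - a, because
    tan is a primitive of its density; so its image under tan is Lebesgue
    measure. *)
Lemma ge0_integral_tan (f : R -> \bar R) :
  measurable_fun [set: measurableTypeR R] f -> (forall r, 0 <= f r) ->
  \int[leb]_y f y = \int[leb]_(x in half) (f (tan x) * ((cos x) ^- 2)%:E).
Proof.
move=> mf f0.
pose phi : measurableTypeR R -> measurableTypeR R := (@tan R) \_ half.
have mphi : measurable_fun setT phi.
  by apply/(measurable_restrictT _ _).1 => //; exact: measurable_tan_half.
pose nu := density leb measurable_half measurable_sec2_half sec2_ge0.
have phiE x : half x -> phi x = tan x by move=> hx; rewrite /phi patchE mem_set.
transitivity (\int[pushforward nu phi]_y f y).
  apply: eq_measure_integral => A mA _; apply: lebesgue_measure_unique => //= _ [[a b]] _ <-.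
  rewrite /pushforward /nu /density /=.
  rewrite lebesgue_measure_itv/= lte_fin; case: ifPn => [ab|]; last first.
    rewrite -leNgt => ba; rewrite (_ : _ `&` _ = set0) ?integral_set0//.
    apply/seteqP; split => // x [/=]; rewrite in_itv/= => /andP[h1 h2] _.
    by have := lt_le_trans h1 h2; rewrite ltNge ba.
  rewrite -EFinB -sec2_integral//; congr (integral _ _ _).
  have hatan (y : R) : half (atan y) by rewrite /= in_itv/= atan_gtNpi2 atan_ltpi2.
  apply/seteqP; split => x /=.
    rewrite !in_itv/= => /andP[ax xb].
    have hx : half x.
      rewrite /= in_itv/= (lt_trans (atan_gtNpi2 a))//=.
      exact: le_lt_trans (atan_ltpi2 b).
    split; last by move: hx; rewrite /= in_itv.
    have lt_tanE u v : half u -> half v -> (tan u < tan v)%R = (u < v)%R by move=> hu hv; apply: ltr_tan.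
    rewrite phiE//; apply/andP; split.
      by rewrite -[X in (X < _)%R]atanK lt_tanE.
    by rewrite -[X in (_ <= X)%R]atanK leNgt lt_tanE// -leNgt.
  rewrite in_itv/= => -[+ hx]; rewrite phiE// => /andP[ax xb].
  by rewrite in_itv/= -(tanK hx) lt_atan//= le_atan.
rewrite ge0_integral_pushforward// preimage_setT ge0_integral_density//=; last exact: measurableT_comp.
by rewrite setTI; apply: eq_integral => x /[!inE] hx /=; rewrite phiE.
Qed.

End affine.

(** * Polar coordinates *)

Section fdensity.
Local Open Scope ereal_scope.
Context d (T : measurableType d) (R : realType) (mu : {measure set T -> \bar R}).
Variables (D : set T) (g : T -> R).

(** An integrable density makes the measure finite, which dominated
    convergence and Schur's test require. *)
Definition fdensity (mD : measurable D) (ig : mu.-integrable D (EFin \o g))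
   (g0 : forall x, D x -> (0 <= g x)%R) : set T -> \bar R :=
  density mu mD ((measurable_EFinP _ _).1 (measurable_int _ ig)) g0.

Hypotheses (mD : measurable D) (ig : mu.-integrable D (EFin \o g))
   (g0 : forall x, D x -> (0 <= g x)%R).

HB.instance Definition _ := Measure.on (fdensity mD ig g0).

Let fin_dens : fin_num_fun (fdensity mD ig g0).
Proof.
move=> A mA; rewrite ge0_fin_numE//.
have mDA : measurable (A `&` D) by exact: measurableI.
have /integrableP[_] := integrableS mD mDA (@subIsetr _ A D) ig.
apply: le_lt_trans; rewrite /fdensity /density.
by apply: ge0_le_integral => //; [
  move=> x [_ Dx]; rewrite lee_fin g0 |
  have := measurable_int _ ig; apply: measurable_funS => // x []|
  apply: measurableT_comp => //;
  have := measurable_int _ ig; apply: measurable_funS => // x []|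
  move=> x _; rewrite /= lee_fin ler_norm].
Qed.

HB.instance Definition _ := Measure_isFinite.Build _ _ _ (fdensity mD ig g0) fin_dens.

End fdensity.

Section polar.
Local Open Scope ereal_scope.
Context (R : realType).
Local Notation leb := (@lebesgue_measure R).
Local Notation M := (measurableTypeR R).
Local Notation half := (`](- (pi / 2))%R, (pi / 2)%R[%classic : set R).

(** The functions used below are extended by zero, so that every integral
    runs over the whole line. *)
Definition pos (x : R) : R := (0 < x)%R%:R.
Definition tanh0 : R -> R := (@tan R) \_ half.
Definition sec2h : R -> R := (fun x => cos x ^- 2)%R \_ half.
Definition indh : R -> R := \1_half.

Let mpos : measurable_fun [set: M] pos.
Proof.
rewrite (_ : pos = \1_`]0%R, +oo[); first exact: measurable_indic.
by apply/funext => x; rewrite indicE /pos mem_setE in_itv/= andbT.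
Qed.
Let mtanh0 : measurable_fun [set: M] tanh0.
Proof. by apply/(measurable_restrictT _ _).1 => //; exact: measurable_tan_half. Qed.
Let msec2h : measurable_fun [set: M] sec2h.
Proof. by apply/(measurable_restrictT _ _).1 => //; exact: measurable_sec2_half. Qed.
Let mindh : measurable_fun [set: M] indh.
Proof. exact: measurable_indic. Qed.
Let msin : measurable_fun [set: M] (@sin R).
Proof. apply: continuous_measurable_fun; exact: continuous_sin. Qed.
Let mcos : measurable_fun [set: M] (@cos R).
Proof. apply: continuous_measurable_fun; exact: continuous_cos. Qed.

Let pos_ge0 x : (0 <= pos x)%R. Proof. by []. Qed.
Let sec2h_ge0 x : (0 <= sec2h x)%R.
Proof. by rewrite /sec2h patchE; case: ifPn => // _; rewrite invr_ge0 sqr_ge0. Qed.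
Let indh_ge0 x : (0 <= indh x)%R. Proof. by rewrite /indh indicE. Qed.
Let posx_ge0 x : (0 <= pos x * x)%R.
Proof. by rewrite /pos; case: ltP => [/ltW|]; rewrite ?mul1r ?mul0r. Qed.

Let integral_tanT (f : R -> \bar R) :
  measurable_fun [set: M] f -> (forall r, 0 <= f r) ->
  \int[leb]_y f y = \int[leb]_x (f (tanh0 x) * (sec2h x)%:E).
Proof.
move=> mf f0; rewrite ge0_integral_tan// integral_mkcond; apply: eq_integral => x _.
by rewrite /tanh0 /sec2h !patchE; case: ifPn => // _; rewrite mule0.
Qed.

(** At fixed x substitute y = x tan t, exchange the two integrals, and at
    fixed t substitute x = r cos t: the Jacobians x / (cos t)^2 and cos t
    multiply to r. *)
Lemma half_plane_polar (f : M * M -> \bar R) : measurable_fun [set: M * M] f ->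
  (forall p, 0 <= f p) ->
  \int[leb]_x \int[leb]_y (f (x, y) * (pos x)%:E) =
  \int[leb]_t \int[leb]_r (f (r * cos t, r * sin t)%R * (pos r * r * indh t)%:E).
Proof.
move=> mf f0.
pose G (p : M * M) := f (p.1, p.1 * tanh0 p.2)%R * (pos p.1 * p.1 * sec2h p.2)%:E.
have mG : measurable_fun setT G.
  apply: emeasurable_funM.
    apply: measurableT_comp => //; apply/measurable_fun_pairP; split => /=; first exact: measurable_fst.
    by apply: measurable_funM; [exact: measurable_fst|exact: measurableT_comp].
  apply/measurable_EFinP; apply: measurable_funM; last exact: measurableT_comp.
  by apply: measurable_funM; [exact: measurableT_comp|exact: measurable_fst].
have G0 p : 0 <= G p by rewrite mule_ge0// lee_fin mulr_ge0.
have mfx x : measurable_fun [set: M] (fun y => f (x, y)) by exact: measurableT_comp.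
transitivity (\int[leb]_x \int[leb]_t G (x, t)).
  apply: eq_integral => x _; rewrite /G/= /pos; case: ltP => x0; last first.
    by rewrite /= integral0_eq ?integral0_eq// => y _; rewrite ?mule0// !mul0r mule0.
  under eq_integral do rewrite mule1.
  rewrite (ge0_integral_affine 0 x0)//.
  rewrite integral_tanT; last 2 first.
  - apply: emeasurable_funM => //; apply: measurableT_comp => //.
    apply/measurable_fun_pairP; split; first exact: measurable_cst.
    by apply: measurable_funD => //; exact: measurable_funM.
  - by move=> y; rewrite mule_ge0// lee_fin ltW.
  by apply: eq_integral => t _; rewrite addr0 -muleA -EFinM mul1r.
transitivity (\int[leb]_t \int[leb]_x G (x, t)); first exact: (fubini_tonelli G mG G0).
apply: eq_integral => t _; rewrite /G /=.
have [ht|ht] := boolP (t \in half); last first.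
  by rewrite integral0_eq ?integral0_eq// => r _; rewrite /indh /sec2h ?indicE ?patchE (negbTE ht) !mulr0 mule0.
have ct : (0 < cos t)%R by apply: cos_half; move: ht; rewrite inE.
rewrite (ge0_integral_affine 0 ct); last 2 first.
- apply: emeasurable_funM.
    apply: measurableT_comp => //; apply/measurable_fun_pairP; split; first exact: measurable_id.
    exact: measurable_funM.
  by apply/measurable_EFinP; apply: measurable_funM => //; apply: measurable_funM.
- by move=> x; rewrite mule_ge0// lee_fin mulr_ge0.
apply: eq_integral => r _; rewrite addr0 -muleA -EFinM; congr (f (_, _) * _%:E).
- by rewrite mulrC.
- by rewrite /tanh0 patchE ht /tan; field; rewrite gt_eqF.
- rewrite /sec2h patchE ht /indh indicE ht /pos pmulr_rgt0//.
  rewrite mulr1; move: ((0 < r)%R%:R : R) => e.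
  by field; rewrite gt_eqF.
Qed.

(** One period, cut so that it is the range of angles of the right half-plane
    followed by its translate by pi. *)
Definition circ : set M := `[(- (pi / 2))%R, (pi / 2 + pi)%R].

Lemma measurable_circ : measurable circ. Proof. exact: measurable_itv. Qed.

(** The map p |-> - p carries the left half-plane to the right one and shifts
    the angle by pi. *)
Lemma polar (f : M * M -> \bar R) : measurable_fun [set: M * M] f ->
  (forall p, 0 <= f p) ->
  \int[(leb \x leb)]_p f p =
  \int[leb]_(t in circ) \int[leb]_r (f (r * cos t, r * sin t)%R * (pos r * r)%:E).
Proof.
move=> mf f0.
pose H t := \int[leb]_r (f (r * cos t, r * sin t)%R * (pos r * r)%:E).
have mH : measurable_fun setT H.
  pose g (p : M * M) := (f (p.2 * cos p.1, p.2 * sin p.1)%R * (pos p.2 * p.2)%:E).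
  apply: (measurable_fun_fubini_tonelli_F g).
  - apply: emeasurable_funM.
      apply: measurableT_comp => //; apply/measurable_fun_pairP; split => /=;
        by apply: measurable_funM; [exact: measurable_snd|exact: measurableT_comp].
    by apply/measurable_EFinP; apply: measurable_funM; [exact: measurableT_comp|exact: measurable_snd].
  - by move=> p; rewrite mule_ge0// lee_fin.
have H0 t : 0 <= H t by apply: integral_ge0 => r _; rewrite mule_ge0// lee_fin.
have mg t : measurable_fun [set: M] (fun r => f (r * cos t, r * sin t)%R * (pos r * r)%:E).
  apply: emeasurable_funM.
    by apply: measurableT_comp => //; apply/measurable_fun_pairP; split => /=; exact: measurable_funM.
  by apply/measurable_EFinP; exact: measurable_funM.
have hp (g : M * M -> \bar R) (mg' : measurable_fun setT g) (g0 : forall p, 0 <= g p) :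
   \int[leb]_x \int[leb]_y (g (x, y) * (pos x)%:E) =
   \int[leb]_(t in half) \int[leb]_r (g (r * cos t, r * sin t)%R * (pos r * r)%:E).
  rewrite (half_plane_polar mg' g0) [RHS]integral_mkcond; apply: eq_integral => t _.
  rewrite patchE; case: ifPn => ht.
    by apply: eq_integral => r _; rewrite /indh indicE ht mulr1.
  by apply: integral0_eq => r _; rewrite /indh indicE (negbTE ht) mulr0 mule0.
have mfx x : measurable_fun [set: M] (fun y => f (x, y)) by exact: measurableT_comp.
pose F x := \int[leb]_y f (x, y).
have mF : measurable_fun [set: M] F by exact: measurable_fun_fubini_tonelli_F.
have F0 x : 0 <= F x by exact: integral_ge0.
have -> : \int[(leb \x leb)]_p f p = \int[leb]_x (F x * (pos x)%:E) + \int[leb]_x (F x * (pos (- x))%:E).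
  rewrite fubini_tonelli1// -ge0_integralD//; last 4 first.
  - by move=> x _; rewrite mule_ge0// lee_fin.
  - by apply: emeasurable_funM => //; exact/measurable_EFinP.
  - by move=> x _; rewrite mule_ge0// lee_fin.
  - by apply: emeasurable_funM => //; apply/measurable_EFinP; exact: measurableT_comp.
  have mT0 : measurable ([set: M] `\ 0%R) by rewrite setTD; exact: measurableC.
  rewrite -(@integral_setD1 _ _ 0%R)//; last exact: measurable_funTS.
  rewrite -[RHS](@integral_setD1 _ _ 0%R)//; last first.
    apply: measurable_funTS; apply: emeasurable_funD;
    by apply: emeasurable_funM => //; apply/measurable_EFinP => //; exact: measurableT_comp.
  apply: eq_integral => x /[!inE] -[_ /eqP x0].
  rewrite /fubini_F -/(F x) /pos oppr_gt0; case: ltgtP x0 => //= _ _; rewrite mule1 mule0 ?adde0 ?add0e//.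
have -> : \int[leb]_x (F x * (pos x)%:E) = \int[leb]_(t in half) H t.
  rewrite -hp//; apply: eq_integral => x _; rewrite /F ge0_integralZr// lee_fin//.
have -> : \int[leb]_x (F x * (pos (- x))%:E) = \int[leb]_(t in half) H (t + pi)%R.
  rewrite ge0_integral_oppr; last 2 first.
  - by apply: emeasurable_funM => //; apply/measurable_EFinP; exact: measurableT_comp.
  - by move=> x; rewrite mule_ge0// lee_fin.
  transitivity (\int[leb]_x \int[leb]_y (f (- x, - y)%R * (pos x)%:E)).
    apply: eq_integral => x _; rewrite opprK /F ge0_integral_oppr// ge0_integralZr ?lee_fin//.
    by apply: (measurableT_comp (mfx (- x)%R)).
  pose g (p : M * M) := f (- p.1, - p.2)%R.
  have mg' : measurable_fun setT g.
    apply: measurableT_comp => //; apply: measurable_fun_pair.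
      by apply: measurable_funN; exact: measurable_fst.
    by apply: measurable_funN; exact: measurable_snd.
  apply: etrans (hp g mg' (fun p => f0 _)) _.
  apply: eq_integral => t _; apply: eq_integral => r _ /=.
  by rewrite cosDpi sinDpi !mulrN.
rewrite -/(H _).
have -> : \int[leb]_(t in half) H (t + pi)%R = \int[leb]_(t in `](pi / 2)%R, (pi / 2 + pi)%R[) H t.
  rewrite integral_mkcond [RHS]integral_mkcond [RHS](ge0_integral_affine pi ltr01); last 2 first.
  - by apply/(measurable_restrictT _ _).1 => //; exact: measurable_funTS.
  - by move=> x; rewrite patchE; case: ifPn.
  apply: eq_integral => t _; rewrite mule1 mul1r !patchE !mem_setE !in_itv/= ltrD2r.
  rewrite -ltrBlDr (_ : pi / 2 - pi = - (pi / 2))%R//; lra.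
have pi0 := @pi_gt0 R.
rewrite /circ (@itv_bndbnd_setU _ _ (BLeft (- (pi / 2))%R) (BRight (pi / 2)%R)); last 2 first.
- by rewrite bnd_simp; lra.
- by rewrite bnd_simp; lra.
rewrite ge0_integral_setU//; last 2 first.
- by move=> t _; exact: H0.
- apply/disj_setPLR => x /=; rewrite !in_itv/= => /andP[_ h] /andP[h2 _].
  by move: h; rewrite leNgt h2.
congr (_ + _).
- by apply/esym/integral_itv_bndoo; exact: measurable_funTS.
- by apply/esym/integral_itv_bndoo; exact: measurable_funTS.
by apply: measurable_funS mH => //; exact: measurableT.
Qed.

End polar.

(** * The radial measure of a weight *)

Section circle_measure.
Context (R : realType).
Local Notation leb := (@lebesgue_measure R).
Local Notation M := (measurableTypeR R).

Lemma leb_circ : leb (@circ R) = (2 * pi)%:E.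
Proof.
have pi0 := @pi_gt0 R.
rewrite /circ lebesgue_measure_itv/= lte_fin ifT; last by lra.
by rewrite -EFinB; congr (_%:E); lra.
Qed.

Definition cdens : R -> R := fun=> (2 * pi)^-1.

Fact integrable_cdens : leb.-integrable (@circ R) (EFin \o cdens).
Proof.
rewrite (_ : EFin \o cdens = cst (2 * pi)^-1%:E)//.
apply/integrableP; split; first exact: measurable_cst.
rewrite integral_cst; last exact: (@measurable_circ R).
by rewrite [X in (_ * X)%E]leb_circ -EFinM ltry.
Qed.

Fact cdens_ge0 : forall t : R, circ t -> (0 <= cdens t)%R.
Proof. by move=> t _; rewrite invr_ge0 mulr_ge0// pi_ge0. Qed.

(** Arc length of total mass 1. *)
Definition sigma : {finite_measure set M -> \bar R} :=
  fdensity (@measurable_circ R) integrable_cdens cdens_ge0.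

Lemma ge0_integral_sigma (f : R -> \bar R) : measurable_fun [set: M] f ->
  (forall t, 0 <= f t)%E ->
  (\int[sigma]_t f t = \int[leb]_(t in @circ R) (f t * (2 * pi)^-1%:E))%E.
Proof. by move=> mf f0; rewrite ge0_integral_density// setTI. Qed.

Lemma sigmaT : sigma setT = 1%E.
Proof.
have pi0 := @pi_gt0 R.
rewrite /sigma /= /fdensity /density setTI.
rewrite (@integral_cst _ _ _ _ _ (@measurable_circ R) (2 * pi)^-1%:E).
rewrite [X in (_ * X)%E]leb_circ -EFinM; congr (_%:E).
by rewrite mulVf// gt_eqF// mulr_gt0.
Qed.

End circle_measure.

Section radial_measure.
Context (R : realType).
Local Notation leb := (@lebesgue_measure R).
Local Notation M := (measurableTypeR R).
Variable nu : R[i] -> R.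
Hypothesis rnu : radial_weight nu.

Let v (s : R) := nu (s%:C)%C.
Definition rdens (s : R) := (2 * s * v s)%R.
Definition I01 : set M := `]0, 1[.

Lemma measurable_I01 : measurable I01. Proof. exact: measurable_itv. Qed.
#[local] Hint Resolve measurable_I01 : core.

Lemma modulusE (z : R[i]) : modulus z = Num.sqrt (complex.Re z ^+ 2 + complex.Im z ^+ 2).
Proof. by case: z. Qed.

Lemma modulus_polar (r t : R) : 0 <= r -> modulus (of_plane (r * cos t, r * sin t)) = r.
Proof.
move=> r0; rewrite modulusE /= !exprMn -mulrDr cos2Dsin2 mulr1 sqrtr_sqr ger0_norm//.
Qed.

Lemma modulus_real (r : R) : modulus (r%:C)%C = `|r|.
Proof. by rewrite modulusE /= expr0n addr0 sqrtr_sqr. Qed.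

Lemma measurable_modulus_of_plane :
  measurable_fun [set: M * M] (fun p : M * M => modulus (of_plane p)).
Proof.
under eq_fun do rewrite modulusE.
apply: (measurableT_comp (f := @Num.sqrt R)); first exact: continuous_measurable_fun (@sqrt_continuous R).
by apply: measurable_funD => /=; apply: (measurableT_comp (f := fun x : R => x ^+ 2)) => //.
Qed.

Lemma measurable_planar_disc : measurable (@planar_disc R : set (M * M)).
Proof.
rewrite (_ : @planar_disc R = (fun p : M * M => modulus (of_plane p)) @^-1` `]-oo, 1[).
  rewrite -[X in measurable X]setTI; apply: measurable_modulus_of_plane => //.
by apply/seteqP; split => p /=; rewrite in_itv.
Qed.

Lemma measurable_nu : measurable_fun (@planar_disc R : set (M * M)) (fun p => nu (of_plane p)).
Proof. by case: rnu => -[_ /integrableP[/measurable_EFinP]]. Qed.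

Lemma v_ge0 s : I01 s -> 0 <= v s.
Proof.
case: rnu => -[h _] _ _; rewrite /I01/= in_itv/= => /andP[s0 s1]; apply: h.
by rewrite /disc /= modulus_real ger0_norm// ltW.
Qed.

Lemma measurable_v : measurable_fun I01 v.
Proof.
have -> : v = (fun p => nu (of_plane p)) \o (fun s => (s, 0)) by [].
apply: (measurable_comp measurable_planar_disc) measurable_nu _ => //.
  move=> _ [s + <-]; rewrite /I01/= in_itv/= => /andP[s0 s1].
  by rewrite /planar_disc /disc /= modulus_real ger0_norm// ltW.
by apply/measurable_funTS/measurable_fun_pairP; split; [exact: measurable_id|exact: measurable_cst].
Qed.

Lemma rdens_ge0 s : I01 s -> 0 <= rdens s.
Proof.
move=> h; rewrite mulr_ge0 ?v_ge0//; move: h; rewrite /I01/= in_itv/= => /andP[s0 _].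
by rewrite mulr_ge0// ltW.
Qed.

Lemma measurable_rdens : measurable_fun I01 rdens.
Proof. by apply: measurable_funM; [exact: measurable_funM|exact: measurable_v]. Qed.

(** The end point r is negligible; leaving it out keeps the interval inside
    ]0, 1[ also for r = 0. *)
Lemma hatE r : 0 <= r -> hat nu r = (\int[leb]_(s in `]r, 1%R[) (v s)%:E)%E.
Proof.
move=> r0; rewrite /hat; have mv : measurable_fun `]r, 1[%classic (fun s => (v s)%:E).
  apply/measurable_EFinP; apply: measurable_funS measurable_v => //.
  by move=> x; rewrite /I01/= !in_itv/= => /andP[rx ->]; rewrite andbT (le_lt_trans r0).
by rewrite (integral_itv_bndoo _ _ mv).
Qed.

Lemma integrable_rdens : leb.-integrable I01 (EFin \o rdens).
Proof.
apply/integrableP; split; first by apply/measurable_EFinP; exact: measurable_rdens.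
case: (rnu) => _ _ /(_ 0); rewrite lexx ltr01 => /(_ isT) /andP[_].
rewrite hatE// => hoo.
apply: (@le_lt_trans _ _ (\int[leb]_(s in I01) (2%:E * (v s)%:E))%E).
  apply: ge0_le_integral => //.
  - apply: measurableT_comp => //; apply/measurable_EFinP; exact: measurable_rdens.
  - by apply/measurable_EFinP; apply: measurable_funM => //; exact: measurable_v.
  - move=> s hs /=; rewrite lee_fin ger0_norm ?rdens_ge0// /rdens.
    rewrite ler_wpM2r ?v_ge0// ler_piMr//.
    by move: hs; rewrite /I01/= in_itv/= => /andP[_ /ltW].
rewrite ge0_integralZl//; last 2 first.
- by apply/measurable_EFinP; exact: measurable_v.
- by move=> s hs; rewrite lee_fin v_ge0.
by rewrite lte_mul_pinfty.
Qed.

(** The radial factor 2 s nu(s) ds of nu dA. *)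
Definition rmeas : {finite_measure set M -> \bar R} :=
  fdensity measurable_I01 integrable_rdens rdens_ge0.

Definition cpoint (p : M * M) : M * M := (p.1 * cos p.2, p.1 * sin p.2).

Lemma measurable_cpoint : measurable_fun setT cpoint.
Proof.
apply: measurable_fun_pair; apply: measurable_funM; try exact: measurable_fst.
  apply: measurableT_comp measurable_snd.
  by apply: continuous_measurable_fun; exact: continuous_cos.
apply: measurableT_comp measurable_snd.
by apply: continuous_measurable_fun; exact: continuous_sin.
Qed.

(** The Jacobian s goes into the density of [rmeas], and the factor 1 / pi of
    dA turns dt into 2 [sigma]. *)
Lemma disc_integral_polar (f : M * M -> \bar R) :
  measurable_fun (@planar_disc R) f -> (forall p, planar_disc p -> 0 <= f p)%E ->
  (\int[@dA R]_(p in @planar_disc R) (f p * (nu (of_plane p))%:E) =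
   \int[rmeas \x sigma R]_p (f \_ (@planar_disc R)) (cpoint p))%E.
Proof.
move=> mf f0.
have mD := measurable_planar_disc.
have nu0 p : planar_disc p -> 0 <= nu (of_plane p) by case: rnu => -[h _] _ _; exact: h.
have mfn : measurable_fun (@planar_disc R) (fun p => f p * (nu (of_plane p))%:E)%E.
  by apply: emeasurable_funM => //; apply/measurable_EFinP; exact: measurable_nu.
have fn0 p : planar_disc p -> (0 <= f p * (nu (of_plane p))%:E)%E.
  by move=> Dp; rewrite mule_ge0 ?f0// lee_fin nu0.
have mF : measurable_fun setT (f \_ (@planar_disc R)) by apply/(measurable_restrictT _ _).1.
have F0 p : (0 <= (f \_ (@planar_disc R)) p)%E.
  by rewrite patchE; case: ifPn => // /[!inE] /f0.
pose G t := (\int[rmeas]_s (f \_ (@planar_disc R)) (cpoint (s, t)))%E.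
have mFc : measurable_fun setT (fun p => (f \_ (@planar_disc R)) (cpoint p)).
  by apply: measurableT_comp => //; exact: measurable_cpoint.
have mG : measurable_fun [set: M] G.
  exact: (measurable_fun_fubini_tonelli_G (fun p => (f \_ (@planar_disc R)) (cpoint p))).
have G0 t : (0 <= G t)%E by exact: integral_ge0.
have GE t : (\int[leb]_r (((fun p => f p * (nu (of_plane p))%:E) \_ (@planar_disc R))
     (r * cos t, r * sin t)%R * (pos r * r)%:E) = G t * (2^-1)%:E)%E.
  have mFt : measurable_fun [set: M] (fun s => (f \_ (@planar_disc R)) (cpoint (s, t))).
    by apply: measurableT_comp => //; apply: (measurableT_comp measurable_cpoint); exact: pair2_measurable.
  rewrite /G ge0_integral_density// setTI -ge0_integralZr//; last 2 first.
  - apply: emeasurable_funM; first exact: measurable_funTS.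
    by apply/measurable_EFinP; exact: measurable_rdens.
  - by move=> s hs; rewrite mule_ge0// lee_fin rdens_ge0.
  rewrite [RHS]integral_mkcond; apply: eq_integral => r _.
  rewrite [RHS]patchE mem_setE in_itv/= /pos.
  have [r0|r0] /= := ltP 0 r; last by rewrite mul0r mule0.
  rewrite mul1r !patchE /cpoint /=.
  have -> : ((r * cos t, r * sin t) \in @planar_disc R) = (r < 1).
    by apply/idP/idP; rewrite inE /planar_disc /disc /= modulus_polar// ltW.
  case: ifPn => r1; last by rewrite mul0e.
  rewrite -!muleA -!EFinM; congr (_ * _%:E)%E.
  have -> : nu (of_plane (r * cos t, r * sin t)) = v r.
    case: rnu => _ rad _; rewrite rad /disc /= modulus_polar// ltW//.
  by rewrite /rdens; field.
rewrite /dA ge0_integral_mscale// integral_mkcond polar; last 2 first.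
- exact/(measurable_restrictT _ _).1.
- by move=> p; rewrite patchE; case: ifPn => // /[!inE] /fn0.
rewrite fubini_tonelli2// ge0_integral_sigma// -/G.
under eq_integral do rewrite GE.
have c1 : (0 <= ((2 * pi)^-1 : R)%:E)%E by rewrite lee_fin invr_ge0 mulr_ge0// pi_ge0.
rewrite !ge0_integralZr//; try exact: measurable_funTS; try exact: (@measurable_circ R).
rewrite muleCA; congr (_ * _)%E; rewrite -EFinM; congr (_%:E) => /=.
by rewrite invfM mulrC.
Qed.

End radial_measure.

(** * Modulus, series and integrals of complex functions *)

Section modulus.
Context (R : realType).
Local Notation C := R[i].
Implicit Types z w : C.
Local Open Scope complex_scope.

Lemma modulus_ge0 z : 0 <= modulus z.
Proof. by rewrite modulusE sqrtr_ge0. Qed.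

Lemma modulus0 : modulus (0 : C) = 0. Proof. exact: Normc.normc0. Qed.

Lemma modulus1 : modulus (1 : C) = 1. Proof. exact: Normc.normc1. Qed.

Lemma modulusM z w : modulus (z * w) = modulus z * modulus w.
Proof. exact: Normc.normcM. Qed.

Lemma modulusV z : modulus (z^-1) = (modulus z)^-1.
Proof. exact: Normc.normcV. Qed.

Lemma modulusD z w : modulus (z + w) <= modulus z + modulus w.
Proof. exact: le_normcD. Qed.

Lemma modulusN z : modulus (- z) = modulus z.
Proof. exact: normcN. Qed.

Lemma modulusX z n : modulus (z ^+ n) = modulus z ^+ n.
Proof. by elim: n => [|n ih]; rewrite ?expr0 ?modulus1// !exprS modulusM ih. Qed.

Lemma modulus_conj z : modulus (conjc z) = modulus z.
Proof. by rewrite !modulusE; case: z => a b /=; rewrite sqrrN. Qed.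

Lemma modulus_eq0 z : (modulus z == 0) = (z == 0).
Proof.
apply/eqP/eqP => [h|->]; last exact: modulus0.
exact: Normc.eq0_normc.
Qed.

Lemma modulus_gt0 z : (0 < modulus z) = (z != 0).
Proof. by rewrite lt0r modulus_ge0 andbT modulus_eq0. Qed.

Lemma Re_modulus z : `|complex.Re z| <= modulus z.
Proof.
rewrite modulusE -sqrtr_sqr ler_wsqrtr// lerDl; exact: sqr_ge0.
Qed.

Lemma Im_modulus z : `|complex.Im z| <= modulus z.
Proof.
rewrite modulusE -sqrtr_sqr ler_wsqrtr// lerDr; exact: sqr_ge0.
Qed.

Lemma modulus_ReIm z : modulus z <= `|complex.Re z| + `|complex.Im z|.
Proof.
rewrite modulusE -[leRHS]ger0_norm ?addr_ge0// -sqrtr_sqr ler_wsqrtr//.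
rewrite sqrrD !real_normK ?num_real//.
have : 0 <= `|complex.Re z| * `|complex.Im z| by rewrite mulr_ge0.
by rewrite -mulr_natl; lra.
Qed.

Lemma modulus_sqr z : modulus z ^+ 2 = complex.Re z ^+ 2 + complex.Im z ^+ 2.
Proof. by rewrite modulusE sqr_sqrtr// addr_ge0// sqr_ge0. Qed.

Lemma ler_modulus_sum I (r : seq I) (P : pred I) (f : I -> C) :
  modulus (\sum_(i <- r | P i) f i) <= \sum_(i <- r | P i) modulus (f i).
Proof.
elim/big_ind2 : _ => [|x1 x2 y1 y2 h1 h2|//]; first by rewrite modulus0.
exact: le_trans (modulusD _ _) (lerD _ _).
Qed.

Lemma ReD z w : complex.Re (z + w) = complex.Re z + complex.Re w.
Proof. by case: z w => [a b] []. Qed.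
Lemma ImD z w : complex.Im (z + w) = complex.Im z + complex.Im w.
Proof. by case: z w => [a b] []. Qed.
Lemma ReN z : complex.Re (- z) = - complex.Re z. Proof. by case: z. Qed.
Lemma ImN z : complex.Im (- z) = - complex.Im z. Proof. by case: z. Qed.
Lemma ReM z w : complex.Re (z * w) = complex.Re z * complex.Re w - complex.Im z * complex.Im w.
Proof. by case: z w => [a b] []. Qed.
Lemma ImM z w : complex.Im (z * w) = complex.Re z * complex.Im w + complex.Im z * complex.Re w.
Proof. by case: z w => [a b] []. Qed.
Lemma Re_sum I (r : seq I) (P : pred I) (f : I -> C) :
  complex.Re (\sum_(i <- r | P i) f i) = \sum_(i <- r | P i) complex.Re (f i).
Proof. by elim/big_ind2 : _ => // x1 x2 y1 y2 <- <-; rewrite ReD. Qed.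
Lemma Im_sum I (r : seq I) (P : pred I) (f : I -> C) :
  complex.Im (\sum_(i <- r | P i) f i) = \sum_(i <- r | P i) complex.Im (f i).
Proof. by elim/big_ind2 : _ => // x1 x2 y1 y2 <- <-; rewrite ImD. Qed.

Lemma complex_eqP z w : complex.Re z = complex.Re w -> complex.Im z = complex.Im w -> z = w.
Proof. by case: z w => [a b] [c d] /= -> ->. Qed.

End modulus.

Section csums.
Context (R : realType).
Local Notation C := R[i].
Implicit Types (u v : nat -> C) (s z : C).
Local Open Scope complex_scope.

(** Convergence of the real and the imaginary parts, so that theorems on real
    series apply to each. *)
Definition csums u s :=
  (series (fun k => complex.Re (u k)) n @[n --> \oo] --> complex.Re s) /\
  (series (fun k => complex.Im (u k)) n @[n --> \oo] --> complex.Im s).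

Definition csum u : C :=
  limn (series (fun k => complex.Re (u k))) +i* limn (series (fun k => complex.Im (u k))).

Definition csummable u := cvgn (series (fun k => modulus (u k))).

Lemma csums_csum u s : csums u s -> csum u = s.
Proof.
move=> [h1 h2]; apply: complex_eqP => /=.
- exact: (cvg_lim (@Rhausdorff R) h1).
- exact: (cvg_lim (@Rhausdorff R) h2).
Qed.

Lemma csums_unique u s s' : csums u s -> csums u s' -> s = s'.
Proof. by move=> /csums_csum <- /csums_csum. Qed.

Lemma csummableP u : csummable u -> csums u (csum u).
Proof.
move=> su; split.
- apply: (@normed_cvg R) => /=; apply: (series_le_cvg _ _ _ su) => n /=.
  + exact: normr_ge0.
  + exact: modulus_ge0.
  + exact: Re_modulus.
- apply: (@normed_cvg R) => /=; apply: (series_le_cvg _ _ _ su) => n /=.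
  + exact: normr_ge0.
  + exact: modulus_ge0.
  + exact: Im_modulus.
Qed.

Lemma csummable_le u (w : nat -> R) : (forall n, modulus (u n) <= w n) ->
  cvgn (series w) -> csummable u.
Proof.
move=> uw cw; apply: (series_le_cvg _ _ _ cw) => n //; first exact: modulus_ge0.
by apply: le_trans (uw n); exact: modulus_ge0.
Qed.

Lemma rseriesD (f g : nat -> R) (a b : R) : series f n @[n --> \oo] --> a ->
  series g n @[n --> \oo] --> b ->
  series (fun n => f n + g n) n @[n --> \oo] --> a + b.
Proof.
move=> fa gb; rewrite (_ : series _ = series f \+ series g); first exact: cvgD.
by apply/funext => n; rewrite /series /= big_split.
Qed.

Lemma rseriesZ (f : nat -> R) (k a : R) : series f n @[n --> \oo] --> a ->
  series (fun n => k * f n) n @[n --> \oo] --> k * a.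
Proof.
move=> fa; rewrite (_ : series _ = (fun n => k * series f n)).
  by apply: cvgM => //; exact: cvg_cst.
by apply/funext => n; rewrite /series /= mulr_sumr.
Qed.

Lemma csumsD u v s s' : csums u s -> csums v s' -> csums (fun n => u n + v n) (s + s').
Proof.
move=> [h1 h2] [h3 h4]; split.
- by rewrite ReD; under [X in series X]eq_fun do rewrite ReD; exact: rseriesD.
- by rewrite ImD; under [X in series X]eq_fun do rewrite ImD; exact: rseriesD.
Qed.

Lemma csumsZ z u s : csums u s -> csums (fun n => z * u n) (z * s).
Proof.
move=> [h1 h2]; split.
- rewrite ReM -mulNr; under [X in series X]eq_fun do rewrite ReM -mulNr.
  by apply: rseriesD; exact: rseriesZ.
- rewrite ImM; under [X in series X]eq_fun do rewrite ImM.
  by apply: rseriesD; exact: rseriesZ.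
Qed.

Lemma csums_conj u s : csums u s -> csums (fun n => (conjc (u n))) (conjc s).
Proof.
have Rec z : complex.Re (conjc z) = complex.Re z by case: z.
have Imc z : complex.Im (conjc z) = - 1 * complex.Im z by case: z => a b /=; rewrite mulN1r.
move=> [h1 h2]; split.
- by rewrite Rec; under [X in series X]eq_fun do rewrite Rec.
- by rewrite Imc; under [X in series X]eq_fun do rewrite Imc; exact: rseriesZ.
Qed.

Lemma csums_modulus_cvg u s : csums u s ->
  modulus (\sum_(0 <= k < n) u k - s) @[n --> \oo] --> (0 : R).
Proof.
move=> [h1 h2].
have h3 : `|series (fun k => complex.Re (u k)) n - complex.Re s| +
   `|series (fun k => complex.Im (u k)) n - complex.Im s| @[n --> \oo] --> (0 : R).
  have key (f : nat -> R) (a : R) : f n @[n --> \oo] --> a -> `|f n - a| @[n --> \oo] --> (0 : R).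
    move=> fa; have h4 : f n - a @[n --> \oo] --> (0 : R).
      by rewrite -(subrr a); apply: cvgB => //; exact: cvg_cst.
    by move/cvg_norm : h4; rewrite normr0.
  by rewrite -[X in _ --> X]addr0; apply: cvgD; exact: key.
apply: (squeeze_cvgr _ (@cvg_cst _ (0 : R) _ \oo _) h3).
near=> n; rewrite modulus_ge0/=.
apply: le_trans (modulus_ReIm _) _; rewrite ReD ImD ReN ImN Re_sum Im_sum //.
Unshelve. all: by end_near. Qed.

Lemma csums_ext u v s : (forall n, u n = v n) -> csums u s -> csums v s.
Proof. by move=> /funext ->. Qed.

(** A partial sum is bounded by that of w, and the modulus of s exceeds it by
    at most a null sequence. *)
Lemma csums_bound u s (w : nat -> R) W : csums u s -> (forall n, modulus (u n) <= w n) ->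
  series w n @[n --> \oo] --> W -> modulus s <= W.
Proof.
move=> us uw wW; apply/ler_addgt0Pr => e e0.
have w0 n : 0 <= w n by apply: le_trans (uw n); exact: modulus_ge0.
have /cvgrPdist_le /(_ _ e0) [N _ hN] := csums_modulus_cvg us.
have := hN N (leqnn N); rewrite /= sub0r normrN ger0_norm ?modulus_ge0// => hN'.
have -> : s = \sum_(0 <= k < N) u k - (\sum_(0 <= k < N) u k - s) by rewrite subKr.
apply: le_trans (modulusD _ _) _; rewrite modulusN; apply: lerD hN'.
apply: le_trans (ler_modulus_sum _ _ _) _.
apply: le_trans (_ : series w N <= _).
  by apply: ler_sum.
rewrite -(cvg_lim (@Rhausdorff R) wW); apply: nondecreasing_cvgn_le.
  by apply: nondecreasing_series => n _ _.
by apply/cvg_ex; exists W.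
Qed.

Lemma csums_shift u s : csums u s ->
  csums (fun n => if n is m.+1 then u m else 0) s.
Proof.
have key (f : nat -> R) (a : R) : series f n @[n --> \oo] --> a ->
   series (fun n => if n is m.+1 then f m else 0) n @[n --> \oo] --> a.
  move=> fa; rewrite -(cvg_shiftS _); apply: cvg_trans fa.
  apply: near_eq_cvg; near=> n.
  by rewrite /series /= big_nat_recl//= add0r.
move=> [h1 h2]; split.
- move/key : h1; rewrite (_ : (fun n => match n with 0 => 0 | m.+1 => complex.Re (u m) end) =
    (fun n => complex.Re (match n with 0 => 0 | m.+1 => u m end)))//.
  by apply/funext => -[].
- move/key : h2; rewrite (_ : (fun n => match n with 0 => 0 | m.+1 => complex.Im (u m) end) =
    (fun n => complex.Im (match n with 0 => 0 | m.+1 => u m end)))//.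
  by apply/funext => -[].
Unshelve. all: by end_near. Qed.

Lemma csums_geometric z : modulus z < 1 -> csums (fun n => z ^+ n) (1 - z)^-1.
Proof.
move=> z1; have su : csummable (fun n => z ^+ n).
  apply: (@csummable_le _ (fun n => modulus z ^+ n)); first by move=> n; rewrite modulusX.
  have := @is_cvg_geometric_series R 1 (modulus z); rewrite ger0_norm ?modulus_ge0// => /(_ z1).
  by congr (cvgn (series _)); apply/funext => n; rewrite /= mul1r.
have h := csummableP su.
have z1' : 1 - z != 0.
  by rewrite subr_eq0; apply: contraTneq z1 => <-; rewrite modulus1 ltxx.
suff -> : (1 - z)^-1 = csum (fun n => z ^+ n) by [].
apply: (mulfI z1'); rewrite mulfV//.
rewrite mulrBl mul1r; apply: (@csums_unique (fun n => (n == 0%N)%:R)).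
  have key (f : nat -> R) : (forall n, f n.+1 = 0) -> series f n @[n --> \oo] --> f 0%N.
    move=> f0; rewrite -(cvg_shiftS _).
    apply: cvg_near_cst; near=> n.
    by rewrite /series /= big_nat_recl//= big1 ?addr0// => i _; rewrite f0.
  by split; apply: key.
have h2 := csumsZ (-1) (csums_shift (csumsZ z h)).
have := csumsD h h2; rewrite mulN1r; apply: csums_ext => -[|n] /=.
  by rewrite expr0 mulr0 addr0.
by rewrite mulN1r exprS subrr.
Unshelve. all: by end_near. Qed.

End csums.

Section cint.
Context d (T : measurableType d) (R : realType) (mu : {measure set T -> \bar R}).
Variable D : set T.
Hypothesis mD : measurable D.
Local Notation C := R[i].
Implicit Types f g : T -> C.
Local Open Scope complex_scope.

Definition cint f : C := Rintegral mu D (fun x => complex.Re (f x)) +i*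
   Rintegral mu D (fun x => complex.Im (f x)).
Definition cmeas f := measurable_fun D (fun x => complex.Re (f x)) /\
   measurable_fun D (fun x => complex.Im (f x)).
Definition cintble f := mu.-integrable D (fun x => (complex.Re (f x))%:E) /\
   mu.-integrable D (fun x => (complex.Im (f x))%:E).

Lemma eq_cint f g : (forall x, D x -> f x = g x) -> cint f = cint g.
Proof.
by move=> fg; rewrite /cint; congr (_ +i* _); apply: eq_Rintegral => x /[!inE] /fg ->.
Qed.

Lemma eq_cintble f g : (forall x, D x -> f x = g x) -> cintble f -> cintble g.
Proof.
by move=> fg [h1 h2]; split; [apply: eq_integrable h1|apply: eq_integrable h2] => // x /[!inE] /fg ->.
Qed.

Lemma eq_cmeas f g : (forall x, D x -> f x = g x) -> cmeas f -> cmeas g.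
Proof.
by move=> fg [h1 h2]; split; [apply: eq_measurable_fun h1|apply: eq_measurable_fun h2] => x /[!inE] /fg ->.
Qed.

Lemma cmeasM f g : cmeas f -> cmeas g -> cmeas (fun x => f x * g x).
Proof.
move=> [h1 h2] [h3 h4]; split; under eq_fun do rewrite ?ReM ?ImM.
- by apply: measurable_funB; exact: measurable_funM.
- by apply: measurable_funD; exact: measurable_funM.
Qed.

Lemma cmeas_cst (c : C) : cmeas (fun=> c).
Proof. by split; exact: measurable_cst. Qed.

Lemma cmeas_real (h : T -> R) : measurable_fun D h -> cmeas (fun x => (h x)%:C).
Proof. by move=> mh; split => //=; exact: measurable_cst. Qed.

Lemma cmeas_conj f : cmeas f -> cmeas (fun x => (conjc (f x))).
Proof.
move=> [h1 h2]; split.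
- by apply: eq_measurable_fun h1 => x _; case: (f x).
- have := measurable_funN h2; apply: eq_measurable_fun => x _ /=; by case: (f x).
Qed.

Lemma cmeasX f n : cmeas f -> cmeas (fun x => f x ^+ n).
Proof.
move=> mf; elim: n => [|n ih]; first exact: cmeas_cst.
by apply: eq_cmeas (cmeasM mf ih) => x _; rewrite exprS.
Qed.

Lemma measurable_modulus f : cmeas f -> measurable_fun D (fun x => modulus (f x)).
Proof.
move=> [h1 h2]; under eq_fun do rewrite modulusE.
apply: (measurableT_comp (f := @Num.sqrt R)); first exact: continuous_measurable_fun (@sqrt_continuous R).
by apply: measurable_funD; exact: measurable_funX.
Qed.

Lemma cintble_meas f : cintble f -> cmeas f.
Proof.
by move=> [/measurable_int/measurable_EFinP h1 /measurable_int/measurable_EFinP h2].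
Qed.

Lemma cintble_le f (h : T -> R) : cmeas f -> mu.-integrable D (EFin \o h) ->
  (forall x, D x -> modulus (f x) <= h x) -> cintble f.
Proof.
move=> [h1 h2] ih fh; split.
- apply: (le_integrable mD _ _ ih); first exact/measurable_EFinP.
  move=> x Dx /=; rewrite lee_fin; apply: le_trans (Re_modulus _) _.
  by apply: le_trans (fh _ Dx) (ler_norm _).
- apply: (le_integrable mD _ _ ih); first exact/measurable_EFinP.
  move=> x Dx /=; rewrite lee_fin; apply: le_trans (Im_modulus _) _.
  by apply: le_trans (fh _ Dx) (ler_norm _).
Qed.

Lemma integrable_modulus f : cintble f -> mu.-integrable D (fun x => (modulus (f x))%:E).
Proof.
move=> cf; have [i1 i2] := cf.
have i3 := integrableD mD (integrable_abse i1) (integrable_abse i2).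
apply: (le_integrable mD _ _ i3).
  by apply/measurable_EFinP/measurable_modulus/cintble_meas.
move=> x Dx /=; rewrite lee_fin ger0_norm ?modulus_ge0//.
by apply: le_trans (modulus_ReIm _) (ler_norm _).
Qed.

Lemma cintbleZ (a : C) f : cintble f -> cintble (fun x => a * f x).
Proof.
move=> [h1 h2]; split.
- have := integrableB mD (integrableZl mD (complex.Re a) h1) (integrableZl mD (complex.Im a) h2).
  by apply: eq_integrable => // x _; rewrite ReM EFinB !EFinM.
- have := integrableD mD (integrableZl mD (complex.Re a) h2) (integrableZl mD (complex.Im a) h1).
  by apply: eq_integrable => // x _; rewrite ImM EFinD !EFinM.
Qed.

Lemma cintD f g : cintble f -> cintble g -> cint (fun x => f x + g x) = cint f + cint g.
Proof.
move=> [h1 h2] [h3 h4]; apply: complex_eqP; rewrite ?ReD ?ImD /=.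
- by under eq_Rintegral do rewrite ReD; rewrite RintegralD.
- by under eq_Rintegral do rewrite ImD; rewrite RintegralD.
Qed.

Lemma cintZ (a : C) f : cintble f -> cint (fun x => a * f x) = a * cint f.
Proof.
have Zl (r : R) (h : T -> R) : mu.-integrable D (fun x => (h x)%:E) ->
  mu.-integrable D (EFin \o (fun x => r * h x)).
  by move=> ih; apply: eq_integrable (integrableZl mD r ih) => // x _; rewrite /= EFinM.
move=> [h1 h2]; apply: complex_eqP; rewrite ?ReM ?ImM /=.
- under eq_Rintegral do rewrite ReM.
  by rewrite RintegralB//; [rewrite !RintegralZl|exact: Zl|exact: Zl].
- under eq_Rintegral do rewrite ImM.
  by rewrite RintegralD//; [rewrite !RintegralZl|exact: Zl|exact: Zl].
Qed.

Lemma cint_conj f : cintble f -> cint (fun x => (conjc (f x))) = (conjc (cint f)).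
Proof.
move=> [h1 h2]; apply: complex_eqP => /=.
- by apply: eq_Rintegral => x _; case: (f x).
- rewrite -mulN1r -RintegralZl//; apply: eq_Rintegral => x _.
  by case: (f x) => a b /=; rewrite mulN1r.
Qed.

(** Multiply by a number of modulus 1 that makes the integral nonnegative;
    then only real parts matter, and they are at most the moduli. *)
Lemma modulus_cint f : cintble f -> modulus (cint f) <= Rintegral mu D (fun x => modulus (f x)).
Proof.
move=> cf; set I := cint f; have [I0|I0] := eqVneq I 0.
  rewrite I0 modulus0; apply: Rintegral_ge0 => x _; exact: modulus_ge0.
pose a : C := (conjc I) / (modulus I)%:C.
have mI0 : modulus I != 0 by rewrite modulus_eq0.
have aI : a * I = (modulus I)%:C.
  rewrite /a mulrAC; have -> : (conjc I) * I = (modulus I ^+ 2)%:C.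
    rewrite modulus_sqr; case: I {I0 a mI0} => x y; apply: complex_eqP => /=; ring.
  by rewrite -[X in _ / X]/(real_complex R (modulus I)) -fmorphV -rmorphM/= expr2 mulfK.
have a1 : modulus a = 1.
  by rewrite /a modulusM modulusV modulus_conj modulus_real ger0_norm ?modulus_ge0// mulfV.
have -> : modulus I = Rintegral mu D (fun x => complex.Re (a * f x)).
  by rewrite -[LHS]/(complex.Re (modulus I)%:C) -aI -cintZ.
apply: le_Rintegral => //.
- by case: (cintbleZ a cf).
- exact: integrable_modulus.
- move=> x _; apply: le_trans (ler_norm _) _; apply: le_trans (Re_modulus _) _.
  by rewrite modulusM a1 mul1r.
Qed.

(** Dominated convergence for the partial sums: the mass is finite, so the
    constant sum of the u n is integrable. *)
Lemma Rintegral_series (h : nat -> T -> R) (H : T -> R) (u : nat -> R) :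
  (mu D < +oo)%E -> (forall n, measurable_fun D (h n)) -> (forall n, 0 <= u n) ->
  (forall n x, D x -> `|h n x| <= u n) -> cvgn (series u) ->
  (forall x, D x -> series (fun k => h k x) n @[n --> \oo] --> H x) ->
  mu.-integrable D (EFin \o H) /\
  series (fun n => Rintegral mu D (h n)) n @[n --> \oo] --> Rintegral mu D H.
Proof.
move=> muD mh u0 hu cu hH.
have icst (c : R) : mu.-integrable D (EFin \o cst c).
  apply/integrableP; split; first exact/measurable_EFinP/measurable_cst.
  under eq_integral do rewrite /=.
  by rewrite integral_cst// lte_mul_pinfty.
have ih n : mu.-integrable D (EFin \o h n).
  apply: (le_integrable mD _ _ (icst (u n))); first exact/measurable_EFinP.
  by move=> x Dx; rewrite /= lee_fin; apply: le_trans (hu n x Dx) (ler_norm _).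
have ms n : measurable_fun D (fun x => series (h ^~ x) n).
  by rewrite /series; apply: measurable_sum => i; exact: mh.
have mH : measurable_fun D H by exact: (measurable_fun_cvg ms hH).
have := @dominated_convergence _ T R mu D mD (fun n x => (series (h ^~ x) n)%:E) (EFin \o H)
   (EFin \o cst (limn (series u))).
case.
- by move=> n; exact/measurable_EFinP.
- exact/measurable_EFinP.
- by apply: aeW => x Dx; apply: cvg_EFin; [exact: nearW|exact: hH].
- exact: icst.
- apply: aeW => x n Dx; rewrite /= lee_fin; apply: (@le_trans _ _ (series u n)).
    by apply: le_trans (ler_norm_sum _ _ _) _; apply: ler_sum => i _; exact: hu.
  apply: nondecreasing_cvgn_le => //.
  by apply: nondecreasing_series => n' _ _.
move=> iH _ hcvg; split => //.
have -> : series (fun n => Rintegral mu D (h n)) =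
    fun n => fine (\int[mu]_(x in D) (series (h ^~ x) n)%:E).
  apply/funext => n; rewrite /series /=.
  under [in RHS]eq_integral do rewrite -sumEFin.
  have fi i : (\int[mu]_(x in D) (h i x)%:E)%E \is a fin_num by have := integrable_fin_num mD (ih i).
  by rewrite integral_sum// -[in RHS]sum_fine.
apply: fine_cvg => /=; rewrite fineK//; exact: integrable_fin_num.
Qed.

Lemma cint_series (h : nat -> T -> C) (H : T -> C) (u : nat -> R) :
  (mu D < +oo)%E -> (forall n, cmeas (h n)) -> (forall n, 0 <= u n) ->
  (forall n x, D x -> modulus (h n x) <= u n) -> cvgn (series u) ->
  (forall x, D x -> csums (fun k => h k x) (H x)) ->
  cintble H /\ csums (fun n => cint (h n)) (cint H).
Proof.
move=> muD mh u0 hu cu hH.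
have [] := @Rintegral_series (fun n x => complex.Re (h n x)) (fun x => complex.Re (H x)) u muD.
- by move=> n; case: (mh n).
- by [].
- by move=> n x Dx; apply: le_trans (Re_modulus _) _; exact: hu.
- by [].
- by move=> x /hH [].
move=> i1 c1.
have [] := @Rintegral_series (fun n x => complex.Im (h n x)) (fun x => complex.Im (H x)) u muD.
- by move=> n; case: (mh n).
- by [].
- by move=> n x Dx; apply: le_trans (Im_modulus _) _; exact: hu.
- by [].
- by move=> x /hH [].
by move=> i2 c2; split; split.
Qed.

End cint.

(** * Moments of a measure whose tails double *)

Section moments.
Context (R : realType).
Local Notation M := (measurableTypeR R).
Variable mu : {finite_measure set M -> \bar R}.

Definition tail (r : R) : R := fine (mu (`[r, 1%R[%classic `&` @I01 R)).
Definition moment (k : nat) : R := Rintegral mu (@I01 R) (fun s => s ^+ k).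

Let mI : measurable (@I01 R) := @measurable_I01 R.

Let fin_mu (A : set M) : measurable A -> mu A \is a fin_num.
Proof. by move=> mA; exact: fin_num_measure. Qed.

Lemma I01P (s : R) : I01 s <-> 0 < s < 1.
Proof. by rewrite /I01 /= in_itv. Qed.

Let mtl r : measurable (`[r, 1%R[%classic `&` @I01 R : set M).
Proof. by apply: measurableI => //; exact: measurable_itv. Qed.

Lemma integrable_bounded (f : R -> R) (c : R) : measurable_fun (@I01 R) f ->
  (forall s, I01 s -> `|f s| <= c) -> mu.-integrable (@I01 R) (EFin \o f).
Proof.
move=> mf fc; apply: measurable_bounded_integrable => //.
- by rewrite -ge0_fin_numE// fin_mu.
- exists c; split; first exact: num_real.
  by move=> x cx y /fc h; apply: le_trans h (ltW cx).
Qed.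

Lemma expr01 (s : R) k : I01 s -> 0 <= s ^+ k <= 1.
Proof.
by move=> /I01P /andP[s0 s1]; rewrite exprn_ge0 ?(ltW s0)//= exprn_ile1// ltW.
Qed.

Lemma integrable_expr k : mu.-integrable (@I01 R) (EFin \o (fun s : R => s ^+ k)).
Proof.
apply: (@integrable_bounded _ 1).
  by apply: measurable_funX; exact: measurable_id.
by move=> s /(@expr01 _ k) /andP[s0 s1]; rewrite ger0_norm.
Qed.

Lemma tail_ge0 r : 0 <= tail r. Proof. by rewrite /tail fine_ge0. Qed.

Lemma tail_decr r s : r <= s -> tail s <= tail r.
Proof.
move=> rs; rewrite /tail fine_le ?fin_mu//; apply: le_measure; rewrite ?inE//.
apply: setSI => x /=; rewrite !in_itv/= => /andP[sx ->].
by rewrite (le_trans rs).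
Qed.

Lemma moment_ge0 k : 0 <= moment k.
Proof. by apply: Rintegral_ge0 => s /(@expr01 _ k) /andP[]. Qed.

Lemma moment_decr k l : (k <= l)%N -> moment l <= moment k.
Proof.
move=> kl; apply: le_Rintegral => //; try exact: integrable_expr.
move=> s /I01P /andP[s0 s1]; apply: ler_wiXn2l => //; exact: ltW.
Qed.

Let tailE r : tail r = Rintegral mu (`[r, 1%R[%classic `&` @I01 R) (fun=> 1).
Proof. by rewrite Rintegral_cst// mul1r. Qed.

Lemma moment0 : moment 0 = tail 0.
Proof.
rewrite tailE; have -> : `[0, 1%R[%classic `&` @I01 R = @I01 R :> set M.
  apply/seteqP; split => x; rewrite /I01 /= !in_itv/=; first by case.
    by move=> /andP[x0 x1]; rewrite x0 x1 (ltW x0).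
by [].
Qed.

Let split01 r : 0 <= r -> @I01 R = (@I01 R `&` `]-oo, r[%classic) `|` (`[r, 1%R[%classic `&` @I01 R).
Proof.
move=> r0; apply/seteqP; split => x; rewrite /I01 /= !in_itv/=.
  by move=> /andP[x0 x1]; case: (ltP x r) => xr; [left|right]; rewrite ?x0 ?x1.
by move=> [[]//|[]].
Qed.

(** Restrict the integral to [r, 1[, where s^k >= r^k. *)
Lemma moment_lower k r : 0 <= r -> r ^+ k * tail r <= moment k.
Proof.
move=> r0; have ik := integrable_expr k.
have ik' : mu.-integrable (`[r, 1%R[%classic `&` @I01 R) (EFin \o (fun s : R => s ^+ k)).
  by apply: integrableS ik => //; exact: subIsetr.
rewrite /moment [X in Rintegral _ X](split01 r0) Rintegral_setU//; last 3 first.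
- by apply: measurableI => //; exact: measurable_itv.
- by rewrite -split01.
- apply/disj_setPLR => x [_]; rewrite /= !in_itv/= => h1 [/andP[h2 _] _].
  by move: h2; rewrite leNgt h1.
rewrite -[leLHS]add0r lerD//.
  by apply: Rintegral_ge0 => s [/(@expr01 _ k) /andP[]].
rewrite tailE -RintegralZl//; last first.
  by apply: (finite_measure_integrable_cst mu 1).
apply: le_Rintegral => //.
  under [X in _.-integrable _ X]eq_fun do rewrite mulr1.
  by apply: (finite_measure_integrable_cst mu (r ^+ k)).
move=> s [/= + _]; rewrite in_itv/= => /andP[rs _].
by rewrite mulr1 lerXn2r// nnegrE (le_trans r0).
Qed.

(** Split at r: below r the factor s^k is at most r^k, above r the whole
    power is at most 1. *)
Lemma moment_upper k l r : 0 <= r -> moment (k + l) <= r ^+ k * moment l + tail r.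
Proof.
move=> r0; have ik := integrable_expr (k + l).
rewrite /moment [X in Rintegral _ X _ <= _](split01 r0) Rintegral_setU//; last 3 first.
- by apply: measurableI => //; exact: measurable_itv.
- by rewrite -split01.
- apply/disj_setPLR => x [_]; rewrite /= !in_itv/= => h1 [/andP[h2 _] _].
  by move: h2; rewrite leNgt h1.
have mA : measurable (@I01 R `&` `]-oo, r[%classic : set M).
  by apply: measurableI => //; exact: measurable_itv.
have iA j : mu.-integrable (@I01 R `&` `]-oo, r[%classic) (EFin \o (fun s : R => s ^+ j)).
  by apply: integrableS (integrable_expr j) => //; exact: subIsetl.
apply: lerD; last first.
  rewrite tailE; apply: le_Rintegral => //.
  - by apply: integrableS ik => //; exact: subIsetr.
  - by apply: (finite_measure_integrable_cst mu 1).
  - by move=> s [_ /(@expr01 _ (k + l)) /andP[]].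
apply: (@le_trans _ _ (r ^+ k * Rintegral mu (@I01 R `&` `]-oo, r[%classic) (fun s => s ^+ l))).
  rewrite -RintegralZl//; apply: le_Rintegral => //.
    have := integrableZl mA (r ^+ k) (iA l).
    by apply: eq_integrable.
  move=> s [/I01P /andP[s0 s1]]; rewrite /= in_itv/= => sr.
  by rewrite exprD ler_wpM2r ?exprn_ge0 ?(ltW s0)// lerXn2r ?nnegrE// ltW.
rewrite ler_wpM2l ?exprn_ge0//.
have iU : mu.-integrable (@I01 R `&` `]-oo, r[%classic `|` (`[r, 1%R[%classic `&` @I01 R))
    (EFin \o (fun s : R => s ^+ l)) by rewrite -split01//; exact: integrable_expr.
have disj : [disjoint @I01 R `&` `]-oo, r[%classic & `[r, 1%R[%classic `&` @I01 R].
  apply/disj_setPLR => x [_]; rewrite /= !in_itv/= => h1 [/andP[h2 _] _].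
  by move: h2; rewrite leNgt h1.
rewrite [X in _ <= Rintegral _ X _](split01 r0) Rintegral_setU//.
rewrite lerDl; apply: Rintegral_ge0 => s [_ /(@expr01 _ l) /andP[//]].
Qed.

(** With x = s^2 the integrand is at most s^k, because p x^p is at most the
    sum of the x^i for i < p, which is (1 - x^p) / (1 - x). *)
Lemma moment_diff p k : p%:R * (moment (2 * p + k) - moment (2 * p + k + 2)) <= moment k.
Proof.
rewrite /moment -RintegralB//; try exact: integrable_expr.
have iB : mu.-integrable (@I01 R) (EFin \o (fun s : R => s ^+ (2 * p + k) - s ^+ (2 * p + k + 2))).
  have := integrableB mI (integrable_expr (2 * p + k)) (integrable_expr (2 * p + k + 2)).
  by apply: eq_integrable.
rewrite -RintegralZl//; apply: le_Rintegral => //; last first.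
- move=> s /I01P /andP[s0 s1].
  have s2 : s ^+ 2 <= 1 by rewrite exprn_ile1// ltW.
  have -> : p%:R * (s ^+ (2 * p + k) - s ^+ (2 * p + k + 2)) =
     p%:R * (s ^+ 2) ^+ p * (1 - s ^+ 2) * s ^+ k.
    by rewrite (exprD s (2 * p + k) 2) (exprD s (2 * p) k) (exprM s 2 p); ring.
  rewrite -[leRHS]mul1r ler_wpM2r ?exprn_ge0 ?(ltW s0)//.
  move: (s ^+ 2) (sqr_ge0 s) s2 => x x0 x1.
  apply: (@le_trans _ _ (1 - x ^+ p)); last by rewrite gerBl exprn_ge0.
  have -> : 1 - x ^+ p = (\sum_(i < p) x ^+ i) * (1 - x).
    have h := subrX1 x p; rewrite -[LHS]opprB h; ring.
  rewrite ler_wpM2r ?subr_ge0//.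
  have -> : p%:R * x ^+ p = \sum_(i < p) x ^+ p by rewrite sumr_const card_ord mulr_natl.
  by apply: ler_sum => i _; apply: ler_wiXn2l => //; exact: ltnW.
- exact: integrable_expr.
- have := integrableZl mI p%:R iB; exact: eq_integrable.
Qed.

End moments.

Section powers.
Context (R : realType).
Implicit Types x : R.

Lemma onem_pow_le x n : 0 <= x <= 1 -> (1 - x) ^+ n * (1 + n%:R * x) <= 1.
Proof.
move=> /andP[x0 x1]; elim: n => [|n ih]; first by rewrite expr0 mul0r addr0 mul1r.
apply: le_trans ih; rewrite exprSr -mulrA ler_wpM2l ?exprn_ge0 ?subr_ge0//.
rewrite -natr1; have : 0 <= n%:R * x * x + x * x by rewrite addr_ge0// mulr_ge0// mulr_ge0.
by lra.
Qed.

Lemma bernoulli_pow x n : 0 <= x <= 1 -> 1 - n%:R * x <= (1 - x) ^+ n.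
Proof.
move=> /andP[x0 x1]; elim: n => [|n ih]; first by rewrite expr0 mul0r subr0.
rewrite exprSr; apply: le_trans (_ : (1 - n%:R * x) * (1 - x) <= _).
  rewrite -natr1; have : 0 <= n%:R * x * x by rewrite mulr_ge0// mulr_ge0.
  by lra.
by rewrite ler_wpM2r ?subr_ge0.
Qed.

Lemma ex_pow2_ge x : exists n : nat, x <= 2 ^+ n.
Proof.
exists (Num.bound x); have := archi_boundP (normr_ge0 x).
rewrite /Num.bound normr_id => h; apply: le_trans (ler_norm _) _.
apply: le_trans (ltW h) _; rewrite -natrX ler_nat; exact/ltnW/ltn_expl.
Qed.

(** Distances to the boundary point 1 are discretised as 2^-k. *)
Definition dyad k : R := 2^-1 ^+ k.

Lemma dyad_gt0 k : 0 < dyad k. Proof. by rewrite exprn_gt0. Qed.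
Lemma dyad_le1 k : dyad k <= 1.
Proof. by rewrite exprn_ile1//; lra. Qed.
Lemma dyadS k : dyad k.+1 = dyad k / 2. Proof. by rewrite /dyad exprSr. Qed.
Lemma dyad2 k : 2 ^+ k * dyad k = 1.
Proof. by rewrite /dyad -exprMn divff// expr1n. Qed.

Lemma ex_dyad x : 0 < x <= 1 -> exists k, dyad k.+1 < x <= dyad k.
Proof.
move=> /andP[x0 x1].
have ex : exists n, dyad n < x.
  have [n hn] := ex_pow2_ge (2 * x^-1); exists n.
  have d0 := dyad_gt0 n; rewrite -(ltr_pM2l (_ : 0 < 2 ^+ n)) ?exprn_gt0// dyad2.
  have : 2 <= 2 ^+ n * x by rewrite -ler_pdivrMr.
  by lra.
case: (ex_minnP ex) => -[|k] hk hmin; first by move: hk; rewrite /dyad expr0 ltNge x1.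
exists k; rewrite hk/= leNgt; apply/negP => /hmin; by rewrite ltnn.
Qed.

End powers.

Section doubling.
Context (R : realType).
Local Notation M := (measurableTypeR R).
Variable mu : {finite_measure set M -> \bar R}.
Local Notation tail := (tail mu).
Local Notation J := (moment mu).
Hypothesis tail_gt0 : forall r, 0 <= r < 1 -> 0 < tail r.
Variable C : R.
Hypothesis C1 : 1 < C.
Hypothesis tail_doubling : forall r, 0 <= r < 1 -> tail r <= C * tail ((1 + r) / 2).
Local Notation dyad := (@dyad R).

Let C0 : 0 < C. Proof. exact: lt_trans ltr01 C1. Qed.
Let Cn0 n : 0 < C ^+ n. Proof. by rewrite exprn_gt0. Qed.
Let Cn1 n : 1 <= C ^+ n. Proof. by rewrite exprn_ege1// ltW. Qed.

Definition ntail k := tail (1 - dyad k).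

Lemma dyad01 k : 0 <= 1 - dyad k < 1.
Proof. by have := dyad_gt0 R k; have := dyad_le1 R k; lra. Qed.

Lemma ntail_gt0 k : 0 < ntail k. Proof. exact/tail_gt0/dyad01. Qed.

Lemma ntail_doubling k j : ntail k <= C ^+ j * ntail (k + j).
Proof.
elim: j => [|j ih]; first by rewrite expr0 mul1r addn0.
apply: le_trans ih _; rewrite exprSr -mulrA ler_wpM2l ?(ltW (Cn0 _))//.
apply: le_trans (tail_doubling (dyad01 _)) _; rewrite ler_wpM2l ?(ltW C0)// /ntail addnS dyadS.
by apply: tail_decr; lra.
Qed.

(** Moments of order 2^k are governed by the tail at distance 2^-k from 1.
    The upper bound is by induction on k: passing from order 2^(L + j) to its
    double, [moment_upper] at r = 1 - 2^-j multiplies the moment by r^(2^(L +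
    j)) <= 1 / (1 + 2^L), and L is chosen so that this beats the doubling
    constant. *)
Lemma moment_ntail : exists2 A, 1 <= A & forall k, J (2 ^ k)%N <= A * ntail k.
Proof.
have [L hL] := ex_pow2_ge (2 * C).
pose A := 2 * C ^+ L.+1; have A1 : 1 <= A by have := Cn1 L.+1; rewrite /A; lra.
exists A => // k.
have J0 : J 0 = ntail 0 by rewrite moment0 /ntail /dyad expr0 subrr.
have [kL|kL] := leqP k L.
  apply: le_trans (moment_decr _ (leq0n _)) _; rewrite J0.
  apply: le_trans (ntail_doubling 0 k) _; rewrite add0n ler_wpM2r ?(ltW (ntail_gt0 _))//.
  apply: (@le_trans _ _ (C ^+ L.+1)); last by have := Cn0 L.+1; rewrite /A; lra.
  by apply: ler_weXn2l; [exact: ltW|exact: leqW].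
have [j ->] : exists j, k = (L + j)%N by exists (k - L)%N; rewrite subnKC// ltnW.
elim: j {k kL} => [|j ih].
  rewrite addn0; apply: le_trans (moment_decr _ (leq0n _)) _; rewrite J0.
  apply: le_trans (ntail_doubling 0 L) _; rewrite add0n ler_wpM2r ?(ltW (ntail_gt0 _))//.
  apply: (@le_trans _ _ (C ^+ L.+1)); last by have := Cn0 L.+1; rewrite /A; lra.
  by apply: ler_weXn2l; [exact: ltW|].
rewrite addnS expnS mul2n -addnn.
have /andP[d0 d1] := dyad01 j.
apply: le_trans (moment_upper _ _ _ d0) _.
have h1 : (1 - dyad j) ^+ (2 ^ (L + j)) <= (2 * C)^-1.
  have := @onem_pow_le R (dyad j) (2 ^ (L + j)) ; rewrite dyad_le1 (ltW (dyad_gt0 _ _)) => /(_ isT).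
  have -> : (2 ^ (L + j))%:R * dyad j = 2 ^+ L by rewrite natrX exprD -mulrA dyad2 mulr1.
  rewrite -ler_pdivlMr; last by rewrite ltr_pwDl ?exprn_ge0.
  move=> /le_trans; apply; rewrite div1r lef_pV2 ?posrE; [|by rewrite ltr_pwDl ?exprn_ge0|by rewrite mulr_gt0].
  by lra.
have h2 : ntail (L + j) <= C * ntail (L + j).+1.
  by have := ntail_doubling (L + j) 1; rewrite expr1 addn1.
have h3 : ntail j <= C ^+ L.+1 * ntail (L + j).+1.
  by have := ntail_doubling j L.+1; rewrite addnS addnC.
have n0 := ntail_gt0 (L + j).+1; have n1 := ntail_gt0 (L + j).
apply: (@le_trans _ _ ((2 * C)^-1 * (A * (C * ntail (L + j).+1)) + C ^+ L.+1 * ntail (L + j).+1)).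
  apply: lerD h3; apply: ler_pM => //; [by rewrite exprn_ge0|exact: moment_ge0|].
  by apply: le_trans ih _; rewrite ler_wpM2l//; lra.
rewrite le_eqVlt; apply/orP; left; apply/eqP; rewrite /A; field.
by rewrite gt_eqF.
Qed.

Lemma moment_ntail_lower k : ntail k.+1 / 2 <= J (2 ^ k)%N.
Proof.
have /andP[d0 d1] := dyad01 k.+1.
apply: le_trans (moment_lower _ _ d0); rewrite mulrC ler_wpM2r ?(ltW (ntail_gt0 _))//.
have := @bernoulli_pow R (dyad k.+1) (2 ^ k); rewrite dyad_le1 (ltW (dyad_gt0 _ _)) => /(_ isT).
apply: le_trans; rewrite natrX dyadS mulrA dyad2; lra.
Qed.

Lemma moment_gt0 k : 0 < J k.
Proof.
apply: lt_le_trans (moment_lower mu k (_ : 0 <= 2^-1)); last by lra.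
by rewrite mulr_gt0// ?exprn_gt0// tail_gt0//; lra.
Qed.

(** Two consecutive powers of 2 enclose every order, so both bounds by tails
    combine. *)
Lemma moment_doubling : exists2 D, 1 <= D & forall e, J e <= D * J (2 * e + 2)%N.
Proof.
have [A A1 hA] := moment_ntail.
have c3 := Cn1 3; exists (2 * A * C ^+ 3); first by nra.
move=> [|e].
  rewrite muln0 add0n (_ : 2 = 2 ^ 1)%N//.
  have h := moment_ntail_lower 1; have n0 := ntail_gt0 2.
  have -> : J 0 = ntail 0 by rewrite moment0 /ntail /dyad expr0 subrr.
  apply: le_trans (ntail_doubling 0 2) _; rewrite add0n.
  apply: le_trans (_ : 2 * C ^+ 3 * (ntail 2 / 2) <= _).
    have := Cn0 2; have C1' := C1; rewrite [C ^+ 3]exprSr; move: (C ^+ 2) => c2 c20.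
    have -> : 2 * (c2 * C) * (ntail 2 / 2) = c2 * ntail 2 * C by field.
    by rewrite ler_peMr// ?mulr_ge0// ltW.
  have -> : 2 * A * C ^+ 3 * J (2 ^ 1)%N = A * (2 * C ^+ 3 * J (2 ^ 1)%N) by ring.
  apply: le_trans (_ : 2 * C ^+ 3 * J (2 ^ 1)%N <= _).
    by rewrite ler_wpM2l//; lra.
  by rewrite ler_peMl// mulr_ge0 ?moment_ge0//; lra.
pose k := trunc_log 2 e.+1.
have /andP[k1 k2] : (2 ^ k <= e.+1 < 2 ^ k.+1)%N by apply: trunc_log_bounds.
apply: le_trans (moment_decr _ k1) _; apply: le_trans (hA k) _.
apply: (@le_trans _ _ (2 * A * C ^+ 3 * J (2 ^ k.+2)%N)); last first.
  rewrite ler_wpM2l//; first by rewrite mulr_ge0// ?(ltW (Cn0 _))//; lra.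
  by apply: moment_decr; rewrite expnS; lia.
have h := moment_ntail_lower k.+2.
apply: le_trans (_ : 2 * A * C ^+ 3 * (ntail k.+3 / 2) <= _); last first.
  by rewrite ler_wpM2l//; rewrite mulr_ge0// ?(ltW (Cn0 _))//; lra.
have := ntail_doubling k 3; rewrite addn3 => h3.
apply: le_trans (_ : A * (C ^+ 3 * ntail k.+3) <= _); first by rewrite ler_wpM2l//; lra.
by rewrite le_eqVlt; apply/orP; left; apply/eqP; field.
Qed.

(** The square of the norm of z^n in the weighted space is the moment of
    order 2 n, so these are the Taylor coefficients of the kernel. *)
Definition kcoef n : R := (J (2 * n))^-1.

Lemma kcoef_gt0 n : 0 < kcoef n. Proof. by rewrite invr_gt0 moment_gt0. Qed.

Lemma kcoef_incr n m : (n <= m)%N -> kcoef n <= kcoef m.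
Proof.
move=> nm; rewrite lef_pV2 ?posrE ?moment_gt0//; apply: moment_decr; lia.
Qed.

(** The difference is controlled by [moment_diff] with p close to n / 2; what
    remains are moments of comparable orders. *)
Lemma kcoef_diff : exists2 E, 0 < E & forall n,
  n.+1%:R * (kcoef n.+1 - kcoef n) <= E * kcoef n.+1.
Proof.
have [D D1 hD] := moment_doubling; exists (2 * D + 2); first by lra.
move=> n; have j0 := moment_gt0 (2 * n); have j1 := moment_gt0 (2 * n.+1).
have -> : kcoef n.+1 - kcoef n = (J (2 * n)%N - J (2 * n.+1)%N) / J (2 * n)%N * kcoef n.+1.
  by rewrite /kcoef; field; rewrite !gt_eqF.
rewrite mulrA ler_wpM2r ?(ltW (kcoef_gt0 _))// mulrA ler_pdivrMr//.
pose p := (n./2)%N.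
have np : (n.+1 <= 2 * p + 2)%N by rewrite /p; have := odd_double_half n; lia.
have pn : (2 * p <= n)%N by rewrite /p; have := odd_double_half n; lia.
have dge0 : 0 <= J (2 * n)%N - J (2 * n.+1)%N by rewrite subr_ge0 moment_decr//; lia.
apply: (@le_trans _ _ ((2 * p + 2)%:R * (J (2 * n)%N - J (2 * n.+1)%N))).
  by rewrite ler_wpM2r// ler_nat.
have := moment_diff mu p (2 * (n - p)).
have -> : (2 * p + 2 * (n - p) + 2 = 2 * n.+1)%N by lia.
have -> : (2 * p + 2 * (n - p) = 2 * n)%N by lia.
have := hD (2 * (n - p))%N.
have : J (2 * (2 * (n - p)) + 2) <= J (2 * n) by apply: moment_decr; lia.
move=> h1 h2 h3; rewrite natrD natrM.
have h4 : D * J (2 * (2 * (n - p)) + 2) <= D * J (2 * n) by rewrite ler_wpM2l//; lra.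
move: dge0; set d := J (2 * n)%N - J (2 * n.+1)%N => dge0.
have : d <= J (2 * n) by rewrite /d; lra.
move=> h5; have -> : (2 * p%:R + 2) * d = 2 * (p%:R * d) + 2 * d by ring.
have h6 : p%:R * d <= D * J (2 * n)%N by apply: le_trans h4; apply: le_trans h3 h2.
by lra.
Qed.

(** Let L be a large multiple of 1 / (1 - x). Beyond L the terms of indices 2
    n and 2 n + 1 together are at most half of the term of index n, since x^n
    is then small against the doubling constant of the coefficients. Hence
    the sum is at most twice the sum up to 2 L, where the coefficients are at
    most the one of index 2 L, of order 1 / T(x), and the geometric series
    contributes 1 / (1 - x). *)
Lemma sum_kcoef_sqr : exists2 B, 0 < B & forall x N, 0 <= x < 1 ->
  \sum_(n < N) kcoef n ^+ 2 * x ^+ n <= B / ((1 - x) * tail x ^+ 2).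
Proof.
have [D D1 hD] := moment_doubling.
have [i hi] := ex_pow2_ge (8 * D ^+ 2).
exists (8 * C ^+ (2 * (i + 3))); first by have := Cn0 (2 * (i + 3)); lra.
move=> x N /andP[x0 x1].
have [k /andP[k1 k2]] : exists k, dyad k.+1 < 1 - x <= dyad k by apply: ex_dyad; lra.
pose L := (2 ^ (k + i))%N.
have d0 := dyad_gt0 R k.
have L1 : (4 * D ^+ 2) <= L%:R * (1 - x).
  rewrite /L natrX exprD; apply: le_trans (_ : 2 ^+ k * 2 ^+ i * (dyad k / 2) <= _).
    have -> : 2 ^+ k * 2 ^+ i * (dyad k / 2) = 2 ^+ k * dyad k * 2 ^+ i / 2 by ring.
    rewrite dyad2 mul1r; lra.
  by rewrite ler_wpM2l ?mulr_ge0 ?exprn_ge0// ltW// -dyadS.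
have D20 : 1 <= D ^+ 2 by rewrite exprn_ege1.
have xL : x ^+ L <= (4 * D ^+ 2)^-1.
  have hx : 0 <= 1 - x <= 1 by lra.
  have := onem_pow_le L hx; rewrite subKr => h.
  have xL0 : 0 <= x ^+ L by rewrite exprn_ge0.
  rewrite -[leRHS]mul1r ler_pdivlMr; last by lra.
  apply: le_trans h; rewrite ler_wpM2l//; lra.
have odd_even (f : nat -> R) m : \sum_(0 <= n < 2 * m) f n = \sum_(0 <= n < m) (f (2 * n)%N + f (2 * n + 1)%N).
  elim: m => [|m ih]; first by rewrite muln0 !big_nil.
  rewrite mulnS !addSn add0n !big_nat_recr//= ih -addrA addn1//.
pose f n := kcoef n ^+ 2 * x ^+ n.
have f0 n : 0 <= f n by rewrite mulr_ge0 ?exprn_ge0// ltW// kcoef_gt0.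
have f2 n : (L <= n)%N -> f (2 * n)%N + f (2 * n + 1)%N <= 2^-1 * f n.
  move=> Ln.
  have a1 : kcoef (2 * n + 1) <= D * kcoef n.
    rewrite /kcoef ler_pdivlMr ?moment_gt0// mulrC ler_pdivrMr ?moment_gt0//.
    have -> : (2 * (2 * n + 1) = 2 * (2 * n) + 2)%N by rewrite mulnDr muln1.
    exact: hD.
  have a2 : kcoef (2 * n) <= D * kcoef n by apply: le_trans a1; apply: kcoef_incr; rewrite leq_addr.
  have s1 : kcoef (2 * n + 1) ^+ 2 <= D ^+ 2 * kcoef n ^+ 2.
    by rewrite -exprMn lerXn2r ?nnegrE ?(ltW (kcoef_gt0 _))// mulr_ge0 ?(ltW (kcoef_gt0 _))//; lra.
  have s2 : kcoef (2 * n) ^+ 2 <= D ^+ 2 * kcoef n ^+ 2.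
    by rewrite -exprMn lerXn2r ?nnegrE ?(ltW (kcoef_gt0 _))// mulr_ge0 ?(ltW (kcoef_gt0 _))//; lra.
  have xn0 : 0 <= x ^+ n by rewrite exprn_ge0.
  have xx : x ^+ n <= (4 * D ^+ 2)^-1 by apply: le_trans xL; apply: ler_wiXn2l => //; exact: ltW.
  have x2 : x ^+ (2 * n) <= (4 * D ^+ 2)^-1 * x ^+ n.
    by rewrite mul2n -addnn exprD ler_wpM2r.
  have x3 : x ^+ (2 * n + 1) <= (4 * D ^+ 2)^-1 * x ^+ n.
    by apply: le_trans x2; apply: ler_wiXn2l => //; [exact: ltW|exact: leq_addr].
  have -> : 2^-1 * f n = D ^+ 2 * kcoef n ^+ 2 * ((4 * D ^+ 2)^-1 * x ^+ n) +
      D ^+ 2 * kcoef n ^+ 2 * ((4 * D ^+ 2)^-1 * x ^+ n).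
    by rewrite /f; field; rewrite gt_eqF//; lra.
  by apply: lerD; apply: ler_pM; rewrite ?exprn_ge0 ?(ltW (kcoef_gt0 _)).
have cat (g : nat -> R) a b c : (a <= b)%N -> (b <= c)%N ->
    \sum_(a <= n < c) g n = \sum_(a <= n < b) g n + \sum_(b <= n < c) g n.
  by move=> ab bc; rewrite (big_cat_nat ab bc).
have hmain m : \sum_(0 <= n < 2 * m) f n <= 2 * \sum_(0 <= n < 2 * L) f n.
  have key : \sum_(0 <= n < 2 * m) f n <= \sum_(0 <= n < 2 * L) f n + 2^-1 * \sum_(0 <= n < m) f n.
    rewrite !odd_even; have [mL|Lm] := leqP m L.
      rewrite (cat _ 0%N m L)// -addrA lerDl addr_ge0//.
        by apply: sumr_ge0 => n _; rewrite addr_ge0.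
      by rewrite mulr_ge0// sumr_ge0.
    rewrite (cat _ 0%N L m)// ?(ltnW Lm)// lerD2l mulr_sumr.
    rewrite (cat (fun n => 2^-1 * f n) 0%N L m)// ?(ltnW Lm)//.
    apply: (@le_trans _ _ (\sum_(L <= n < m) 2^-1 * f n)).
      by rewrite big_nat [leRHS]big_nat; apply: ler_sum => n /andP[Ln _]; exact: f2.
    by rewrite lerDr sumr_ge0// => n _; rewrite mulr_ge0.
  have : \sum_(0 <= n < m) f n <= \sum_(0 <= n < 2 * m) f n.
    rewrite (cat _ 0%N m (2 * m)%N)//; last by rewrite leq_pmull.
    by rewrite lerDl sumr_ge0.
  by lra.
apply: (@le_trans _ _ (\sum_(0 <= n < 2 * N) f n)).
  rewrite -(big_mkord xpredT f) (cat _ 0%N N (2 * N)%N)//; last by rewrite leq_pmull.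
  by rewrite lerDl sumr_ge0.
apply: le_trans (hmain N) _.
have t0 : 0 < tail x by apply: tail_gt0; rewrite x0.
have tn : tail x <= ntail k by apply: tail_decr; lra.
have aL : kcoef (2 * L) <= 2 * C ^+ (i + 3) / tail x.
  rewrite /kcoef ler_pdivlMr// mulrC ler_pdivrMr ?moment_gt0//.
  have := moment_ntail_lower (k + i + 2).
  have -> : (2 ^ (k + i + 2) = 2 * (2 * L))%N by rewrite expnD /L mulnC [RHS]mulnA.
  have := ntail_doubling k (i + 3); have -> : (k + (i + 3) = (k + i + 2).+1)%N by rewrite addnA !addnS.
  move=> h1 h2; apply: le_trans tn (le_trans h1 _).
  rewrite [2 * _]mulrC -mulrA ler_wpM2l ?(ltW (Cn0 _))//; lra.
have geo : \sum_(0 <= n < 2 * L) f n <= kcoef (2 * L) ^+ 2 / (1 - x).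
  apply: (@le_trans _ _ (\sum_(0 <= n < 2 * L) kcoef (2 * L) ^+ 2 * x ^+ n)).
    rewrite big_nat [leRHS]big_nat; apply: ler_sum => n /andP[_ nL].
    rewrite ler_wpM2r ?exprn_ge0// lerXn2r ?nnegrE ?(ltW (kcoef_gt0 _))//.
    by apply: kcoef_incr; exact: ltnW.
  rewrite -mulr_sumr ler_wpM2l ?exprn_ge0 ?(ltW (kcoef_gt0 _))//.
  rewrite big_mkord -[leRHS]mul1r ler_pdivlMr; last by lra.
  have h := subrX1 x (2 * L); rewrite mulrC.
  have -> : (1 - x) * (\sum_(i0 < 2 * L) x ^+ i0) = - ((x - 1) * (\sum_(i0 < 2 * L) x ^+ i0)) by ring.
  by rewrite -h opprB gerBl exprn_ge0.
apply: (@le_trans _ _ (2 * ((2 * C ^+ (i + 3) / tail x) ^+ 2 / (1 - x)))).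
  rewrite ler_wpM2l//; apply: le_trans geo _.
  rewrite ler_wpM2r ?invr_ge0 ?subr_ge0 ?(ltW x1)//.
  by rewrite lerXn2r ?nnegrE ?(ltW (kcoef_gt0 _))// !mulr_ge0 ?invr_ge0 ?(ltW (Cn0 _))// ltW.
rewrite mulnC exprM le_eqVlt; apply/orP; left; apply/eqP.
by field; rewrite !gt_eqF//; lra.
Qed.

Lemma kcoef_le r n : 0 < r < 1 -> kcoef n <= (tail r)^-1 * (r ^- 2) ^+ n.
Proof.
move=> /andP[r0 r1]; have t0 : 0 < tail r by apply: tail_gt0; rewrite ltW.
have -> : (tail r)^-1 * (r ^- 2) ^+ n = (tail r * r ^+ (2 * n))^-1.
  by rewrite [RHS]invfM; congr (_ * _); rewrite exprM -[RHS]exprVn.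
rewrite /kcoef lef_pV2 ?posrE ?moment_gt0//; last first.
  by rewrite mulr_gt0// exprn_gt0.
by rewrite mulrC moment_lower// ltW.
Qed.

(** Use [kcoef_le] at a radius r with x < r^2 < 1. *)
Lemma kcoef_summable x : 0 <= x < 1 -> cvgn (series (fun n => kcoef n * x ^+ n)).
Proof.
move=> /andP[x0 x1]; pose r := Num.sqrt ((1 + x) / 2).
have r2 : r ^+ 2 = (1 + x) / 2 by rewrite sqr_sqrtr//; lra.
have r0 : 0 < r by rewrite sqrtr_gt0; lra.
have r1 : r < 1 by rewrite -[ltRHS]sqrtr1 ltr_sqrt//; lra.
have t0 : 0 < tail r by apply: tail_gt0; rewrite ltW.
apply: (@series_le_cvg R _ (fun n => (tail r)^-1 * (x / ((1 + x) / 2)) ^+ n)) => [n|n|n|].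
- by rewrite mulr_ge0 ?exprn_ge0// ltW// kcoef_gt0.
- by rewrite mulr_ge0 ?exprn_ge0// ?invr_ge0 ?(ltW t0)// divr_ge0//; lra.
- apply: le_trans (_ : (tail r)^-1 * (r ^- 2) ^+ n * x ^+ n <= _).
    by rewrite ler_wpM2r ?exprn_ge0// kcoef_le// r0.
  by rewrite r2 -mulrA -exprMn [_^-1 * x]mulrC.
- apply: is_cvg_geometric_series; rewrite ger0_norm; last by rewrite divr_ge0//; lra.
  by rewrite ltr_pdivrMr; lra.
Qed.

End doubling.

(** * Fourier series on the circle *)

Section circle.
Context (R : realType).
Local Notation C := R[i].
Local Notation M := (measurableTypeR R).
Local Notation sg := (@sigma R).
Local Notation leb := (@lebesgue_measure R).
Local Open Scope complex_scope.

(** The point e^(i t) of the unit circle. *)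
Definition ec (t : R) : C := cos t +i* sin t.

Lemma modulus_ec t : modulus (ec t) = 1.
Proof. by rewrite modulusE /= cos2Dsin2 sqrtr1. Qed.

Lemma ec_neq0 t : ec t != 0.
Proof. by rewrite -modulus_gt0 modulus_ec. Qed.

Lemma ecD s t : ec (s + t) = ec s * ec t.
Proof. by apply: complex_eqP => /=; rewrite ?cosD ?sinD// addrC [cos s * _]mulrC. Qed.

Lemma ecX t n : ec t ^+ n = ec (n%:R * t).
Proof.
elim: n => [|n ih]; first by rewrite expr0 mul0r /ec cos0 sin0.
by rewrite exprS ih -ecD -natr1 mulrDl mul1r addrC.
Qed.

Lemma ec_conj t : ec t * (conjc (ec t)) = 1.
Proof.
apply: complex_eqP => /=; last by ring.
by rewrite -(cos2Dsin2 t); ring.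
Qed.

Lemma conj_ec t : (conjc (ec t)) = (ec t)^-1.
Proof. by apply: (mulfI (ec_neq0 t)); rewrite ec_conj mulfV// ec_neq0. Qed.

Lemma conjcM (z w : C) : (conjc (z * w)) = (conjc z) * (conjc w).
Proof. exact: rmorphM. Qed.

Lemma conjcX (z : C) n : (conjc (z ^+ n)) = (conjc z) ^+ n.
Proof. exact: rmorphXn. Qed.

Lemma cmeas_ec : cmeas [set: M] ec.
Proof.
split => /=; apply: continuous_measurable_fun; [exact: continuous_cos|exact: continuous_sin].
Qed.

Lemma sigma_fin : (sg setT < +oo)%E.
Proof. by rewrite sigmaT ltry. Qed.

Lemma cintble_bounded (f : M -> C) (c : R) : cmeas setT f ->
  (forall t, modulus (f t) <= c) -> cintble sg setT f.
Proof.
move=> mf fc; apply: (@cintble_le _ _ _ _ _ measurableT _ (cst c)) => //.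
exact: (finite_measure_integrable_cst sg c).
Qed.

Lemma cint_cst (c : C) : cint sg setT (fun=> c) = c.
Proof.
by rewrite /cint !Rintegral_cst//= sigmaT /= !mulr1; case: c.
Qed.

(** The passage from nonnegative to continuous integrands, for which the
    fundamental theorem is available. *)
Lemma Rintegral_sigma (f : R -> R) : continuous f ->
  Rintegral sg setT f = (2 * pi)^-1 * Rintegral leb (@circ R) f.
Proof.
move=> cf; have pi0 := @pi_gt0 R.
have mf : measurable_fun [set: M] f by exact: continuous_measurable_fun.
have icf : leb.-integrable (@circ R) (EFin \o f).
  apply: continuous_compact_integrable; first exact: segment_compact.
  exact: continuous_subspaceT.
have k0 : 0 <= (2 * pi : R)^-1 by rewrite invr_ge0; lra.
have mc := @measurable_circ R.
have key (h : R -> \bar R) : measurable_fun [set: M] h -> (forall t, 0 <= h t)%E ->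
   (\int[sg]_t h t = (2 * pi)^-1%:E * \int[leb]_(t in @circ R) h t)%E.
  move=> mh h0; rewrite ge0_integral_sigma// ge0_integralZr//; last exact: measurable_funTS.
  by rewrite muleC.
rewrite /Rintegral integralE [in RHS]integralE.
have mfe : measurable_fun [set: M] (fun x => (f x)%:E) by exact/measurable_EFinP.
rewrite !key//; try by [exact: measurable_funepos|exact: measurable_funeneg].
have ip := integrable_fin_num mc (integrable_funepos mc icf).
have im := integrable_fin_num mc (integrable_funeneg mc icf).
by rewrite -(fineK ip) -(fineK im) -!EFinM -!EFinB /= mulrBr.
Qed.

Lemma integral_circ_deriv (f F : R -> R) : continuous f ->
  (forall t : R, is_derive t (1 : R) F (f t)) -> F (pi / 2 + pi) = F (- (pi / 2)) ->
  Rintegral leb (@circ R) f = 0.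
Proof.
move=> cf dF FF; have pi0 := @pi_gt0 R.
have dF1 t : derivable F t 1 by case: (dF t).
rewrite /Rintegral /circ (@continuous_FTC2 _ f F).
- by rewrite FF subee.
- lra.
- exact: continuous_subspaceT.
- have cF t : {for t, continuous F}.
    by apply: differentiable_continuous; apply/derivable1_diffP; exact: dF1.
  split => [t _||]; first exact: dF1.
  + by apply: cvg_at_right_filter; exact: cF.
  + by apply: cvg_at_left_filter; exact: cF.
- by move=> t _; rewrite derive1E; have := dF t => dFt; rewrite derive_val.
Qed.

(** For n > 0 the primitives of cos (n t) and sin (n t) take the same value
    at both ends of the period. *)
Lemma cint_ecX n : cint sg setT (fun t => ec t ^+ n) = (n == 0%N)%:R.
Proof.
case: n => [|n]; first by under eq_cint do rewrite expr0; rewrite cint_cst.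
have n0 : (n.+1%:R : R) != 0 by rewrite pnatr_eq0.
have cM : continuous (fun t : R => n.+1%:R * t).
  by move=> t; apply: cvgM; [exact: cvg_cst|exact: cvg_id].
have cc : continuous (fun t : R => cos (n.+1%:R * t)).
  by move=> t; apply: (@continuous_comp _ _ _ (fun t : R => n.+1%:R * t) cos); [exact: cM|exact: continuous_cos].
have cs : continuous (fun t : R => sin (n.+1%:R * t)).
  by move=> t; apply: (@continuous_comp _ _ _ (fun t : R => n.+1%:R * t) sin); [exact: cM|exact: continuous_sin].
have pin : (2 * pi) *+ n.+1 = (pi *+ 2) *+ n.+1 :> R by rewrite mulr_natl.
have per : n.+1%:R * (pi / 2 + pi) = n.+1%:R * (- (pi / 2)) + (pi *+ 2) *+ n.+1 :> R.
  by rewrite -pin -[(2 * pi) *+ n.+1]mulr_natl; field.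
have dM (t : R) : is_derive t (1 : R) (fun t : R => n.+1%:R * t) n.+1%:R.
  have -> : (fun t : R => n.+1%:R * t) = (cst n.+1%:R * id)%R by [].
  by apply: is_derive_eq; rewrite /= scaler0 addr0 -[LHS]/(_ * _) mulr1.
have ds (t : R) : is_derive t (1 : R) (fun t => n.+1%:R^-1 * sin (n.+1%:R * t)) (cos (n.+1%:R * t)).
  have dc := is_derive1_comp (is_derive_sin (n.+1%:R * t)) (dM t).
  have -> : (fun t : R => n.+1%:R^-1 * sin (n.+1%:R * t)) = (n.+1%:R^-1 \*: (sin \o (fun t : R => n.+1%:R * t))) by [].
  by apply: is_derive_eq; rewrite -[LHS]/(_ * _) mulrC mulfK.
have dcos (t : R) : is_derive t (1 : R) (fun t => - n.+1%:R^-1 * cos (n.+1%:R * t)) (sin (n.+1%:R * t)).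
  have dc := is_derive1_comp (is_derive_cos (n.+1%:R * t)) (dM t).
  have -> : (fun t : R => - n.+1%:R^-1 * cos (n.+1%:R * t)) = (- n.+1%:R^-1 \*: (cos \o (fun t : R => n.+1%:R * t))) by [].
  by apply: is_derive_eq; rewrite -[LHS]/(_ * _) !mulNr mulrN opprK mulrC mulfK.
apply: complex_eqP => /=.
- under eq_Rintegral do rewrite ecX /=.
  rewrite Rintegral_sigma// (integral_circ_deriv _ ds)// ?mulr0//.
  by rewrite per (periodicn (@sinD2pi R)).
- under eq_Rintegral do rewrite ecX /=.
  rewrite Rintegral_sigma// (integral_circ_deriv _ dcos)// ?mulr0//.
  by rewrite per (periodicn (@cosD2pi R)).
Qed.

Lemma cmeas_ecX n : cmeas [set: M] (fun t => ec t ^+ n).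
Proof. exact/cmeasX/cmeas_ec. Qed.

Lemma modulus_ecX t n : modulus (ec t ^+ n) = 1.
Proof. by rewrite modulusX modulus_ec expr1n. Qed.

Lemma cintble_ecX n : cintble sg setT (fun t => ec t ^+ n).
Proof. by apply: (@cintble_bounded _ 1) => [|t]; [exact: cmeas_ecX|rewrite modulus_ecX]. Qed.

Lemma ec_orthonormal m n :
  cint sg setT (fun t => ec t ^+ m * (conjc (ec t ^+ n))) = (m == n)%:R.
Proof.
have E t k l : ec t ^+ (k + l) * (conjc (ec t ^+ l)) = ec t ^+ k.
  by rewrite exprD -mulrA conjcX -exprMn ec_conj expr1n mulr1.
have [mn|nm] := leqP n m.
  have -> : m = (m - n + n)%N by rewrite subnK.
  under eq_cint do rewrite E.
  by rewrite cint_ecX -[X in _ = (_ == X)%:R]add0n eqn_add2r.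
have -> : n = (n - m + m)%N by rewrite subnK// ltnW.
have -> : (m == n - m + m)%N = false by rewrite subnK 1?ltnW// ltn_eqF.
under eq_cint => t _.
  rewrite -[X in X * _]conjcK -conjcM mulrC E.
  over.
rewrite cint_conj//; last exact: cintble_ecX.
by rewrite cint_ecX subn_eq0 leqNgt nm conjc0.
Qed.

Section parseval.
Variables (b k : nat -> C).
Hypotheses (sb : csummable b) (sk : csummable k).

Definition trig (u : nat -> C) t := csum (fun n => u n * ec t ^+ n).

Lemma csummable_ec u t : csummable u -> csummable (fun n => u n * ec t ^+ n).
Proof. by apply: csummable_le => n; rewrite modulusM modulus_ecX mulr1. Qed.

Lemma trigP u t : csummable u -> csums (fun n => u n * ec t ^+ n) (trig u t).
Proof. by move=> su; apply/csummableP/csummable_ec. Qed.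

Lemma cmeas_trig u : csummable u -> cmeas [set: M] (trig u).
Proof.
move=> su; have [|||||h _] := @cint_series _ M R sg setT measurableT
  (fun n t => u n * ec t ^+ n) (trig u) (fun n => modulus (u n)) sigma_fin.
- by move=> n; apply: cmeasM; [exact: cmeas_cst|exact: cmeas_ecX].
- by move=> n; exact: modulus_ge0.
- by move=> n t _; rewrite modulusM modulus_ecX mulr1.
- exact: su.
- by move=> t _; exact: trigP.
- exact: cintble_meas h.
Qed.

Lemma modulus_trig u t : csummable u -> modulus (trig u t) <= limn (series (fun n => modulus (u n))).
Proof.
move=> su; apply: (csums_bound (trigP t su) _ su) => n.
by rewrite modulusM modulus_ecX mulr1.
Qed.

(** The series converges uniformly and f is bounded, so the integral is taken
    term by term. *)
Lemma cint_trig_mul (f : M -> C) (c : R) : cmeas setT f -> (forall t, modulus (f t) <= c) ->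
  csums (fun n => k n * cint sg setT (fun t => f t * ec t ^+ n)) (cint sg setT (fun t => f t * trig k t)).
Proof.
move=> mf fc; have c0 : 0 <= c by apply: le_trans (fc 0); exact: modulus_ge0.
have [|||||_ h] := @cint_series _ M R sg setT measurableT
  (fun n t => k n * (f t * ec t ^+ n)) (fun t => f t * trig k t) (fun n => c * modulus (k n)) sigma_fin.
- by move=> n; apply: cmeasM; [exact: cmeas_cst|apply: cmeasM => //; exact: cmeas_ecX].
- by move=> n; rewrite mulr_ge0// modulus_ge0.
- move=> n t _; rewrite !modulusM modulus_ecX mulr1 mulrC.
  by rewrite ler_wpM2r ?modulus_ge0.
- by apply/cvg_ex; eexists; exact: rseriesZ sk.
- move=> t _; apply: csums_ext (csumsZ (f t) (trigP t sk)) => n; ring.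
apply: csums_ext h => n; rewrite cintZ//.
apply: (@cintble_bounded _ c); first by apply: cmeasM => //; exact: cmeas_ecX.
by move=> t; rewrite modulusM modulus_ecX mulr1.
Qed.

End parseval.

Lemma trig_coef u n : csummable u -> cint sg setT (fun t => trig u t * (conjc (ec t ^+ n))) = u n.
Proof.
move=> su; under eq_cint do rewrite mulrC.
have := @cint_trig_mul u su (fun t => (conjc (ec t ^+ n))) 1.
case.
- exact/cmeas_conj/cmeas_ecX.
- by move=> t; rewrite modulus_conj modulus_ecX.
move=> h1 h2; apply: (@csums_unique _ (fun m => u m * (m == n)%:R)).
  apply: csums_ext (conj h1 h2) => m; congr (_ * _); rewrite -ec_orthonormal.
  by apply: eq_cint => t _; rewrite mulrC.
have key (f : nat -> R) : (forall m, m != n -> f m = 0) -> series f m @[m --> \oo] --> f n.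
  move=> f0; apply: cvg_near_cst; near=> m.
  rewrite /series /= (bigD1_seq n) ?iota_uniq//=; last first.
    by rewrite mem_index_iota /=; near: m; exists n.+1.
  by rewrite big1 ?addr0// => i; exact: f0.
split.
- have -> : complex.Re (u n) = complex.Re (u n * (n == n)%:R) by rewrite eqxx mulr1.
  by apply: (key (fun m => complex.Re (u m * (m == n)%:R))) => m /negbTE ->; rewrite mulr0.
- have -> : complex.Im (u n) = complex.Im (u n * (n == n)%:R) by rewrite eqxx mulr1.
  by apply: (key (fun m => complex.Im (u m * (m == n)%:R))) => m /negbTE ->; rewrite mulr0.
Unshelve. all: by end_near. Qed.

(** Expand one factor by [cint_trig_mul]; the Fourier coefficients of the
    other one are known by [trig_coef]. *)
Lemma parseval u k : csummable u -> csummable k ->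
  csums (fun n => u n * (conjc (k n))) (cint sg setT (fun t => trig u t * (conjc (trig k t)))).
Proof.
move=> su sk.
have sc : csummable (fun n => (conjc (k n))) by apply: csummable_le sk => n; rewrite modulus_conj.
pose W := limn (series (fun n => modulus (u n))).
have mt := cmeas_trig su.
have Wt t : modulus ((conjc (trig u t))) <= W by rewrite modulus_conj; exact: modulus_trig.
have h := @cint_trig_mul k sk (fun t => (conjc (trig u t))) W (cmeas_conj mt) Wt.
have h1 := csums_conj h.
have E : (conjc (cint sg setT (fun t => (conjc (trig u t)) * trig k t))) = cint sg setT (fun t => trig u t * (conjc (trig k t))).
  rewrite -cint_conj//; first by apply: eq_cint => t _; rewrite conjcM conjcK.
  apply: (@cintble_bounded _ (W * limn (series (fun n => modulus (k n))))).
    by apply: cmeasM; [exact: cmeas_conj|exact: cmeas_trig].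
  move=> t; rewrite modulusM; apply: ler_pM; rewrite ?modulus_ge0//.
  exact: modulus_trig.
rewrite -E; apply: csums_ext h1 => n; rewrite conjcM mulrC; congr (_ * _).
rewrite -cint_conj//; last first.
  apply: (@cintble_bounded _ W).
    by apply: cmeasM; [exact: cmeas_conj|exact: cmeas_ecX].
  by move=> t; rewrite modulusM modulus_ecX mulr1.
rewrite -[RHS](trig_coef n su); apply: eq_cint => t _.
by rewrite conjcM conjcK.
Qed.

Lemma parseval_norm u : csummable u ->
  series (fun n => modulus (u n) ^+ 2) n @[n --> \oo] -->
  Rintegral sg setT (fun t => modulus (trig u t) ^+ 2).
Proof.
move=> su; have [h _] := parseval su su.
have E (z : C) : complex.Re (z * (conjc z)) = modulus z ^+ 2.
  by rewrite modulus_sqr; case: z => x y /=; ring.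
have -> : Rintegral sg setT (fun t => modulus (trig u t) ^+ 2) =
   complex.Re (cint sg setT (fun t => trig u t * (conjc (trig u t)))).
  by apply: eq_Rintegral => t _; rewrite E.
by move: h; under [X in series X]eq_fun do rewrite E.
Qed.

End circle.

(** * Goursat's theorem on a rectangle *)

Section real_facts.
Context (R : realType).

Lemma half_step (x x0 u v lo : R) : 0 < u -> v = u / 2 -> lo <= x -> x0 = x \/ x0 = x + v ->
  [/\ x <= x0, x0 + v <= x + u & lo <= x0].
Proof. by move=> u0 -> lx [] ->; split; lra. Qed.

Lemma ltr_norm4 (p q r s e : R) : `|p| < e -> `|q| < e -> `|r| < e -> `|s| < e ->
  `|p + q + r + s| < 4 * e.
Proof.
move=> hp hq hr hs; have := ler_normD (p + q + r) s.
have := ler_normD (p + q) r; have := ler_normD p q; lra.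
Qed.

Lemma ler_norm_sub2 (p q e : R) : `|p| <= e -> `|q| <= e -> `|p - q| <= 2 * e.
Proof. by move=> hp hq; have := ler_normB p q; lra. Qed.

Lemma dist_in_segment (x0 l u x : R) : x0 <= u <= x0 + l -> x0 <= x <= x0 + l -> `|u - x| <= l.
Proof. by move=> /andP[h1 h2] /andP[h3 h4]; rewrite ler_norml; apply/andP; split; lra. Qed.

Lemma le_sum3 (p q r : R) : 0 <= p -> 0 <= q -> 0 <= r ->
  [/\ p <= 2 + p + q + r - 1, q <= 2 + p + q + r - 1 & r <= 2 + p + q + r - 1].
Proof. by move=> *; split; lra. Qed.

End real_facts.

Section goursat.
Context (R : realType).
Local Notation leb := (@lebesgue_measure R).
Local Notation M := (measurableTypeR R).

Definition seg (f : R -> R) (a b : R) := Rintegral leb `[a, b] f.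

(** Continuity relative to the closed interval, as the fundamental theorem
    and compactness arguments want it. *)
Definition cont_on (f : R -> R) (a b : R) := {within `[a, b], continuous f}.

Let mcc (a b : R) : measurable (`[a, b]%classic : set M).
Proof. exact: measurable_itv. Qed.

Lemma cont_onB f g (a b : R) : cont_on f a b -> cont_on g a b -> cont_on (fun x => f x - g x) a b.
Proof. by move=> cf cg x; apply: cvgB; [exact: cf|exact: cg]. Qed.

Lemma cont_on_cst (c a b : R) : cont_on (fun=> c) a b.
Proof. by apply: continuous_subspaceT => x; exact: cst_continuous. Qed.

Lemma cont_on_integrable f a b : cont_on f a b -> leb.-integrable `[a, b] (EFin \o f).
Proof.
by move=> cf; apply: continuous_compact_integrable => //; exact: segment_compact.
Qed.

Lemma cont_onS f a b c d : a <= c -> d <= b -> cont_on f a b -> cont_on f c d.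
Proof.
by move=> ac db; apply: continuous_subspaceW => x /=; rewrite !in_itv/= => /andP[cx xd];
  rewrite (le_trans ac)//= (le_trans xd).
Qed.

Lemma seg_split f (a b c : R) : a <= c -> c <= b -> cont_on f a b ->
  seg f a b = seg f a c + seg f c b.
Proof.
move=> ac cb cf; rewrite /seg.
have icf := cont_on_integrable cf.
have -> : `[a, b]%classic = `[a, c]%classic `|` `]c, b]%classic :> set M.
  by rewrite -itv_bndbnd_setU// bnd_simp.
rewrite Rintegral_setU//.
- congr (_ + _); rewrite /Rintegral; congr fine; apply: integral_itv_obnd_cbnd.
  have := cont_on_integrable (cont_onS ac (lexx _) cf) => /measurable_int.
  by apply: measurable_funS; [exact: measurable_itv|apply: subset_itv_oc_cc].
- by rewrite -itv_bndbnd_setU// bnd_simp.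
- apply/disj_setPLR => x /=; rewrite !in_itv/= => /andP[_ xc] /andP[cx _].
  by move: cx; rewrite ltNge xc.
Qed.

Lemma seg_bound f (a b c : R) : a <= b -> cont_on f a b ->
  (forall x, a <= x <= b -> `|f x| <= c) -> `|seg f a b| <= c * (b - a).
Proof.
move=> ab cf fc; have icf := cont_on_integrable cf.
have mab := mcc a b.
apply: le_trans (le_normr_Rintegral mab icf) _.
apply: (@le_trans _ _ (Rintegral leb `[a, b] (fun=> c))).
  apply: le_Rintegral => //.
  - exact: integrable_norm icf.
  - apply: continuous_compact_integrable; first exact: segment_compact.
    by apply: continuous_subspaceT => x; exact: cst_continuous.
rewrite (Rintegral_cst _ mab); have := @lebesgue_measure_itv R `[a, b]; rewrite /= lte_fin.
move: ab; rewrite le_eqVlt => /predU1P[->|ab].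
  by rewrite ltxx => ->; rewrite subrr.
by rewrite ab => ->; rewrite -EFinB.
Qed.

Lemma segB f g (a b : R) : cont_on f a b -> cont_on g a b ->
  seg (fun x => f x - g x) a b = seg f a b - seg g a b.
Proof.
by move=> cf cg; apply: RintegralB; [exact: mcc|exact: cont_on_integrable|exact: cont_on_integrable].
Qed.

Lemma seg_cst (c a b : R) : a <= b -> seg (fun=> c) a b = c * (b - a).
Proof.
move=> ab; rewrite /seg (Rintegral_cst _ (mcc a b)).
have := @lebesgue_measure_itv R `[a, b]; rewrite /= lte_fin.
move: ab; rewrite le_eqVlt => /predU1P[->|ab].
  by rewrite ltxx => ->; rewrite subrr.
by rewrite ab => ->; rewrite -EFinB.
Qed.

Lemma cont_onP f (a b : R) : (forall x, a <= x <= b -> forall e, 0 < e ->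
    exists2 d, 0 < d & forall y, a <= y <= b -> `|y - x| <= d -> `|f y - f x| <= e) ->
  cont_on f a b.
Proof.
move=> h; apply/subspace_continuousP => x; rewrite /= in_itv/= => xab.
apply/cvgrPdist_le => e e0; have [d d0 hd] := h x xab e e0.
rewrite near_withinE; apply/nbhs_ballP; exists d => //= y; rewrite /ball/= distrC => /ltW yd yab.
by rewrite distrC; apply: hd => //; move: yab; rewrite in_itv.
Qed.

Section closed_form.
Variables (U V : R -> R -> R) (a b c d : R).
Hypotheses (ab : a < b) (cd : c < d).

Definition rect x y := (a <= x <= b) && (c <= y <= d).

(* U dx + V dy is differentiable, and closed: q serves twice *)
Hypothesis UV : forall x y, rect x y -> exists p q r, forall e, 0 < e ->
  exists2 dl, 0 < dl & forall x' y', rect x' y' -> `|x' - x| <= dl -> `|y' - y| <= dl ->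
    `|U x' y' - U x y - (p * (x' - x) + q * (y' - y))| <= e * (`|x' - x| + `|y' - y|) /\
    `|V x' y' - V x y - (q * (x' - x) + r * (y' - y))| <= e * (`|x' - x| + `|y' - y|).

Lemma contUV x y : rect x y -> forall e, 0 < e ->
  exists2 dl, 0 < dl & forall x' y', rect x' y' -> `|x' - x| <= dl -> `|y' - y| <= dl ->
    `|U x' y' - U x y| <= e /\ `|V x' y' - V x y| <= e.
Proof.
move=> xy e e0; have [p [q [r H]]] := UV xy.
have [dl dl0 hdl] := H 1 ltr01.
pose K := 2 + `|p| + `|q| + `|r|; have K0 : 0 < K by rewrite /K; have := normr_ge0 p; have := normr_ge0 q; have := normr_ge0 r; lra.
exists (Num.min dl (e / (K * 2))); first by rewrite lt_min dl0/= divr_gt0// mulr_gt0.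
move=> x' y' xy' hx hy.
have [hx1 hy1] : `|x' - x| <= dl /\ `|y' - y| <= dl.
  by split; [apply: le_trans hx _|apply: le_trans hy _]; rewrite ge_min lexx.
have [hx2 hy2] : `|x' - x| <= e / (K * 2) /\ `|y' - y| <= e / (K * 2).
  by split; [apply: le_trans hx _|apply: le_trans hy _]; rewrite ge_min lexx orbT.
have [h1 h2] := hdl x' y' xy' hx1 hy1.
have key (u v : R) : `|u| <= K - 1 -> `|v| <= K - 1 -> forall w,
    `|w - (u * (x' - x) + v * (y' - y))| <= 1 * (`|x' - x| + `|y' - y|) -> `|w| <= e.
  move=> hu hv w hw.
  have -> : w = (w - (u * (x' - x) + v * (y' - y))) + (u * (x' - x) + v * (y' - y)) by ring.
  apply: le_trans (ler_normD _ _) _; apply: le_trans (lerD hw (ler_normD _ _)) _.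
  rewrite !normrM mul1r.
  apply: (@le_trans _ _ (K * `|x' - x| + K * `|y' - y|)).
    have : `|u| * `|x' - x| <= (K - 1) * `|x' - x| by rewrite ler_wpM2r.
    have : `|v| * `|y' - y| <= (K - 1) * `|y' - y| by rewrite ler_wpM2r.
    by lra.
  apply: (@le_trans _ _ (K * (e / (K * 2)) + K * (e / (K * 2)))).
    by apply: lerD; rewrite ler_pM2l.
  by rewrite le_eqVlt; apply/orP; left; apply/eqP; field; rewrite gt_eqF.
have np := normr_ge0 p; have nq := normr_ge0 q; have nr := normr_ge0 r.
have [kp kq kr] := le_sum3 np nq nr.
by split; [exact: (key p q kp kq)|exact: (key q r kq kr)].
Qed.

Let contU y : c <= y <= d -> cont_on (U ^~ y) a b.
Proof.
move=> ycd; apply: cont_onP => x xab e e0.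
have xy : rect x y by rewrite /rect xab.
have [dl dl0 h] := contUV xy e0; exists dl => // x' x'ab hx.
by have [] := h x' y _ hx; rewrite ?/rect ?x'ab// subrr normr0 ltW.
Qed.

Let contV x : a <= x <= b -> cont_on (V x) c d.
Proof.
move=> xab; apply: cont_onP => y ycd e e0.
have xy : rect x y by rewrite /rect xab.
have [dl dl0 h] := contUV xy e0; exists dl => // y' y'cd hy.
by have [] := h x y' _ _ hy; rewrite ?/rect ?xab ?y'cd// subrr normr0 ltW.
Qed.

Let circu x x' y y' := seg (fun u => U u y - U u y') x x' + seg (fun v => V x' v - V x v) y y'.

Let circuE x x' y y' : a <= x -> x <= x' -> x' <= b -> c <= y -> y <= y' -> y' <= d ->
  circu x x' y y' = seg (U ^~ y) x x' - seg (U ^~ y') x x' + (seg (V x') y y' - seg (V x) y y').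
Proof.
move=> ax xx xb cy yy yd; rewrite /circu !segB//.
- by apply: (cont_onS cy yd); apply: contV; rewrite xb (le_trans ax).
- by apply: (cont_onS cy yd); apply: contV; rewrite ax (le_trans xx).
- by apply: (cont_onS ax xb); apply: contU; rewrite cy (le_trans yy).
- by apply: (cont_onS ax xb); apply: contU; rewrite yd (le_trans cy).
Qed.

Let circu4 x m x' y n y' : a <= x -> x <= m -> m <= x' -> x' <= b ->
   c <= y -> y <= n -> n <= y' -> y' <= d ->
  circu x x' y y' = circu x m y n + circu m x' y n + circu x m n y' + circu m x' n y'.
Proof.
move=> ax xm mx xb cy yn ny yd.
have xx' := le_trans xm mx; have yy' := le_trans yn ny.
have am := le_trans ax xm; have mb := le_trans mx xb.
have cn := le_trans cy yn; have nd := le_trans ny yd.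
rewrite !circuE//.
have sU y0 : c <= y0 -> y0 <= d -> seg (U ^~ y0) x x' = seg (U ^~ y0) x m + seg (U ^~ y0) m x'.
  by move=> h1 h2; apply: seg_split => //; apply: (cont_onS ax xb); apply: contU; rewrite h1.
have sV x0 : a <= x0 -> x0 <= b -> seg (V x0) y y' = seg (V x0) y n + seg (V x0) n y'.
  by move=> h1 h2; apply: seg_split => //; apply: (cont_onS cy yd); apply: contV; rewrite h1.
rewrite !sU// ?sV//; try by [exact: le_trans yy' _|exact: le_trans cy _|exact: le_trans ax _|exact: le_trans xx' _].
ring.
all: by [exact: le_trans yd|exact: le_trans yy'|exact: le_trans xx'].
Qed.

Let A := b - a.
Let B := d - c.
Let w n : R := 2^-1 ^+ n.

Let w0 n : 0 < w n. Proof. by rewrite exprn_gt0. Qed.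

Let sub (n : nat) (p : R * R) := [&& a <= p.1, p.1 + A * w n <= b, c <= p.2 & p.2 + B * w n <= d].
Let big (eta : R) (n : nat) (p : R * R) :=
  eta * (w n * w n) <= `|circu p.1 (p.1 + A * w n) p.2 (p.2 + B * w n)|.
Let inside (n : nat) (p p' : R * R) := [&& p.1 <= p'.1, p'.1 + A * w n.+1 <= p.1 + A * w n,
   p.2 <= p'.2 & p'.2 + B * w n.+1 <= p.2 + B * w n].

(** The circulation is the sum of those around the four quarters, so one of
    them carries at least a quarter of it. *)
Let step eta n p : sub n p -> big eta n p ->
  exists p', [&& sub n.+1 p', big eta n.+1 p' & inside n p p'].
Proof.
move=> /and4P[h1 h2 h3 h4] hb; have wS : w n.+1 = w n / 2 by rewrite /w exprSr.
have A0 : 0 < A * w n by rewrite mulr_gt0// subr_gt0.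
have B0 : 0 < B * w n by rewrite mulr_gt0// subr_gt0.
pose x := p.1; pose y := p.2; pose m := x + A * w n.+1; pose k := y + B * w n.+1.
have eA : A * w n.+1 = A * w n / 2 by rewrite wS; ring.
have eB : B * w n.+1 = B * w n / 2 by rewrite wS; ring.
have E := @circu4 x m (x + A * w n) y k (y + B * w n).
have em : m + A * w n.+1 = x + A * w n by rewrite /m eA; lra.
have ek : k + B * w n.+1 = y + B * w n by rewrite /k eB; lra.
apply: contrapT => /forallNP H.
have small (x0 y0 : R) : x0 = x \/ x0 = m -> y0 = y \/ y0 = k ->
    `|circu x0 (x0 + A * w n.+1) y0 (y0 + B * w n.+1)| < eta * (w n.+1 * w n.+1).
  move=> hx0 hy0; rewrite ltNge; apply/negP => hbig; apply: (H (x0, y0)).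
  rewrite /sub /big /inside /= hbig.
  have [hA1 hA2 hA3] : [/\ x <= x0, x0 + A * w n.+1 <= x + A * w n & a <= x0].
    exact: (half_step A0 eA h1 hx0).
  have [hB1 hB2 hB3] : [/\ y <= y0, y0 + B * w n.+1 <= y + B * w n & c <= y0].
    exact: (half_step B0 eB h3 hy0).
  by rewrite hA1 hA2 hA3 hB1 hB2 hB3 (le_trans hA2)// (le_trans hB2).
have s1 := small x y (or_introl erefl) (or_introl erefl).
have s2 := small m y (or_intror erefl) (or_introl erefl).
have s3 := small x k (or_introl erefl) (or_intror erefl).
have s4 := small m k (or_intror erefl) (or_intror erefl).
rewrite -/m -/k em ek in s1 s2 s3 s4.
have [xm mx _] := half_step A0 eA h1 (or_intror erefl : m = x \/ m = x + A * w n.+1).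
have [yk ky _] := half_step B0 eB h3 (or_intror erefl : k = y \/ k = y + B * w n.+1).
have AS : 0 <= A * w n.+1 by rewrite eA divr_ge0// ltW.
have BS : 0 <= B * w n.+1 by rewrite eB divr_ge0// ltW.
have mx' : m <= x + A * w n by apply: le_trans mx; rewrite lerDl.
have ky' : k <= y + B * w n by apply: le_trans ky; rewrite lerDl.
move: hb; rewrite /big -/x -/y (E h1 xm mx' h2 h3 yk ky' h4) leNgt => /negP; apply.
have -> : eta * (w n * w n) = 4 * (eta * (w n.+1 * w n.+1)) by rewrite wS; field.
exact: ltr_norm4.
Qed.

(** Bisection. If the circulation were not zero, nested rectangles of sides
    proportional to 2^-n would carry circulation at least eta 4^-n. At their
    common point the form differs from its linear part by o(2^-n), and the
    linear part has no circulation since its mixed coefficients agree; this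
    gives a circulation o(4^-n). *)
Lemma goursat : seg (fun u => U u c - U u d) a b + seg (fun v => V b v - V a v) c d = 0.
Proof.
rewrite -/(circu a b c d).
apply/eqP/negPn/negP => nz; pose eta := `|circu a b c d|.
have eta0 : 0 < eta by rewrite normr_gt0.
have A0 : 0 < A by rewrite subr_gt0.
have B0 : 0 < B by rewrite subr_gt0.
have /choice[f hf] : forall np : nat * (R * R), exists p', sub np.1 np.2 -> big eta np.1 np.2 ->
    [&& sub np.1.+1 p', big eta np.1.+1 p' & inside np.1 np.2 p'].
  move=> [n p] /=.
  have [h1|h1] := boolP (sub n p); last by exists p.
  have [h2|h2] := boolP (big eta n p); last by exists p.
  by have [p' hp'] := step h1 h2; exists p'.
pose pt := fix pt n := if n is m.+1 then f (m, pt m) else (a, c).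
have w00 : w 0 = 1 by rewrite /w expr0.
have inv n : sub n (pt n) && big eta n (pt n).
  elim: n => [|n /andP[h1 h2]].
    by rewrite /sub /big /= w00 !mulr1 !lexx /A /B !subrKC !lexx /=.
  by have /and3P[-> -> _] := hf (n, pt n) h1 h2.
have ins n : inside n (pt n) (pt n.+1).
  by have /andP[h1 h2] := inv n; have /and3P[_ _] := hf (n, pt n) h1 h2.
have mono n k : [/\ (pt n).1 <= (pt (n + k)%N).1, (pt (n + k)%N).1 + A * w (n + k) <= (pt n).1 + A * w n,
    (pt n).2 <= (pt (n + k)%N).2 & (pt (n + k)%N).2 + B * w (n + k) <= (pt n).2 + B * w n].
  elim: k => [|k [h1 h2 h3 h4]]; first by rewrite addn0 !lexx.
  rewrite addnS; have /and4P[g1 g2 g3 g4] := ins (n + k)%N.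
  by split; [exact: le_trans h1 g1|exact: le_trans g2 h2|exact: le_trans h3 g3|exact: le_trans g4 h4].
have ubx n m : (pt m).1 <= (pt n).1 + A * w n.
  have [mn|nm] := leqP m n.
    have [+ _ _ _] := mono m (n - m)%N; rewrite subnKC// => /le_trans; apply.
    by rewrite lerDl mulr_ge0 ?ltW.
  have [_ + _ _] := mono n (m - n)%N; rewrite subnKC 1?ltnW//; apply: le_trans.
  by rewrite lerDl mulr_ge0 ?ltW.
have uby n m : (pt m).2 <= (pt n).2 + B * w n.
  have [mn|nm] := leqP m n.
    have [_ _ + _] := mono m (n - m)%N; rewrite subnKC// => /le_trans; apply.
    by rewrite lerDl mulr_ge0 ?ltW.
  have [_ _ _ +] := mono n (m - n)%N; rewrite subnKC 1?ltnW//; apply: le_trans.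
  by rewrite lerDl mulr_ge0 ?ltW.
pose X := range (fun n => (pt n).1); pose Y := range (fun n => (pt n).2).
pose x := sup X; pose y := sup Y.
have hx n : (pt n).1 <= x <= (pt n).1 + A * w n.
  apply/andP; split.
    by apply: ub_le_sup; [exists ((pt 0).1 + A * w 0) => _ [m _ <-]; exact: ubx|exists n].
  by apply: ge_sup; [exists (pt 0).1; exists 0%N|move=> _ [m _ <-]; exact: ubx].
have hy n : (pt n).2 <= y <= (pt n).2 + B * w n.
  apply/andP; split.
    by apply: ub_le_sup; [exists ((pt 0).2 + B * w 0) => _ [m _ <-]; exact: uby|exists n].
  by apply: ge_sup; [exists (pt 0).2; exists 0%N|move=> _ [m _ <-]; exact: uby].
have subn n : [/\ a <= (pt n).1, (pt n).1 + A * w n <= b, c <= (pt n).2 & (pt n).2 + B * w n <= d].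
  by have /andP[/and4P[]] := inv n.
have rxy : rect x y.
  have [s1 s2 s3 s4] := subn 0%N; have /andP[x1 x2] := hx 0%N; have /andP[y1 y2] := hy 0%N.
  rewrite /rect (le_trans s1 x1) (le_trans x2 s2) (le_trans s3 y1) (le_trans y2 s4)//.
have [p [q [r H]]] := UV rxy.
have S0 : 0 < A + B by rewrite addr_gt0.
pose e := eta / (4 * (A + B) ^+ 2).
have e0 : 0 < e by rewrite divr_gt0// mulr_gt0// exprn_gt0.
have [dl dl0 hdl] := H e e0.
have [n hn] := ex_pow2_ge ((A + B) / dl).
have wn : (A + B) * w n <= dl.
  by rewrite ler_pdivrMr// in hn; rewrite /w exprVn ler_pdivrMr ?exprn_gt0// mulrC.
have [s1 s2 s3 s4] := subn n; have /andP[x1 x2] := hx n; have /andP[y1 y2] := hy n.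
have /andP[_ hbig] := inv n.
move: s1 s2 s3 s4 x1 x2 y1 y2 hbig; rewrite /big.
set x0 := (pt n).1; set y0 := (pt n).2; set x' := x0 + A * w n; set y' := y0 + B * w n.
move=> s1 s2 s3 s4 x1 x2 y1 y2 hbig.
have Aw : 0 < A * w n by rewrite mulr_gt0.
have Bw : 0 < B * w n by rewrite mulr_gt0.
have xx : x0 <= x' by rewrite lerDl ltW.
have yy : y0 <= y' by rewrite lerDl ltW.
have loc u v : x0 <= u <= x' -> y0 <= v <= y' ->
    `|U u v - U x y - (p * (u - x) + q * (v - y))| <= e * ((A + B) * w n) /\
    `|V u v - V x y - (q * (u - x) + r * (v - y))| <= e * ((A + B) * w n).
  move=> /andP[u1 u2] /andP[v1 v2].
  have du : `|u - x| <= A * w n by apply: (@dist_in_segment _ x0); [rewrite u1|rewrite x1].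
  have dv : `|v - y| <= B * w n by apply: (@dist_in_segment _ y0); [rewrite v1|rewrite y1].
  have ruv : rect u v by rewrite /rect (le_trans s1 u1) (le_trans u2 s2) (le_trans s3 v1) (le_trans v2 s4).
  have wn' : A * w n + B * w n <= dl by rewrite -mulrDl.
  have dux : `|u - x| <= dl by apply: le_trans du (le_trans _ wn'); rewrite lerDl ltW.
  have dvy : `|v - y| <= dl by apply: le_trans dv (le_trans _ wn'); rewrite lerDr ltW.
  have [h1 h2] := hdl u v ruv dux dvy.
  have le_e : e * (`|u - x| + `|v - y|) <= e * ((A + B) * w n).
    by rewrite ler_pM2l// mulrDl lerD.
  by split; [exact: le_trans h1 le_e|exact: le_trans h2 le_e].
have cU v : y0 <= v <= y' -> cont_on (U ^~ v) x0 x'.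
  by move=> /andP[v1 v2]; apply: (cont_onS s1 s2); apply: contU; rewrite (le_trans s3 v1) (le_trans v2 s4).
have cV u : x0 <= u <= x' -> cont_on (V u) y0 y'.
  by move=> /andP[v1 v2]; apply: (cont_onS s3 s4); apply: contV; rewrite (le_trans s1 v1) (le_trans v2 s2).
have hy0 : y0 <= y0 <= y' by rewrite lexx. have hy' : y0 <= y' <= y' by rewrite lexx yy.
have hx0 : x0 <= x0 <= x' by rewrite lexx. have hx' : x0 <= x' <= x' by rewrite lexx xx.
have b1 : `|seg (fun u => U u y0 - U u y' - q * (y0 - y')) x0 x'| <= 2 * (e * ((A + B) * w n)) * (x' - x0).
  apply: seg_bound => //.
    by apply: cont_onB; [apply: cont_onB; exact: cU|exact: cont_on_cst].
  move=> u hu; have [h1 _] := loc u y0 hu hy0; have [h2 _] := loc u y' hu hy'.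
  have -> : U u y0 - U u y' - q * (y0 - y') = (U u y0 - U x y - (p * (u - x) + q * (y0 - y))) - (U u y' - U x y - (p * (u - x) + q * (y' - y))) by ring.
  exact: ler_norm_sub2.
have b2 : `|seg (fun v => V x' v - V x0 v - q * (x' - x0)) y0 y'| <= 2 * (e * ((A + B) * w n)) * (y' - y0).
  apply: seg_bound => //.
    by apply: cont_onB; [apply: cont_onB; exact: cV|exact: cont_on_cst].
  move=> v hv; have [_ h1] := loc x' v hx' hv; have [_ h2] := loc x0 v hx0 hv.
  have -> : V x' v - V x0 v - q * (x' - x0) = (V x' v - V x y - (q * (x' - x) + r * (v - y))) - (V x0 v - V x y - (q * (x0 - x) + r * (v - y))) by ring.
  exact: ler_norm_sub2.
rewrite segB in b1; [|by apply: cont_onB; exact: cU|exact: cont_on_cst].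
rewrite segB in b2; [|by apply: cont_onB; exact: cV|exact: cont_on_cst].
rewrite seg_cst// in b1; rewrite seg_cst// in b2.
have E : circu x0 x' y0 y' = (seg (fun u => U u y0 - U u y') x0 x' - q * (y0 - y') * (x' - x0)) +
   (seg (fun v => V x' v - V x0 v) y0 y' - q * (x' - x0) * (y' - y0)).
  by rewrite /circu; ring.
move: hbig; rewrite E => hbig.
have := le_trans hbig (le_trans (ler_normD _ _) (lerD b1 b2)).
have -> : 2 * (e * ((A + B) * w n)) * (x' - x0) + 2 * (e * ((A + B) * w n)) * (y' - y0) = eta / 2 * (w n * w n).
  by rewrite /x' /y' /e; field; rewrite gt_eqF.
rewrite ler_pM2r ?mulr_gt0// leNgt => /negP; apply.
by rewrite ltr_pdivrMr// ltr_pMr// ltr1n.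
Qed.

End closed_form.
End goursat.

(** * Complex differentiability *)

Section complex_diff.
Context (R : realType).
Local Notation C := R[i].
Local Notation M := (measurableTypeR R).

Lemma normCE (z : C) : `|z| = (modulus z)%:C%C.
Proof. by case: z => a b; rewrite /modulus. Qed.

Lemma posC (e : C) : 0 < e -> e = (complex.Re e)%:C%C /\ 0 < complex.Re e.
Proof.
case: e => a b; rewrite ltcE/= => /andP[/eqP b0 a0]; split => //.
by rewrite b0.
Qed.

(** The first-order expansion of f at z with derivative d. Unlike a limit of
    difference quotients it makes sense at w = z, which simplifies estimates
    along curves. *)
Definition cdiff (f : C -> C) z d := forall e : R, 0 < e -> exists2 dl : R, 0 < dl &
  forall w, modulus (w - z) <= dl -> modulus (f w - f z - d * (w - z)) <= e * modulus (w - z).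

Definition cdiffable f z := exists d, cdiff f z d.

Lemma cdiffableP (f : C -> C) z : derivable (f : C^o -> C^o) z 1 <-> cdiffable f z.
Proof.
split.
  move=> /cvg_ex[/= d h]; exists d => e e0.
  move/cvgrPdist_le: h => /(_ e%:C%C); rewrite ltcR => /(_ e0).
  rewrite near_withinE => /nbhs_ballP[dl /= dl0 hdl].
  have [edl dl0'] := posC dl0.
  exists (complex.Re dl / 2); first by rewrite divr_gt0.
  move=> w hw; have [->|wz] := eqVneq w z; first by rewrite !subrr mulr0 subrr modulus0 mulr0.
  have h0 : w - z != 0 by rewrite subr_eq0.
  have := hdl (w - z); rewrite /ball/= sub0r normrN normCE edl ltcR => /(_ _ h0).
  rewrite (le_lt_trans hw) ?ltr_pdivrMr ?ltr_pMr ?ltr1n// => /(_ isT).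
  rewrite normCE lecR [(_ *: 1 : C^o)]mulr1 subrK -[X in d - X]/((w - z)^-1 * (f w - f z)) => hd.
  have -> : f w - f z - d * (w - z) = - ((w - z) * (d - (w - z)^-1 * (f w - f z))).
    by field.
  by rewrite modulusN modulusM mulrC ler_wpM2r ?modulus_ge0.
move=> [d h]; apply/cvg_ex; exists d; apply/cvgrPdist_le => /= e e0.
have [ee e0'] := posC e0.
have [dl dl0 hd] := h _ e0'.
rewrite near_withinE; apply/nbhs_ballP; exists dl%:C%C => /=; first by rewrite ltcR.
move=> k; rewrite /ball/= sub0r normrN normCE ltcR => hk k0.
rewrite normCE ee lecR [(_ *: 1 : C^o)]mulr1 -[X in d - X]/(k^-1 * (f (k + z) - f z)).
have := hd (k + z); rewrite addrK => /(_ (ltW hk)).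
have -> : d - k^-1 * (f (k + z) - f z) = - (k^-1 * (f (k + z) - f z - d * k)) by field.
by rewrite modulusN modulusM modulusV ler_pdivrMl ?modulus_gt0// [leRHS]mulrC.
Qed.

Lemma cdiffable_cst (c z : C) : cdiffable (fun=> c) z.
Proof. by apply/cdiffableP; exact: derivable_cst. Qed.

Lemma cdiffable_id z : cdiffable id z.
Proof. by apply/cdiffableP; exact: derivable_id. Qed.

Lemma cdiffableB f g z : cdiffable f z -> cdiffable g z -> cdiffable (fun w => f w - g w) z.
Proof. by move=> /cdiffableP hf /cdiffableP hg; apply/cdiffableP; exact: derivableB. Qed.

Lemma cdiffableV f z : f z != 0 -> cdiffable f z -> cdiffable (fun w => (f w)^-1) z.
Proof. by move=> fz /cdiffableP hf; apply/cdiffableP; exact: (@derivableV C C^o). Qed.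

Definition ccont (f : C -> C) z := forall e : R, 0 < e -> exists2 dl : R, 0 < dl &
  forall w, modulus (w - z) <= dl -> modulus (f w - f z) <= e.

Lemma cdiffable_cont f z : cdiffable f z -> ccont f z.
Proof.
move=> [d h] e e0; have [dl dl0 hd] := h 1 ltr01.
have K0 : 0 < 1 + modulus d by have := modulus_ge0 d; lra.
exists (Num.min dl (e / (1 + modulus d))); first by rewrite lt_min dl0/= divr_gt0.
move=> w; rewrite le_min => /andP[h1 h2].
rewrite -(subrK (d * (w - z)) (f w - f z)); apply: le_trans (modulusD _ _) _.
apply: le_trans (lerD (hd w h1) (lexx _)) _.
by rewrite modulusM -mulrDl mulrC -ler_pdivlMr.
Qed.

Lemma cdiffableM f g z : cdiffable f z -> cdiffable g z -> cdiffable (fun w => f w * g w) z.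
Proof.
move=> [d hd] hg; have cg := cdiffable_cont hg; have [d' hd'] := hg.
exists (d * g z + f z * d') => e e0.
have [d0 f0 g0] := And3 (modulus_ge0 d) (modulus_ge0 (f z)) (modulus_ge0 (g z)).
pose K := 1 + modulus d + modulus (f z) + modulus (g z).
have K0 : 0 < K by rewrite /K; lra.
have e' : 0 < e / K by rewrite divr_gt0.
have [d1 d10 h1] := hd _ e'. have [d2 d20 h2] := hd' _ e'.
have [d3 d30 h3] := cg _ e'. have [d4 d40 h4] := cg _ ltr01.
exists (Num.min (Num.min d1 d2) (Num.min d3 d4)); first by rewrite !lt_min d10 d20 d30.
move=> w; rewrite !le_min => /andP[/andP[/h1 {}h1 /h2 {}h2] /andP[/h3 {}h3 /h4 {}h4]].
set x := modulus (w - z) in h1 h2 *; have x0 : 0 <= x by exact: modulus_ge0.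
have -> : f w * g w - f z * g z - (d * g z + f z * d') * (w - z) =
   (f w - f z - d * (w - z)) * g w + (f z * (g w - g z - d' * (w - z)) + (d * (w - z)) * (g w - g z)) by ring.
apply: le_trans (modulusD _ _) _; apply: le_trans (lerD (lexx _) (modulusD _ _)) _.
rewrite !modulusM -/x.
have gw : modulus (g w) <= 1 + modulus (g z).
  by rewrite -[g w](subrK (g z)); apply: le_trans (modulusD _ _) _; rewrite lerD2r.
have y1 : modulus (f w - f z - d * (w - z)) * modulus (g w) <= e / K * x * (1 + modulus (g z)).
  by apply: ler_pM; rewrite ?modulus_ge0.
have y2 : modulus (f z) * modulus (g w - g z - d' * (w - z)) <= modulus (f z) * (e / K * x) by rewrite ler_wpM2l.
have y3 : modulus d * x * modulus (g w - g z) <= modulus d * x * (e / K).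
  by rewrite ler_wpM2l// mulr_ge0.
apply: le_trans (lerD y1 (lerD y2 y3)) _.
have yK : e / K * K = e by rewrite divfK// gt_eqF.
suff H (a b c y : R) : y * x * (1 + c) + (b * (y * x) + a * x * y) = y * (1 + a + b + c) * x.
  by rewrite H -/K yK.
ring.
Qed.

Lemma cdiffableX f n z : cdiffable f z -> cdiffable (fun w => f w ^+ n) z.
Proof.
move=> hf; elim: n => [|n ih]; first by under eq_fun do rewrite expr0; exact: cdiffable_cst.
by under eq_fun do rewrite exprS; exact: cdiffableM.
Qed.

Lemma ccontM f g z : ccont f z -> ccont g z -> ccont (fun w => f w * g w) z.
Proof.
move=> hf hg e e0.
pose K := 1 + modulus (f z) + modulus (g z).
have fz := modulus_ge0 (f z). have gz := modulus_ge0 (g z).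
have K0 : 0 < K by rewrite /K; lra.
have e' : 0 < Num.min 1 (e / (2 * K)) by rewrite lt_min ltr01 divr_gt0// mulr_gt0.
have [d1 d10 h1] := hf _ e'. have [d2 d20 h2] := hg _ e'.
exists (Num.min d1 d2); first by rewrite lt_min d10.
move=> w; rewrite le_min => /andP[/h1 + /h2]; rewrite !le_min => /andP[a1 a2] /andP[b1 b2].
have -> : f w * g w - f z * g z = (f w - f z) * (g w - g z) + ((f w - f z) * g z + f z * (g w - g z)) by ring.
apply: le_trans (modulusD _ _) _; apply: le_trans (lerD (lexx _) (modulusD _ _)) _.
rewrite !modulusM.
have : modulus (f w - f z) * modulus (g w - g z) <= modulus (f w - f z) by rewrite ler_piMr ?modulus_ge0.
have : modulus (f w - f z) * modulus (g z) <= (e / (2 * K)) * modulus (g z) by rewrite ler_wpM2r.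
have : modulus (f z) * modulus (g w - g z) <= modulus (f z) * (e / (2 * K)) by rewrite ler_wpM2l.
have : e / (2 * K) * K <= e by rewrite (_ : _ * K = e / 2); [lra|field; rewrite gt_eqF].
move: a2 => /[swap]; rewrite {2}/K; set x := e / _ => hx a2 y1 y2 y3.
have x0 : 0 <= x by rewrite divr_ge0// ltW// mulr_gt0.
lra.
Qed.

End complex_diff.

(** * Circular means of holomorphic functions *)

Section circle_mean.
Context (R : realType).
Local Notation C := R[i].
Local Notation M := (measurableTypeR R).
Local Notation leb := (@lebesgue_measure R).

Lemma is_derive_bound (f : R -> R) (x d : R) : is_derive x 1 f d -> forall e : R, 0 < e ->
  exists2 dl : R, 0 < dl & forall h, `|h| <= dl -> `|f (x + h) - f x - d * h| <= e * `|h|.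
Proof.
move=> [/cvg_ex[/= l hl] hd] e e0.
have ld : l = d by rewrite -hd; apply/esym/cvg_lim.
rewrite ld in hl; move/cvgrPdist_le: hl => /(_ e e0).
rewrite near_withinE => /nbhs_ballP[dl /= dl0 hdl].
exists (dl / 2); first by rewrite divr_gt0.
move=> h hh; have [->|h0] := eqVneq h 0; first by rewrite addr0 subrr mulr0 subr0 normr0 mulr0.
have := hdl h; rewrite /ball/= sub0r normrN => /(_ _ h0).
rewrite (le_lt_trans hh) ?ltr_pdivrMr ?ltr_pMr ?ltr1n// => /(_ isT).
rewrite [(_ *: 1)]mulr1 -[X in d - X]/(h^-1 * (f (h + x) - f x)) (addrC h) => hb.
have -> : f (x + h) - f x - d * h = - (h * (d - h^-1 * (f (x + h) - f x))) by field.
by rewrite normrN normrM mulrC ler_wpM2r.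
Qed.

(** Logarithmic coordinates: w = e^(s + i t) turns an annulus into a
    rectangle, on which [goursat] applies. *)
Definition cexp (s t : R) : C := (expR s)%:C%C * ec t.

Lemma cexpD s t h k : cexp (s + h) (t + k) = cexp s t * cexp h k.
Proof. by rewrite /cexp expRD ecD rmorphM/=; ring. Qed.

Lemma modulus_cexp s t : modulus (cexp s t) = expR s.
Proof. by rewrite modulusM modulus_ec mulr1 modulus_real ger0_norm ?expR_ge0. Qed.

Lemma cexp_bound (e : R) : 0 < e -> exists2 dl : R, 0 < dl & forall h k : R, `|h| <= dl -> `|k| <= dl ->
  modulus (cexp h k - 1 - (h +i* k)%C) <= e * (`|h| + `|k|).
Proof.
move=> e0; have e' : 0 < Num.min 1 (e / 30) by rewrite lt_min ltr01 divr_gt0.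
have [d1 d10 h1] := is_derive_bound (is_derive_expR (0 : R)) e'.
have [d2 d20 h2] := is_derive_bound (is_derive_cos (0 : R)) e'.
have [d3 d30 h3] := is_derive_bound (is_derive_sin (0 : R)) e'.
exists (Num.min (Num.min d1 d2) (Num.min d3 (Num.min 1 (e / 10)))).
  by rewrite !lt_min d10 d20 d30 ltr01 divr_gt0.
move=> h k; rewrite !le_min => /andP[/andP[/h1 {}h1 _] /and3P[_ hh1 hhe]].
move=> /andP[/andP[_ /h2 {}h2] /and3P[/h3 {}h3 hk1 _]].
rewrite add0r expR0 mul1r in h1.
rewrite add0r cos0 sin0 oppr0 mul0r subr0 in h2.
rewrite add0r cos0 sin0 subr0 mul1r in h3.
have [m1 m2] : Num.min 1 (e / 30) <= 1 /\ Num.min 1 (e / 30) <= e / 30 by rewrite !ge_min !lexx orbT.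
set m := Num.min _ _ in h1 h2 h3 m1 m2.
have -> : cexp h k - 1 - (h +i* k)%C = (expR h)%:C%C * (ec k - 1 - (0 +i* k)%C) + (((expR h - 1 - h)%:C)%C + (0 +i* k)%C * ((expR h - 1)%:C)%C).
  by rewrite /cexp; apply: complex_eqP; rewrite !(ReD,ImD,ReM,ImM,ReN,ImN)/=; ring.
have nh := normr_ge0 h; have nk := normr_ge0 k.
have x1 : `|expR h - 1 - h| <= e / 5 * `|h| by apply: le_trans h1 _; rewrite ler_wpM2r//; lra.
have x2 : `|expR h - 1| <= 2 * `|h|.
  rewrite -[expR h - 1](subrK h); apply: le_trans (ler_normD _ _) _.
  have : m * `|h| <= 1 * `|h| by rewrite ler_wpM2r.
  lra.
have x3 : expR h <= 3.
  by move: (le_trans x2 (ler_wpM2l (ler0n _ 2) hh1)); rewrite ler_norml => /andP[_]; lra.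
have x4 : modulus (ec k - 1 - (0 +i* k)%C) <= 2 * (m * `|k|).
  apply: le_trans (modulus_ReIm _) _; rewrite !(ReD,ImD,ReN,ImN)/= subr0 oppr0 addr0.
  by rewrite mulr2n mulrDl mul1r lerD.
apply: le_trans (modulusD _ _) _; apply: le_trans (lerD (lexx _) (modulusD _ _)) _.
rewrite !modulusM !modulus_real ger0_norm ?expR_ge0//.
have -> : modulus (0 +i* k)%C = `|k|.
  by rewrite modulusE/= expr0n/= add0r sqrtr_sqr.
have y1 : expR h * modulus (ec k - 1 - (0 +i* k)%C) <= 3 * (2 * (m * `|k|)).
  by apply: ler_pM; rewrite ?expR_ge0 ?modulus_ge0.
have y2 : `|k| * `|expR h - 1| <= `|k| * (e / 5).
  by rewrite ler_wpM2l//; apply: le_trans x2 _; lra.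
have y3 : m * `|k| <= e / 30 * `|k| by rewrite ler_wpM2r.
have p1 : 0 <= e * `|h| by rewrite mulr_ge0// ltW.
have p2 : 0 <= e * `|k| by rewrite mulr_ge0// ltW.
move: y1 x1 y2 y3 p1 p2; clear; lra.
Qed.

Section log_coordinates.
Variables (G : C -> C) (a b : R).
Hypotheses (ab : a < b).
Hypothesis Gd : forall z, expR a <= modulus z <= expR b -> cdiffable G z.

(** The chain rule for G after [cexp], with D = z G'(z). *)
Lemma closed_log_form s t : a <= s <= b -> exists D : C, forall e : R, 0 < e ->
  exists2 dl : R, 0 < dl & forall s' t', `|s' - s| <= dl -> `|t' - t| <= dl ->
  modulus (G (cexp s' t') - G (cexp s t) - D * ((s' - s) +i* (t' - t))%C) <= e * (`|s' - s| + `|t' - t|).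
Proof.
move=> /andP[s1 s2]; set z := cexp s t.
have [|d hd] := Gd (z := z); first by rewrite modulus_cexp !ler_expR s1.
exists (d * z) => e e0.
have z0 : 0 < modulus z by rewrite modulus_cexp expR_gt0.
pose K := modulus z * (2 + modulus d).
have d0 := modulus_ge0 d.
have K0 : 0 < K by rewrite mulr_gt0//; lra.
pose y := Num.min 1 (e / K).
have y0 : 0 < y by rewrite lt_min ltr01 divr_gt0.
have [y1 yK] : y <= 1 /\ y * K <= e by rewrite -ler_pdivlMr// /y !ge_min !lexx orbT.
have [d1 d10 h1] := hd _ y0. have [d2 d20 h2] := cexp_bound y0.
have q0 : 0 < d1 / (4 * modulus z) by rewrite divr_gt0// mulr_gt0.
exists (Num.min d2 (d1 / (4 * modulus z))); first by rewrite lt_min d20.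
move=> s' t'; rewrite !le_min => /andP[hs1 hs2] /andP[ht1 ht2].
have {}h2 := h2 _ _ hs1 ht1.
set h := s' - s in hs1 hs2 h2 *; set k := t' - t in ht1 ht2 h2 *.
have E : cexp s' t' = z * cexp h k by rewrite -cexpD /h /k !subrKC.
set p := cexp h k - 1 - (h +i* k)%C in h2.
have Ep : cexp s' t' - z = z * (p + (h +i* k)%C) by rewrite E /p; ring.
have hk : modulus (h +i* k)%C <= `|h| + `|k| by exact: modulus_ReIm.
have m1 : modulus (cexp s' t' - z) <= modulus z * (2 * (`|h| + `|k|)).
  rewrite Ep modulusM ler_wpM2l ?(ltW z0)//; apply: le_trans (modulusD _ _) _.
  have : y * (`|h| + `|k|) <= 1 * (`|h| + `|k|) by rewrite ler_wpM2r// addr_ge0.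
  lra.
have m2 : modulus (cexp s' t' - z) <= d1.
  apply: le_trans m1 _; rewrite mulrC -ler_pdivlMr//.
  have -> : d1 / modulus z = 4 * (d1 / (4 * modulus z)) by field; rewrite gt_eqF.
  lra.
have {}h1 := h1 _ m2.
have -> : G (cexp s' t') - G z - d * z * (h +i* k)%C = (G (cexp s' t') - G z - d * (cexp s' t' - z)) + d * z * p.
  by rewrite Ep; ring.
apply: le_trans (modulusD _ _) _; rewrite (modulusM (d * z)) (modulusM d).
have n1 : y * modulus (cexp s' t' - z) <= y * (modulus z * (2 * (`|h| + `|k|))) by rewrite ler_wpM2l// ltW.
have n2 : modulus d * modulus z * modulus p <= modulus d * modulus z * (y * (`|h| + `|k|)).
  by rewrite ler_wpM2l// mulr_ge0// ltW.
apply: le_trans (lerD (le_trans h1 n1) n2) _.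
suff H (u v w x : R) : u * (v * (2 * x)) + w * v * (u * x) = u * (v * (2 + w)) * x.
  by rewrite H ler_wpM2r// addr_ge0.
ring.
Qed.

(** The sides t = const of the rectangle cancel by periodicity, so the
    integrals along the two sides s = const agree. *)
Lemma circle_mean_log :
  Rintegral leb (@circ R) (fun t => - complex.Im (G (cexp a t))) =
  Rintegral leb (@circ R) (fun t => - complex.Im (G (cexp b t))).
Proof.
have cd : - (pi / 2) < pi / 2 + pi :> R by have := pi_gt0 R; lra.
have UV x y : rect a b (- (pi / 2)) (pi / 2 + pi) x y -> exists p q r, forall e, 0 < e ->
  exists2 dl, 0 < dl & forall x' y', rect a b (- (pi / 2)) (pi / 2 + pi) x' y' -> `|x' - x| <= dl -> `|y' - y| <= dl ->
    `|complex.Re (G (cexp x' y')) - complex.Re (G (cexp x y)) - (p * (x' - x) + q * (y' - y))| <= e * (`|x' - x| + `|y' - y|) /\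
    `|- complex.Im (G (cexp x' y')) - - complex.Im (G (cexp x y)) - (q * (x' - x) + r * (y' - y))| <= e * (`|x' - x| + `|y' - y|).
  move=> /andP[/closed_log_form -/(_ y)[D hD] _].
  exists (complex.Re D), (- complex.Im D), (- complex.Re D) => e /hD[dl dl0 h].
  exists dl => // x' y' _ hx hy; have {}h := h x' y' hx hy; split.
    apply: le_trans h; apply: le_trans (Re_modulus _).
    case: D {hD} (G _) (G _) => [D1 D2] [g1 g2] [g3 g4] /=.
    by rewrite le_eqVlt; apply/orP; left; apply/eqP; congr (`|_|); ring.
  apply: le_trans h; apply: le_trans (Im_modulus _); rewrite -normrN.
  case: D {hD} (G _) (G _) => [D1 D2] [g1 g2] [g3 g4] /=.
  by rewrite le_eqVlt; apply/orP; left; apply/eqP; congr (`|_|); ring.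
have := goursat ab cd UV.
have per s : cexp s (- (pi / 2)) = cexp s (pi / 2 + pi).
  by congr (_ * _); apply: complex_eqP; rewrite /= ?cosDpi ?sinDpi ?cosN ?sinN// cos_pihalf oppr0.
have -> : seg (fun u => complex.Re (G (cexp u (- (pi / 2)))) - complex.Re (G (cexp u (pi / 2 + pi)))) a b = 0.
  have -> : (fun u => complex.Re (G (cexp u (- (pi / 2)))) - complex.Re (G (cexp u (pi / 2 + pi)))) = fun=> 0.
    by apply/funext => u; rewrite per subrr.
  by rewrite seg_cst ?mul0r// ltW.
rewrite add0r.
have cI s : a <= s <= b -> cont_on (fun v => - complex.Im (G (cexp s v))) (- (pi / 2)) (pi / 2 + pi).
  move=> sab; apply: cont_onP => x xc e e0.
  have xy : rect a b (- (pi / 2)) (pi / 2 + pi) s x by rewrite /rect sab.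
  have [dl dl0 h] := contUV UV xy e0; exists dl => // y' y'cd hy.
  by have [] := h s y' _ _ hy; rewrite ?/rect ?sab ?y'cd// subrr normr0 ltW.
clear UV; have ca : cont_on (fun v => - complex.Im (G (cexp a v))) (- (pi / 2)) (pi / 2 + pi).
  by apply: cI; rewrite lexx ltW.
have cb : cont_on (fun v => - complex.Im (G (cexp b v))) (- (pi / 2)) (pi / 2 + pi).
  by apply: cI; rewrite lexx ltW.
by rewrite segB; [move=> /subr0_eq/esym|exact: cb|exact: ca].
Qed.

End log_coordinates.

Lemma ec_cont t (e : R) : 0 < e -> exists2 dl : R, 0 < dl &
  forall s, `|s - t| <= dl -> modulus (ec s - ec t) <= e.
Proof.
move=> e0; have e2 : 0 < e / 2 by rewrite divr_gt0.
have /cvgrPdist_le/(_ _ e2)/nbhs_ballP[d1 /= d10 h1] := @continuous_cos R t.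
have /cvgrPdist_le/(_ _ e2)/nbhs_ballP[d2 /= d20 h2] := @continuous_sin R t.
exists (Num.min d1 d2 / 2); first by rewrite divr_gt0// lt_min d10.
move=> s hs; have {}hs : `|s - t| < Num.min d1 d2.
  by apply: le_lt_trans hs _; rewrite ltr_pdivrMr// ltr_pMr ?ltr1n// lt_min d10.
move: hs; rewrite lt_min distrC => /andP[/h1 c1 /h2 c2].
apply: le_trans (modulus_ReIm _) _; rewrite !(ReD,ImD,ReN,ImN)/=.
by rewrite -[leLHS]/(`|_| + `|_|) distrC (distrC (sin s)) [leRHS](splitr e) lerD.
Qed.

Section on_circle.
Variables (G : C -> C) (r : R).
Hypothesis Gc : forall t, ccont G (r%:C%C * ec t).

Lemma circle_ccont t (e : R) : 0 < e -> exists2 dl : R, 0 < dl &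
  forall s, `|s - t| <= dl -> modulus (G (r%:C%C * ec s) - G (r%:C%C * ec t)) <= e.
Proof.
move=> e0; have [d1 d10 h1] := Gc t e0.
have K0 : 0 < `|r| + 1 by rewrite ltr_wpDl.
have [|d2 d20 h2] := @ec_cont t (d1 / (`|r| + 1)); first by rewrite divr_gt0.
exists d2 => // s /h2 hs; apply: h1; rewrite -mulrBr modulusM modulus_real.
apply: (@le_trans _ _ (`|r| * (d1 / (`|r| + 1)))); first by rewrite ler_wpM2l.
by rewrite mulrCA ler_piMr// ?(ltW d10)// ler_pdivrMr// mul1r lerDl.
Qed.

Lemma continuous_circle_Re : continuous (fun t => complex.Re (G (r%:C%C * ec t))).
Proof.
move=> t; apply/cvgrPdist_le => e e0; have [dl dl0 h] := circle_ccont t e0.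
apply/nbhs_ballP; exists dl => //= s; rewrite /ball/= distrC => /ltW/h; apply: le_trans.
by rewrite distrC; apply: le_trans (Re_modulus _); rewrite ReD ReN.
Qed.

Lemma continuous_circle_Im : continuous (fun t => complex.Im (G (r%:C%C * ec t))).
Proof.
move=> t; apply/cvgrPdist_le => e e0; have [dl dl0 h] := circle_ccont t e0.
apply/nbhs_ballP; exists dl => //= s; rewrite /ball/= distrC => /ltW/h; apply: le_trans.
by rewrite distrC; apply: le_trans (Im_modulus _); rewrite ImD ImN.
Qed.

Lemma cmeas_circle : cmeas [set: M] (fun t => G (r%:C%C * ec t)).
Proof.
by split; apply: continuous_measurable_fun; [exact: continuous_circle_Re|exact: continuous_circle_Im].
Qed.

End on_circle.

Definition cmean (G : C -> C) r : C := cint (@sigma R) [set: M] (fun t => G (r%:C%C * ec t)).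

(** [circle_mean_log] gives the imaginary parts, and the real parts follow by
    applying it to i G. *)
Lemma cmean_const (G : C -> C) (r1 r2 : R) : 0 < r1 -> r1 <= r2 ->
  (forall z, r1 <= modulus z <= r2 -> cdiffable G z) -> cmean G r1 = cmean G r2.
Proof.
move=> r10; rewrite le_eqVlt => /predU1P[->//|r12] Gd.
have r20 := lt_trans r10 r12.
have mz (r : R) t : 0 < r -> modulus (r%:C%C * ec t) = r.
  by move=> r0; rewrite modulusM modulus_ec mulr1 modulus_real gtr0_norm.
have cc (r : R) : r1 <= r <= r2 -> forall t, ccont G (r%:C%C * ec t).
  move=> /andP[h1 h2] t; apply: cdiffable_cont; apply: Gd.
  by rewrite mz ?h1// (lt_le_trans r10).
have c1 := cc r1; have c2 := cc r2; rewrite !lexx !(ltW r12) in c1 c2.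
have {}c1 := c1 isT; have {}c2 := c2 isT.
have l12 : ln r1 < ln r2 by rewrite ltr_ln ?posrE.
have key (H : C -> C) : (forall z, r1 <= modulus z <= r2 -> cdiffable H z) ->
   Rintegral leb (@circ R) (fun t => complex.Im (H (r1%:C%C * ec t))) =
   Rintegral leb (@circ R) (fun t => complex.Im (H (r2%:C%C * ec t))).
  move=> Hd; have := @circle_mean_log (fun z => -1 * H z) _ _ l12.
  rewrite /cexp !lnK; [|exact: r20|exact: r10].
  move=> h; transitivity (Rintegral leb (@circ R) (fun t => - complex.Im (-1 * H (r1%:C%C * ec t)))).
    by apply: eq_Rintegral => t _; rewrite mulN1r ImN opprK.
  rewrite h; last by move=> z /Hd; apply: cdiffableM; exact: cdiffable_cst.
  by apply: eq_Rintegral => t _; rewrite mulN1r ImN opprK.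
rewrite /cmean /cint; congr (_ +i* _)%C.
  rewrite Rintegral_sigma; last exact: continuous_circle_Re.
  rewrite Rintegral_sigma; last exact: continuous_circle_Re.
  have Ei (z : C) : complex.Im ((0 +i* 1)%C * z) = complex.Re z by case: z => x y /=; ring.
  congr (_ * _); transitivity (Rintegral leb (@circ R) (fun t => complex.Im ((0 +i* 1)%C * G (r1%:C%C * ec t)))).
    by apply: eq_Rintegral => t _; rewrite Ei.
  rewrite (key (fun z => (0 +i* 1)%C * G z)); first by apply: eq_Rintegral => t _; rewrite Ei.
  by move=> z /Gd; apply: cdiffableM; exact: cdiffable_cst.
rewrite Rintegral_sigma; last exact: continuous_circle_Im.
rewrite Rintegral_sigma; last exact: continuous_circle_Im.
by congr (_ * _); exact: key.
Qed.

End circle_mean.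

(** * Taylor expansion in the disc *)

Section cauchy.
Context (R : realType).
Local Notation C := R[i].
Local Notation M := (measurableTypeR R).
Local Notation leb := (@lebesgue_measure R).

Lemma midpoint (x : R) : 0 <= x -> x < 1 -> x < (1 + x) / 2 /\ (1 + x) / 2 < 1.
Proof. by move=> x0 x1; split; lra. Qed.

Lemma modulus_of_plane_dist (p q : R * R) : modulus (of_plane p - of_plane q) <= `|p.1 - q.1| + `|p.2 - q.2|.
Proof. by apply: le_trans (modulus_ReIm _) _; case: p q => [a b] [c d]. Qed.

Lemma modulus_dist (z w : C) : `|modulus z - modulus w| <= modulus (z - w).
Proof.
rewrite ler_norml; apply/andP; split.
  rewrite lerNl opprB lerBlDr -[in leLHS](subrK z w) -(modulusN (z - w)) opprB; exact: modulusD.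
by rewrite lerBlDr -[in leLHS](subrK w z) modulusD.
Qed.

Lemma cont_at_planar (f : C -> R) (A : set (R * R)) :
  (forall z, A (complex.Re z, complex.Im z) -> forall e : R, 0 < e -> exists2 dl : R, 0 < dl &
     forall w, modulus (w - z) <= dl -> `|f w - f z| <= e) ->
  {within A, continuous (f \o @of_plane R)}.
Proof.
move=> h; apply/subspace_continuousP => p Ap.
apply/cvgrPdist_le => e e0.
have [|dl dl0 hd] := h (of_plane p) _ e e0; first by case: p Ap.
rewrite near_withinE; apply/nbhs_ballP; exists (dl / 2) => /=; first by rewrite divr_gt0.
move=> q [/= h1 h2] Aq; rewrite distrC; apply: hd.
apply: le_trans (modulus_of_plane_dist _ _) _; rewrite distrC (distrC q.2).
rewrite [leRHS](splitr dl) lerD//; exact: ltW.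
Qed.

Lemma compact_disc (rho : R) : compact [set p : R * R | modulus (of_plane p) <= rho].
Proof.
apply: (@subclosed_compact _ _ (`[- rho, rho]%classic `*` `[- rho, rho]%classic)).
- have -> : [set p : R * R | modulus (of_plane p) <= rho] = (@modulus R \o @of_plane R) @^-1` [set x | x <= rho] by [].
  apply: preimage_closed; last exact: closed_le.
  have cm : continuous (@modulus R \o @of_plane R).
    apply/continuous_subspace_setT; apply: cont_at_planar => z _ e e0; exists e => // w.
    by apply: le_trans; exact: modulus_dist.
  by move=> p _; exact: cm.
- by apply: compact_setX; exact: segment_compact.
- move=> [x y] /= h; rewrite !in_itv/= -!ler_norml; split.
    by apply: le_trans (Re_modulus _) h.
  by apply: le_trans (Im_modulus _) h.
Qed.

Lemma ccont_bounded (G : C -> C) (rho : R) : 0 <= rho ->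
  (forall z, modulus z <= rho -> ccont G z) ->
  exists2 B, 0 <= B & forall z, modulus z <= rho -> modulus (G z) <= B.
Proof.
move=> rho0 Gc.
have [||[x y] _ h] := @compact_EVT_max _ R (fun p => modulus (G (of_plane p))) _ _ (@compact_disc rho).
- by exists (0, 0); rewrite /= [of_plane _]/(0 : C) modulus0.
- apply: (@cont_at_planar (fun z => modulus (G z))) => -[a b] /= hz e e0.
  have [dl dl0 hd] := Gc _ hz e e0; exists dl => // w /hd; apply: le_trans; exact: modulus_dist.
exists (modulus (G (of_plane (x, y)))); first exact: modulus_ge0.
by case=> a b hz; apply: (h (a, b)); rewrite inE.
Qed.

Lemma cvg_Rintegral_sigma (f : nat -> M -> R) (g : M -> R) B :
  (forall n, measurable_fun setT (f n)) -> (forall n t, `|f n t| <= B) ->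
  (forall t, f n t @[n --> \oo] --> g t) ->
  Rintegral (@sigma R) setT (f n) @[n --> \oo] --> Rintegral (@sigma R) setT g.
Proof.
move=> mf fB fg.
have mg : measurable_fun setT g by apply: (measurable_fun_cvg mf) => t _; exact: fg.
have iB : (@sigma R).-integrable [set: M] (EFin \o cst B).
  by apply: finite_measure_integrable_cst.
have := @dominated_convergence _ M R (@sigma R) setT measurableT (fun n t => (f n t)%:E) (EFin \o g) (EFin \o cst B).
case.
- by move=> n; exact/measurable_EFinP.
- exact/measurable_EFinP.
- by apply: aeW => t _; apply: cvg_EFin; [exact: nearW|exact: fg].
- exact: iB.
- by apply: aeW => t n _; rewrite /= lee_fin.
move=> ig _ h; apply: fine_cvg; rewrite fineK//; exact: integrable_fin_num.
Qed.

Section continuous_on_disc.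
Variable G : C -> C.
Hypothesis Gc : forall z, disc z -> ccont G z.

(** On a smaller closed disc G is bounded, so dominated convergence makes the
    mean continuous in the radius. *)
Lemma cmean_cvg (rn : nat -> R) (r rho : R) : rho < 1 -> (forall n, 0 <= rn n <= rho) ->
  0 <= r <= rho -> rn n @[n --> \oo] --> r -> (forall n, cmean G (rn n) = cmean G (rn 0)) ->
  cmean G r = cmean G (rn 0).
Proof.
move=> rho1 hn /andP[r0 rrho] cr hc.
have rho0 : 0 <= rho by exact: le_trans rrho.
have mz (s t : R) : 0 <= s -> modulus (s%:C%C * ec t) = s.
  by move=> s0; rewrite modulusM modulus_ec mulr1 modulus_real ger0_norm.
have [|B B0 hB] := @ccont_bounded G rho rho0.
  by move=> z hz; apply: Gc; exact: le_lt_trans hz rho1.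
have Gcn n t : ccont G ((rn n)%:C%C * ec t).
  by have /andP[h1 h2] := hn n; apply: Gc; rewrite /disc/= mz// (le_lt_trans h2).
have Bn n t : modulus (G ((rn n)%:C%C * ec t)) <= B.
  by have /andP[h1 h2] := hn n; apply: hB; rewrite mz.
have mn n := cmeas_circle (Gcn n).
have lim t (e : R) : 0 < e -> \forall n \near \oo, modulus (G ((rn n)%:C%C * ec t) - G (r%:C%C * ec t)) <= e.
  move=> e0; have [|dl dl0 hd] := Gc (z := r%:C%C * ec t) _ e0.
    by rewrite /disc/= mz// (le_lt_trans rrho).
  move/cvgrPdist_le : cr => /(_ dl dl0); apply: filterS => n hrn; apply: hd.
  by rewrite -mulrBl -rmorphB/= modulusM modulus_ec mulr1 modulus_real distrC.
have c1 := @cvg_Rintegral_sigma (fun n t => complex.Re (G ((rn n)%:C%C * ec t))) (fun t => complex.Re (G (r%:C%C * ec t))) B.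
have c2 := @cvg_Rintegral_sigma (fun n t => complex.Im (G ((rn n)%:C%C * ec t))) (fun t => complex.Im (G (r%:C%C * ec t))) B.
apply: complex_eqP.
  have e n : Rintegral (@sigma R) [set: M] (fun t => complex.Re (G ((rn n)%:C%C * ec t))) = complex.Re (cmean G (rn 0)).
    by rewrite -(hc n).
  have -> : complex.Re (cmean G (rn 0)) = limn (fun n => Rintegral (@sigma R) [set: M] (fun t => complex.Re (G ((rn n)%:C%C * ec t)))).
    by under eq_fun do rewrite e; rewrite lim_cst.
  apply/esym/cvg_lim => //; apply: c1.
  - by move=> n; case: (mn n).
  - by move=> n t; apply: le_trans (Re_modulus _) _.
  move=> t; apply/cvgrPdist_le => e' e0; apply: filterS (lim t e' e0) => n; apply: le_trans.
  by rewrite distrC -ReN -ReD; exact: Re_modulus.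
have e n : Rintegral (@sigma R) [set: M] (fun t => complex.Im (G ((rn n)%:C%C * ec t))) = complex.Im (cmean G (rn 0)).
  by rewrite -(hc n).
have -> : complex.Im (cmean G (rn 0)) = limn (fun n => Rintegral (@sigma R) [set: M] (fun t => complex.Im (G ((rn n)%:C%C * ec t)))).
  by under eq_fun do rewrite e; rewrite lim_cst.
apply/esym/cvg_lim => //; apply: c2.
- by move=> n; case: (mn n).
- by move=> n t; apply: le_trans (Im_modulus _) _.
move=> t; apply/cvgrPdist_le => e' e0; apply: filterS (lim t e' e0) => n; apply: le_trans.
by rewrite distrC -ImN -ImD; exact: Im_modulus.
Qed.

Lemma cmean_limit (r s : R) : 0 <= r < 1 -> 0 <= s < 1 ->
  (forall n, cmean G (r + (s - r) / n.+1%:R) = cmean G s) -> cmean G r = cmean G s.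
Proof.
move=> /andP[r0 r1] /andP[s0 s1] h.
have e0 : r + (s - r) / 1%:R = s by rewrite divr1 subrKC.
have := @cmean_cvg (fun n => r + (s - r) / n.+1%:R) r (Num.max r s); rewrite /= e0; apply.
- by rewrite gt_max r1.
- move=> n; have h1 : 0 <= (n.+1%:R^-1 : R) <= 1 by rewrite invr_ge0 ler0n invf_le1// ler1n.
  have [rs|sr] := leP r s; move: h1; set x := _^-1 => /andP[x0 x1].
    have : (s - r) * x <= (s - r) * 1 by rewrite ler_wpM2l// subr_ge0.
    have : 0 <= (s - r) * x by rewrite mulr_ge0// subr_ge0.
    by lra.
  have : (r - s) * x <= (r - s) * 1 by rewrite ler_wpM2l// subr_ge0 ltW.
  have : 0 <= (r - s) * x by rewrite mulr_ge0// subr_ge0 ltW.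
  by lra.
- by rewrite r0 le_max lexx.
- rewrite -[X in _ --> X]addr0; apply: cvgD; first exact: cvg_cst.
  rewrite -[X in _ --> X](mulr0 (s - r)); apply: cvgMr; exact: cvg_harmonic.
- by move=> n; rewrite h.
Qed.

Lemma cmean0 : cmean G 0 = G 0.
Proof.
rewrite /cmean -[RHS](cint_cst (G 0)); apply: eq_cint => t _.
by rewrite -[(0%:C)%C]/(0 : C) mul0r.
Qed.

(** The exceptional circle |z| = r0 separates two annuli in which the mean is
    constant; continuity of the mean in the radius joins them, and carries
    the inner value to the centre. *)
Lemma cmean_const_disc (r0 : R) : 0 <= r0 < 1 ->
  (forall z, disc z -> modulus z != r0 -> z != 0 -> cdiffable G z) ->
  forall r, r0 < r < 1 -> cmean G r = G 0.
Proof.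
move=> /andP[r00 r01] Gd r /andP[r0r r1].
have frac (n : nat) : 0 < (n.+1%:R^-1 : R) <= 1 by rewrite invr_gt0 ltr0Sn invf_le1// ler1n.
have zpos (x y : R) z : 0 < x -> x <= modulus z <= y -> z != 0.
  by move=> x0 /andP[h _]; rewrite -modulus_gt0 (lt_le_trans x0).
have outer x y : r0 < x -> x <= y -> y < 1 -> cmean G x = cmean G y.
  move=> h1 h2 h3; have x0 := le_lt_trans r00 h1.
  apply: cmean_const => // z hz; apply: Gd; last exact: zpos hz.
    by rewrite /disc/=; case/andP: hz => _ /le_lt_trans; apply.
  by case/andP: hz => /(lt_le_trans h1)/gt_eqF -> _.
have -> : cmean G r = cmean G r0.
  apply/esym; apply: cmean_limit; rewrite ?r00 ?(ltW (le_lt_trans r00 r0r))//.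
  move=> n; have /andP[f0 f1] := frac n.
  have p1 : 0 < (r - r0) * n.+1%:R^-1 by rewrite mulr_gt0// subr_gt0.
  have p2 : (r - r0) * n.+1%:R^-1 <= (r - r0) * 1 by rewrite ler_wpM2l// subr_ge0 ltW.
  move: p1 p2; rewrite mulr1; set y := (r - r0) / _ => p1 p2.
  by apply: outer => //; clear -p1 p2; lra.
move: r00; rewrite le_eqVlt => /predU1P[<-|r00]; first exact: cmean0.
have inner x y : 0 < x -> x <= y -> y < r0 -> cmean G x = cmean G y.
  move=> h1 h2 h3; apply: cmean_const => // z hz; apply: Gd; last exact: zpos hz.
    by rewrite /disc/=; case/andP: hz => _ /le_lt_trans; apply; exact: lt_trans r01.
  by case/andP: hz => _ /le_lt_trans-/(_ _ h3)/lt_eqF ->.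
have h2 : 0 < r0 / 2 < r0 by rewrite divr_gt0// ltr_pdivrMr// ltr_pMr// ltr1n.
have /andP[h20 h21] := h2.
have -> : cmean G r0 = cmean G (r0 / 2).
  apply: cmean_limit; rewrite ?(ltW r00) ?(ltW h20) ?(lt_trans h21)//.
  move=> n; have /andP[f0 f1] := frac n; apply/esym.
  have -> : (r0 / 2 - r0) = - (r0 / 2) by lra.
  have p1 : 0 < (r0 / 2) * n.+1%:R^-1 by rewrite mulr_gt0.
  have p2 : (r0 / 2) * n.+1%:R^-1 <= (r0 / 2) * 1 by rewrite ler_wpM2l// ltW.
  move: p1 p2; rewrite mulr1 mulNr; set y := r0 / 2 / _ => p1 p2.
  by apply: inner => //; clear -p1 p2; lra.
rewrite -cmean0; apply/esym; apply: cmean_limit; rewrite ?lexx ?ltr01 ?(ltW h20) ?(lt_trans h21)//.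
move=> n; have /andP[f0 f1] := frac n; rewrite add0r subr0.
by apply: inner; rewrite ?mulr_gt0// ler_piMr// ltW.
Qed.

End continuous_on_disc.

Section taylor.
Variable f : C -> C.
Hypothesis fd : forall z, disc z -> cdiffable f z.

(** The function z (f z - f z0) / (z - z0), continued to z0. It vanishes at
    0, so its means vanish; this is Cauchy's formula at z0. *)
Let slope z0 d z := if z == z0 then z0 * d else z * (f z - f z0) * (z - z0)^-1.

Let slope_diff z0 d z : disc z -> z != z0 -> cdiffable (slope z0 d) z.
Proof.
move=> dz zz0; have zz : z - z0 != 0 by rewrite subr_eq0.
have [e he] : cdiffable (fun w => w * (f w - f z0) * (w - z0)^-1) z.
  apply: cdiffableM.
    apply: cdiffableM; first exact: cdiffable_id.
    by apply: cdiffableB; [exact: fd|exact: cdiffable_cst].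
  by apply: cdiffableV => //; apply: cdiffableB; [exact: cdiffable_id|exact: cdiffable_cst].
exists e => x x0; have [dl dl0 h] := he x x0.
have mz : 0 < modulus (z - z0) by rewrite modulus_gt0.
exists (Num.min dl (modulus (z - z0) / 2)); first by rewrite lt_min dl0 divr_gt0.
move=> w; rewrite le_min => /andP[h1 h2]; rewrite /slope (negbTE zz0).
case: eqVneq => [wz0|_]; last exact: h.
by move: h2; rewrite wz0 -modulusN opprB ler_pdivlMr// ger_pMr// (ler_nat _ 2 1).
Qed.

Let slope_cont z0 d : disc z0 -> cdiff f z0 d -> forall z, disc z -> ccont (slope z0 d) z.
Proof.
move=> dz0 hd z dz; have [->{z dz}|zz0] := eqVneq z z0; last exact/cdiffable_cont/slope_diff.
have h : ccont (fun w => if w == z0 then d else (f w - f z0) / (w - z0)) z0.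
  move=> e e0; have [dl dl0 h] := hd e e0; exists dl => // w /h; rewrite eqxx.
  case: eqVneq => [->|wz]; first by move=> _; rewrite subrr modulus0 ltW.
  have wz' : w - z0 != 0 by rewrite subr_eq0.
  rewrite -{1}[f w - f z0](divfK wz') -mulrBl modulusM ler_pM2r ?modulus_gt0//.
have := ccontM (cdiffable_cont (cdiffable_id z0)) h.
rewrite (_ : (fun w => _ * _) = slope z0 d)//; apply/funext => w.
by rewrite /slope; case: eqVneq => [->//|_]; rewrite mulrA.
Qed.

(** The radius 1/2 is arbitrary: by [tcoefE] every radius in ]0, 1[ gives the
    same coefficient. *)
Definition tcoef n : C := cint (@sigma R) [set: M] (fun t => f ((2^-1 : R)%:C%C * ec t) * conjc (ec t ^+ n)) * 2 ^+ n.

Let fc z : disc z -> ccont f z. Proof. by move=> /fd/cdiffable_cont. Qed.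

Let mz (s t : R) : 0 <= s -> modulus (s%:C%C * ec t) = s.
Proof. by move=> s0; rewrite modulusM modulus_ec mulr1 modulus_real ger0_norm. Qed.

(** The integrand is, up to the factor r^n, the restriction to a circle of z
    |-> f z / z^n, whose mean does not depend on the radius. *)
Lemma tcoefE n (r : R) : 0 < r < 1 ->
  cint (@sigma R) [set: M] (fun t => f (r%:C%C * ec t) * conjc (ec t ^+ n)) = tcoef n * (r ^+ n)%:C%C.
Proof.
move=> /andP[r0 r1].
have cr (x : R) : 0 < x -> x < 1 -> cint (@sigma R) [set: M] (fun t => f (x%:C%C * ec t) * conjc (ec t ^+ n)) =
   cmean (fun z => f z * (z ^+ n)^-1) x * (x ^+ n)%:C%C.
  move=> x0 x1; rewrite mulrC /cmean -cintZ.
    apply: eq_cint => t _; rewrite exprMn invfM conjcX conj_ec exprVn -rmorphXn/= mulrCA; congr (_ * _).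
    by rewrite mulVKf// rmorphXn/= expf_neq0// (@fmorph_eq0 _ _ (@real_complex R)) gt_eqF.
    exact: measurableT.
  have [||B B0 hB] := @ccont_bounded f x; first exact: ltW.
    by move=> z hz; apply: fc; exact: le_lt_trans x1.
  apply: (@cintble_bounded _ _ (B * (x ^+ n)^-1)).
    apply: (@cmeas_circle _ (fun z => f z * (z ^+ n)^-1)) => t; apply: ccontM.
      by apply: fc; rewrite /disc/= mz// ltW.
    apply: cdiffable_cont; apply: cdiffableV; last by apply: cdiffableX; exact: cdiffable_id.
    by rewrite expf_neq0// -modulus_gt0 mz// ltW.
  move=> t; rewrite modulusM modulusV modulusX (mz _ (ltW x0)) ler_wpM2r// ?invr_ge0 ?(exprn_ge0 _ (ltW x0))//.
  by apply: hB; rewrite mz// ltW.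
have h2 : 0 < (2^-1 : R) /\ (2^-1 : R) < 1 by rewrite invr_gt0 ltr0n invf_lt1// ltr1n.
rewrite /tcoef (cr r)// (cr 2^-1)//; try exact: h2.1; try exact: h2.2.
congr (_ * _).
have cm (x y : R) : 0 < x -> x <= y -> y < 1 -> cmean (fun z => f z * (z ^+ n)^-1) x = cmean (fun z => f z * (z ^+ n)^-1) y.
  move=> x0 xy y1; apply: cmean_const => // z /andP[z1 z2]; apply: cdiffableM.
    by apply: fd; exact: le_lt_trans y1.
  apply: cdiffableV; last by apply: cdiffableX; exact: cdiffable_id.
  by rewrite expf_neq0// -modulus_gt0 (lt_le_trans x0).
rewrite rmorphXn/= -mulrA -exprMn.
have -> : ((2^-1)%:C * 2 = 1 :> C)%C.
  by rewrite -(rmorph_nat (@real_complex R)) -rmorphM/= mulVf.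
rewrite expr1n mulr1.
have [h20 h21] := h2.
by have [rh|/ltW rh] := leP r 2^-1; [exact: cm|apply/esym; exact: cm].
Qed.

Lemma tcoef_bound (r : R) : 0 < r < 1 -> exists2 B, 0 <= B & forall n, modulus (tcoef n) * r ^+ n <= B.
Proof.
move=> /andP[r0 r1].
have [||B B0 hB] := @ccont_bounded f r; first exact: ltW.
  by move=> z hz; apply: fc; exact: le_lt_trans r1.
have mf : cmeas [set: M] (fun t => f (r%:C%C * ec t)).
  by apply: cmeas_circle => t; apply: fc; rewrite /disc/= mz// ltW.
exists B => // n.
have ci : cintble (@sigma R) [set: M] (fun t => f (r%:C%C * ec t) * conjc (ec t ^+ n)).
  apply: (@cintble_bounded _ _ B); first by apply: cmeasM => //; apply/cmeas_conj/cmeas_ecX.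
  by move=> t; rewrite modulusM modulus_conj modulus_ecX mulr1; apply: hB; rewrite mz// ltW.
rewrite -(ger0_norm (exprn_ge0 n (ltW r0))) -modulus_real -modulusM -tcoefE ?r0//.
apply: le_trans (modulus_cint _ ci) _; first exact: measurableT.
have EB : B = Rintegral (@sigma R) [set: M] (fun=> B).
  by rewrite Rintegral_cst// [X in fine X]sigmaT mulr1.
rewrite [leRHS]EB.
apply: le_Rintegral => //; first exact: integrable_modulus.
  by apply: finite_measure_integrable_cst.
by move=> t _; rewrite modulusM modulus_conj modulus_ecX mulr1; apply: hB; rewrite mz// ltW.
Qed.

Lemma tcoef_summable z : disc z -> csummable (fun n => tcoef n * z ^+ n).
Proof.
move=> dz; have z0 := modulus_ge0 z; pose r := (1 + modulus z) / 2.
have z1 : modulus z < 1 by exact: dz.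
have [zr r1] := midpoint z0 z1; rewrite -/r in zr r1.
have r0 : 0 < r by exact: le_lt_trans zr.
have hr : 0 < r < 1 by rewrite r0.
have [B B0 hB] := tcoef_bound hr.
apply: (@csummable_le _ _ (geometric B (modulus z / r))).
  move=> n; rewrite /geometric/= modulusM modulusX expr_div_n [leRHS]mulrA ler_pdivlMr ?exprn_gt0//.
  by rewrite mulrAC ler_wpM2r// exprn_ge0.
apply: is_cvg_geometric_series; rewrite ger0_norm; last exact: divr_ge0 z0 (ltW r0).
by rewrite ltr_pdivrMr// mul1r.
Qed.

(** The kernel r e^(i t) / (r e^(i t) - z0) is a geometric series in z0 e^(-
    i t) / r, integrated term by term. *)
Let cauchy_series (F : C -> C) (r : R) z0 : modulus z0 < r -> (forall t, ccont F (r%:C%C * ec t)) ->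
  (exists B, forall t, modulus (F (r%:C%C * ec t)) <= B) ->
  csums (fun n => (z0 / r%:C%C) ^+ n * cint (@sigma R) [set: M] (fun t => F (r%:C%C * ec t) * conjc (ec t ^+ n)))
    (cint (@sigma R) [set: M] (fun t => F (r%:C%C * ec t) * (r%:C%C * ec t / (r%:C%C * ec t - z0)))).
Proof.
move=> zr Fc [B hB]; have r0 : 0 < r by apply: le_lt_trans zr; exact: modulus_ge0.
have mF := cmeas_circle Fc.
have B0 : 0 <= B by apply: le_trans (hB 0); exact: modulus_ge0.
have rC0 : r%:C%C != 0 by rewrite -modulus_gt0 modulus_real gtr0_norm.
have mq : modulus (z0 / r%:C%C) = modulus z0 / r by rewrite modulusM modulusV modulus_real gtr0_norm.
have [|||||_ h] := @cint_series _ M R (@sigma R) setT measurableT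
  (fun n t => (z0 / r%:C%C) ^+ n * (F (r%:C%C * ec t) * conjc (ec t ^+ n)))
  (fun t => F (r%:C%C * ec t) * (r%:C%C * ec t / (r%:C%C * ec t - z0)))
  (fun n => geometric B (modulus z0 / r) n) (sigma_fin R).
- move=> n; apply: cmeasM; first exact: cmeas_cst.
  by apply: cmeasM => //; apply/cmeas_conj/cmeas_ecX.
- by move=> n; rewrite /geometric/= mulr_ge0// exprn_ge0// divr_ge0 ?modulus_ge0// ltW.
- move=> n t _; rewrite /geometric/= !modulusM modulus_conj modulus_ecX mulr1 modulusX mq mulrC.
  by rewrite ler_wpM2r// exprn_ge0// divr_ge0 ?modulus_ge0// ltW.
- apply: is_cvg_geometric_series; rewrite ger0_norm ?divr_ge0 ?modulus_ge0 ?(ltW r0)//.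
  by rewrite ltr_pdivrMr// mul1r.
- move=> t _; have q1 : modulus (z0 / r%:C%C * conjc (ec t)) < 1.
    by rewrite modulusM modulus_conj modulus_ec mulr1 mq ltr_pdivrMr// mul1r.
  have := csumsZ (F (r%:C%C * ec t)) (csums_geometric q1).
  have -> : (1 - z0 / r%:C%C * conjc (ec t))^-1 = r%:C%C * ec t / (r%:C%C * ec t - z0).
    have e0 := ec_neq0 t; rewrite conj_ec.
    have d0 : r%:C%C * ec t - z0 != 0.
      rewrite subr_eq0; apply: contraTneq zr => <-.
      by rewrite mz ?ltxx// ltW.
    by field; rewrite rC0 e0 d0.
  by apply: csums_ext => n; rewrite exprMn -conjcX; ring.
apply: csums_ext h => n; rewrite cintZ//.
apply: (@cintble_bounded _ _ B); first by apply: cmeasM => //; apply/cmeas_conj/cmeas_ecX.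
by move=> t; rewrite modulusM modulus_conj modulus_ecX mulr1.
Qed.

(** By [cmean_const_disc] the mean of the continued difference quotient
    vanishes on a circle around z; [cauchy_series] expands that mean in the
    powers of z. *)
Theorem taylor z : disc z -> csums (fun n => tcoef n * z ^+ n) (f z).
Proof.
move=> dz; have z0 := modulus_ge0 z; pose r := (1 + modulus z) / 2.
have z1 : modulus z < 1 by exact: dz.
have [zr r1] := midpoint z0 z1; rewrite -/r in zr r1.
have r0 : 0 < r by exact: le_lt_trans zr.
have [d hd] := fd dz.
have dr t : disc (r%:C%C * ec t) by rewrite /disc/= mz// ltW.
have mean0 : cmean (slope z d) r = 0.
  rewrite (@cmean_const_disc (slope z d) _ (modulus z)) ?z0 ?zr//.
  - by rewrite /slope; case: eqVneq => [<-|_]; rewrite ?mul0r.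
  - exact: slope_cont.
  move=> w dw wz _; apply: slope_diff => //.
  by apply: contraNneq wz => ->.
have [||B B0 hB] := @ccont_bounded f r; first exact: ltW.
  by move=> w hw; apply: fc; exact: le_lt_trans r1.
have Fc t : ccont (fun w => f w - f z) (r%:C%C * ec t).
  apply: cdiffable_cont; apply: cdiffableB; first exact: fd.
  exact: cdiffable_cst.
have h := @cauchy_series (fun w => f w - f z) r z zr Fc.
have {h} := h (ex_intro _ (B + modulus (f z)) _).
have -> : cint (@sigma R) [set: M] (fun t => (f (r%:C%C * ec t) - f z) * (r%:C%C * ec t / (r%:C%C * ec t - z))) = 0.
  rewrite -mean0; apply: eq_cint => t _; rewrite /slope ifF; first by ring.
  apply/negbTE; apply: contraTneq zr => <-.
  by rewrite mz ?ltxx// ltW.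
move=> h; have {}h := h (fun t => le_trans (modulusD _ _) (lerD (hB _ _) _)).
have {h} : csums (fun n => tcoef n * z ^+ n - f z * 0 ^+ n) 0.
  apply: csums_ext (h _ _) => [n||].
  - have mf : cmeas [set: M] (fun t => f (r%:C%C * ec t)).
      by apply: cmeas_circle => t; exact: fc.
    have c1 : cintble (@sigma R) [set: M] (fun t => f (r%:C%C * ec t) * conjc (ec t ^+ n)).
      apply: (@cintble_bounded _ _ B); first by apply: cmeasM => //; apply/cmeas_conj/cmeas_ecX.
      by move=> t; rewrite modulusM modulus_conj modulus_ecX mulr1; apply: hB; rewrite mz// ltW.
    have c2 : cintble (@sigma R) [set: M] (fun t => conjc (ec t ^+ n)).
      apply: (@cintble_bounded _ _ 1); first exact/cmeas_conj/cmeas_ecX.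
      by move=> t; rewrite modulus_conj modulus_ecX.
    have -> : cint (@sigma R) [set: M] (fun t => (f (r%:C%C * ec t) - f z) * conjc (ec t ^+ n)) =
        tcoef n * (r ^+ n)%:C%C - f z * 0 ^+ n.
      under eq_cint do rewrite mulrBl -mulNr.
      rewrite cintD//; last by apply: cintbleZ.
      rewrite cintZ// cint_conj//; last exact: cintble_ecX.
      rewrite cint_ecX tcoefE ?r0// mulNr expr0n; congr (_ - _ * _).
      by case: n {c1 c2} => [|n]; rewrite ?conjc1 ?conjc0.
    rewrite mulrBr rmorphXn/= expr_div_n; congr (_ - _).
      have rC0 : r%:C%C ^+ n != 0 by rewrite expf_neq0// -modulus_gt0 modulus_real gtr0_norm.
      by field.
    by case: n {c1 c2} => [|n]; [rewrite !expr0 invr1 !mul1r | rewrite [0 ^+ n.+1]exprS mul0r !mulr0].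
  - by move=> t; rewrite mz// ltW.
  - by rewrite modulusN.
move=> h; have z01 : modulus (0 : C) < 1 by rewrite modulus0.
have := csumsD h (csumsZ (f z) (csums_geometric z01)).
by rewrite add0r subr0 invr1 mulr1; apply: csums_ext => n; rewrite subrK.
Qed.

End taylor.

End cauchy.

(** * Power series and signed polar integrals *)

Section power_series.
Context (R : realType).
Local Notation C := R[i].

Lemma cmeas_csum d (T : measurableType d) (D : set T) (h : nat -> T -> C) (H : T -> C) :
  (forall n, cmeas D (h n)) -> (forall x, D x -> csums (fun n => h n x) (H x)) -> cmeas D H.
Proof.
move=> mh hH; split.
  apply: (@measurable_fun_cvg _ T R D (fun n x => series (fun k => complex.Re (h k x)) n)).
    by move=> n; rewrite /series; apply: measurable_sum => i; case: (mh i).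
  by move=> x /hH[].
apply: (@measurable_fun_cvg _ T R D (fun n x => series (fun k => complex.Im (h k x)) n)).
  by move=> n; rewrite /series; apply: measurable_sum => i; case: (mh i).
by move=> x /hH[].
Qed.

(** Multiplication by e lets (|z| + e)^n serve as a common bound, so that a
    series convergent at radius |z| + e dominates. *)
Lemma pow_diff1 (z h : C) (e : R) n : 0 < e -> modulus h <= e ->
  modulus ((z + h) ^+ n - z ^+ n) * e <= modulus h * (modulus z + e) ^+ n.
Proof.
move=> e0 he; have z0 := modulus_ge0 z; have h0 := modulus_ge0 h.
elim: n => [|n ih]; first by rewrite !expr0 subrr modulus0 mul0r mulr1.
have -> : (z + h) ^+ n.+1 - z ^+ n.+1 = z * ((z + h) ^+ n - z ^+ n) + h * (z + h) ^+ n by rewrite !exprS; ring.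
apply: le_trans (ler_wpM2r (ltW e0) (modulusD _ _)) _; rewrite !modulusM modulusX.
have i1 : modulus z * (modulus ((z + h) ^+ n - z ^+ n) * e) <= modulus z * (modulus h * (modulus z + e) ^+ n).
  by rewrite ler_wpM2l.
have i2 : modulus h * e * modulus (z + h) ^+ n <= modulus h * e * (modulus z + e) ^+ n.
  rewrite ler_wpM2l ?mulr_ge0 ?(ltW e0)// lerXn2r ?nnegrE ?modulus_ge0 ?addr_ge0 ?(ltW e0)//.
  by apply: le_trans (modulusD _ _) _; rewrite lerD2l.
rewrite exprS; nra.
Qed.

(** The same device for the second-order remainder. *)
Lemma pow_diff2 (z h : C) (e : R) n : 0 < e -> modulus h <= e ->
  modulus ((z + h) ^+ n - z ^+ n - n%:R * z ^+ n.-1 * h) * e ^+ 2 <= modulus h ^+ 2 * (modulus z + e) ^+ n.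
Proof.
move=> e0 he; have z0 := modulus_ge0 z; have h0 := modulus_ge0 h.
elim: n => [|n ih]; first by rewrite !expr0 subrr !mul0r subr0 modulus0 mul0r mulr1 sqr_ge0.
have -> : (z + h) ^+ n.+1 - z ^+ n.+1 - n.+1%:R * z ^+ n.+1.-1 * h =
   z * ((z + h) ^+ n - z ^+ n - n%:R * z ^+ n.-1 * h) + h * ((z + h) ^+ n - z ^+ n).
  by case: n {ih} => [|n] /=; rewrite !exprS -?natr1 ?expr0; ring.
apply: le_trans (ler_wpM2r (sqr_ge0 e) (modulusD _ _)) _; rewrite !modulusM.
have i1 := ler_wpM2l z0 ih.
have i2 := ler_wpM2l (mulr_ge0 h0 (ltW e0)) (pow_diff1 z n e0 he).
rewrite [(_ + e) ^+ n.+1]exprS; move: i1 i2; set x := modulus (_ - _ * _); set y := modulus (_ - _); set m := (_ + e) ^+ n.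
by rewrite !expr2; clearbody x y m; clear; nra.
Qed.

Lemma pow_deriv_bound (z : C) (e : R) n : 0 < e ->
  modulus (n%:R * z ^+ n.-1) * e <= (modulus z + e) ^+ n.
Proof.
move=> e0; have z0 := modulus_ge0 z.
have -> : modulus (n%:R * z ^+ n.-1) = n%:R * modulus z ^+ n.-1.
  rewrite modulusM modulusX; congr (_ * _).
  by rewrite -(rmorph_nat (@real_complex R)) modulus_real ger0_norm.
elim: n => [|[|n] ih]; first by rewrite !mul0r expr0.
  by rewrite /= expr0 expr1 mul1r mul1r lerDr.
have p0 : 0 <= modulus z ^+ n by rewrite exprn_ge0.
have m0 : modulus z ^+ n.+1 <= (modulus z + e) ^+ n.+1.
  by rewrite lerXn2r ?nnegrE ?addr_ge0 ?lerDl ?(ltW e0).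
have {}ih := ler_wpM2l z0 ih.
have := ler_wpM2l (ltW e0) m0.
move=> i2; have -> : n.+2%:R * modulus z ^+ n.+1 * e = modulus z * (n.+1%:R * modulus z ^+ n * e) + e * modulus z ^+ n.+1.
  by rewrite exprS -(natr1 n.+1); ring.
by rewrite [leRHS]exprS mulrDl lerD.
Qed.

Variables (u : nat -> C) (r : R).
Hypothesis su : csummable (fun n => u n * (r%:C%C) ^+ n).

Definition psum w := csum (fun n => u n * w ^+ n).

Lemma psum_summable w : modulus w <= r -> csummable (fun n => u n * w ^+ n).
Proof.
move=> wr; have r0 : 0 <= r by apply: le_trans wr; exact: modulus_ge0.
apply: csummable_le su => n; rewrite !modulusM !modulusX modulus_real ger0_norm//.
by rewrite ler_wpM2l ?modulus_ge0// lerXn2r ?nnegrE ?modulus_ge0.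
Qed.

Lemma psumP w : modulus w <= r -> csums (fun n => u n * w ^+ n) (psum w).
Proof. by move=> /psum_summable/csummableP. Qed.

Lemma psum_bound w : modulus w <= r -> modulus (psum w) <= limn (series (fun n => modulus (u n * r%:C%C ^+ n))).
Proof.
move=> wr; have r0 : 0 <= r by apply: le_trans wr; exact: modulus_ge0.
apply: (csums_bound (psumP wr) _ su) => n; rewrite !modulusM !modulusX modulus_real ger0_norm//.
by rewrite ler_wpM2l ?modulus_ge0// lerXn2r ?nnegrE ?modulus_ge0.
Qed.

(** By [pow_diff2] the remainder of the n-th term is at most |h|^2 / e^2
    times the n-th term at radius r = |z| + e; summing gives a remainder
    O(|h|^2). *)
Lemma psum_cdiffable z : modulus z < r -> cdiffable psum z.
Proof.
move=> zr; pose e := r - modulus z; have e0 : 0 < e by rewrite subr_gt0.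
have er : modulus z + e = r by rewrite /e subrKC.
have r0 : 0 <= r by apply: le_trans (ltW zr); exact: modulus_ge0.
have mur n : modulus (u n * r%:C%C ^+ n) = modulus (u n) * r ^+ n.
  by rewrite modulusM modulusX modulus_real ger0_norm.
have sd : csummable (fun n => u n * (n%:R * z ^+ n.-1)).
  apply: (@csummable_le _ _ (fun n => e^-1 * modulus (u n * r%:C%C ^+ n))).
    move=> n; rewrite mur modulusM mulrCA ler_wpM2l ?modulus_ge0// ler_pdivlMl//.
    by rewrite mulrC -er pow_deriv_bound.
  by apply/cvg_ex; eexists; exact: rseriesZ su.
pose B := limn (series (fun n => modulus (u n * r%:C%C ^+ n))).
have B0 : 0 <= B.
  by apply: le_trans (psum_bound (ltW zr)); exact: modulus_ge0.
exists (csum (fun n => u n * (n%:R * z ^+ n.-1))) => eps eps0.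
have q0 : 0 < eps * e ^+ 2 / (B + 1) by rewrite divr_gt0 ?mulr_gt0 ?exprn_gt0// ltr_wpDl.
exists (Num.min e (eps * e ^+ 2 / (B + 1))); first by rewrite lt_min e0.
move=> w; rewrite le_min => /andP[h1 h2]; set h := w - z in h1 h2 *.
have wE : w = z + h by rewrite /h subrKC.
have wr : modulus w <= r by rewrite wE; apply: le_trans (modulusD _ _) _; rewrite -er lerD2l.
have hs := csumsD (csumsD (psumP wr) (csumsZ (-1) (psumP (ltW zr)))) (csumsZ (- h) (csummableP sd)).
set d := csum _ in hs *.
have -> : psum w - psum z - d * h = psum w + -1 * psum z + - h * d by rewrite mulN1r mulNr (mulrC h).
have bnd n : modulus (u n * w ^+ n + -1 * (u n * z ^+ n) + - h * (u n * (n%:R * z ^+ n.-1))) <=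
    (modulus h ^+ 2 / e ^+ 2) * modulus (u n * r%:C%C ^+ n).
  rewrite (_ : _ + _ = u n * ((z + h) ^+ n - z ^+ n - n%:R * z ^+ n.-1 * h)); last by rewrite wE; ring.
  rewrite modulusM mur [leRHS]mulrCA ler_wpM2l ?modulus_ge0// [leRHS]mulrAC ler_pdivlMr ?exprn_gt0//.
  by rewrite -er; exact: pow_diff2.
have cB : series (fun n => modulus (u n * r%:C%C ^+ n)) n @[n --> \oo] --> B by exact: su.
have hh := csums_bound hs bnd (rseriesZ (k := modulus h ^+ 2 / e ^+ 2) cB).
apply: le_trans hh _.
have hB : modulus h * (B + 1) <= eps * e ^+ 2 by rewrite -ler_pdivlMr// ltr_wpDl.
have h0 := modulus_ge0 h.
rewrite mulrAC ler_pdivrMr ?exprn_gt0// expr2 -mulrA [leRHS]mulrAC [leRHS]mulrC ler_wpM2l//.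
by apply: le_trans hB; rewrite ler_wpM2l// lerDl.
Qed.

End power_series.

Section polar_signed.
Context (R : realType).
Local Notation C := R[i].
Local Notation M := (measurableTypeR R).
Variable nu : C -> R.
Hypothesis rnu : radial_weight nu.
Local Notation mu := (rmeas rnu).
Local Notation D := (@planar_disc R : set (M * M)).

Lemma rmeas_setC : mu (~` @I01 R) = 0%E.
Proof. by rewrite /rmeas /= /fdensity /density setICl integral_set0. Qed.

Lemma rmeas_integral (f : M -> \bar R) : mu.-integrable setT f ->
  (\int[mu]_s f s = \int[mu]_(s in @I01 R) f s)%E.
Proof.
move=> mf; rewrite (@negligible_integral _ _ _ mu setT (~` @I01 R))//.
- by rewrite setTD setCK.
- by have mI : measurable (@I01 R) := @measurable_I01 R; exact: measurableC.
- exact: rmeas_setC.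
Qed.

Lemma cpoint_disc s t : I01 s -> @planar_disc R (cpoint (s, t)).
Proof.
by move=> /I01P/andP[s0 s1]; rewrite /planar_disc/= /disc/= modulus_polar// ltW.
Qed.

(** Split the integrand in its positive and negative parts, which
    [disc_integral_polar] covers. *)
Lemma Rintegral_polar (g : M * M -> R) : measurable_fun D g ->
  (@dA R).-integrable D (fun p => (g p * nu (of_plane p))%:E) ->
  (forall s, I01 s -> (@sigma R).-integrable setT (fun t => (g (cpoint (s, t)))%:E)) ->
  Rintegral (@dA R) D (fun p => g p * nu (of_plane p)) =
  Rintegral mu (@I01 R) (fun s => Rintegral (@sigma R) setT (fun t => g (cpoint (s, t)))).
Proof.
move=> mg ig ic; have mD := @measurable_planar_disc R.
have nu0 p : planar_disc p -> 0 <= nu (of_plane p) by case: rnu => -[h _] _ _; exact: h.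
pose ext (f : M * M -> R) p := ((EFin \o f) \_ D) (cpoint p).
have mext f : measurable_fun D f -> measurable_fun setT (ext f).
  move=> mf; apply: measurableT_comp; last exact: (@measurable_cpoint R).
  by apply/(measurable_restrictT _ _).1 => //; exact/measurable_EFinP.
have polar_ge0 (f : M * M -> R) : measurable_fun D f -> (forall p, 0 <= f p) ->
    (\int[@dA R]_(p in D) (f p * nu (of_plane p))%:E = \int[mu \x sigma R]_p ext f p)%E.
  move=> mf f0; rewrite -disc_integral_polar//; first exact/measurable_EFinP.
  by move=> p _; rewrite lee_fin.
have iG : (mu \x sigma R)%E.-integrable setT (ext g).
  apply/integrableP; split; first exact: mext.
  have -> : (\int[mu \x sigma R]_p `|ext g p| = \int[mu \x sigma R]_p ext (fun p => `|g p|%R) p)%E.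
    by apply: eq_integral => p _; rewrite /ext !patchE; case: ifP => //; rewrite abse0.
  rewrite -polar_ge0//; last exact: measurableT_comp.
  have /integrableP[_] := ig; apply: le_lt_trans; rewrite le_eqVlt; apply/orP; left; apply/eqP.
  by apply: eq_integral => p /[!inE] Dp; rewrite /= normrM (ger0_norm (nu0 _ Dp)).
have E : (\int[@dA R]_(p in D) (g p * nu (of_plane p))%:E = \int[mu \x sigma R]_p ext g p)%E.
  rewrite integralE [RHS]integralE; congr (_ - _)%E.
    have -> : (\int[mu \x sigma R]_p (ext g)^\+ p = \int[mu \x sigma R]_p ext (fun p => Num.max (g p) 0)%R p)%E.
      apply: eq_integral => p _; rewrite funeposE /ext !patchE.
      by case: ifP => _; [rewrite /= EFin_max|exact: maxxx].
    rewrite -polar_ge0; [|exact: measurable_maxr|by move=> p; rewrite le_max lexx orbT].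
    apply: eq_integral => p /[!inE] Dp; rewrite funeposE -[0%E]/(0%:E) -EFin_max.
    by rewrite maxr_pMl ?nu0// mul0r.
  have -> : (\int[mu \x sigma R]_p (ext g)^\- p = \int[mu \x sigma R]_p ext (fun p => Num.max (- g p) 0)%R p)%E.
    apply: eq_integral => p _; rewrite funenegE /ext !patchE.
    by case: ifP => _; [rewrite /= EFin_max|rewrite -[point]/(0%E : \bar R) oppe0; exact: maxxx].
  rewrite -polar_ge0; [|apply: measurable_maxr => //; exact: measurable_funN|by move=> p; rewrite le_max lexx orbT].
  apply: eq_integral => p /[!inE] Dp; rewrite funenegE -[0%E]/(0%:E) -EFinN -EFin_max.
  by rewrite maxr_pMl ?nu0// mul0r mulNr.
rewrite /Rintegral E -integral12_prod_meas1// rmeas_integral; last exact: integrable_fubini_F.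
congr fine; apply: eq_integral => s /[!inE] Is.
have -> : fubini_F (sigma R) (ext g) s = (\int[sigma R]_t (g (cpoint (s, t)))%:E)%E.
  by apply: eq_integral => t _; rewrite /ext patchE ifT// inE; exact: cpoint_disc.
by rewrite fineK//; apply: integrable_fin_num => //; exact: ic.
Qed.

Lemma cpointE s t : of_plane (cpoint (s, t)) = s%:C%C * ec t :> C.
Proof. by apply: complex_eqP; rewrite /= !mul0r ?subr0 ?addr0. Qed.

Lemma cint_polar (g : C -> C) : cmeas D (g \o @of_plane R) ->
  cintble (@dA R) D (fun p => g (of_plane p) * (nu (of_plane p))%:C%C) ->
  (forall s, I01 s -> cintble (@sigma R) setT (fun t => g (s%:C%C * ec t))) ->
  cint (@dA R) D (fun p => g (of_plane p) * (nu (of_plane p))%:C%C) =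
  cint mu (@I01 R) (fun s => cint (@sigma R) setT (fun t => g (s%:C%C * ec t))).
Proof.
move=> [m1 m2] [i1 i2] ic.
have Rr (z : C) x : complex.Re (z * x%:C%C) = complex.Re z * x by case: z => a b /=; ring.
have Ir (z : C) x : complex.Im (z * x%:C%C) = complex.Im z * x by case: z => a b /=; ring.
apply: complex_eqP => /=.
  transitivity (Rintegral (@dA R) D (fun p => complex.Re (g (of_plane p)) * nu (of_plane p))).
    by apply: eq_Rintegral => p _; rewrite Rr.
  rewrite Rintegral_polar; last 3 first.
  - exact: m1.
  - by apply: eq_integrable i1 => [|p _]; [exact: measurable_planar_disc|rewrite /= Rr].
  - by move=> s /ic[h _]; apply: eq_integrable h => // t _; rewrite cpointE.
  by apply: eq_Rintegral => s _ /=; apply: eq_Rintegral => t _; rewrite cpointE.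
transitivity (Rintegral (@dA R) D (fun p => complex.Im (g (of_plane p)) * nu (of_plane p))).
  by apply: eq_Rintegral => p _; rewrite Ir.
rewrite Rintegral_polar; last 3 first.
- exact: m2.
- by apply: eq_integrable i2 => [|p _]; [exact: measurable_planar_disc|rewrite /= Ir].
- by move=> s /ic[_ h]; apply: eq_integrable h => // t _; rewrite cpointE.
by apply: eq_Rintegral => s _ /=; apply: eq_Rintegral => t _; rewrite cpointE.
Qed.

End polar_signed.

(** * The Bergman kernel of a radial weight *)

Section kernel.
Context (R : realType).
Local Notation C := R[i].
Local Notation M := (measurableTypeR R).
Variable nu : C -> R.
Hypothesis rnu : radial_weight nu.
Local Notation mu := (rmeas rnu).
Local Notation D := (@planar_disc R : set (M * M)).
Local Notation a := (kcoef mu).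
Hypothesis tail_gt0 : forall r, 0 <= r < 1 -> 0 < tail mu r.

Definition kser (x : C) : C := psum (fun n => (a n)%:C%C) x.

(** The candidate for the kernel: monomials are orthogonal for a radial
    weight, and [kcoef] lists the reciprocals of their squared norms. *)
Definition radial_kernel (z w : C) : C := kser (conjc z * w).

Lemma a_ge0 n : 0 <= a n.
Proof. by rewrite invr_ge0 moment_ge0. Qed.

Lemma modulus_a n : modulus (a n)%:C%C = a n.
Proof. by rewrite modulus_real ger0_norm// a_ge0. Qed.

Lemma kser_summable (x : C) : modulus x < 1 -> csummable (fun n => (a n)%:C%C * x ^+ n).
Proof.
move=> x1; apply: (@csummable_le _ _ (fun n => a n * modulus x ^+ n)).
  by move=> n; rewrite modulusM modulusX modulus_a.
by apply: kcoef_summable => //; rewrite modulus_ge0.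
Qed.

Lemma kserP x : modulus x < 1 -> csums (fun n => (a n)%:C%C * x ^+ n) (kser x).
Proof. by move=> /kser_summable/csummableP. Qed.

Lemma kser_bound x r : modulus x <= r -> r < 1 -> modulus (kser x) <= limn (series (fun n => a n * r ^+ n)).
Proof.
move=> xr r1; have r0 : 0 <= r by apply: le_trans xr; exact: modulus_ge0.
apply: (csums_bound (kserP (le_lt_trans xr r1))); last first.
  by apply: kcoef_summable => //; rewrite r0.
move=> n; rewrite modulusM modulus_a modulusX ler_wpM2l ?a_ge0//.
by rewrite lerXn2r ?nnegrE ?modulus_ge0.
Qed.

Lemma disc_mul (z w : C) : disc z -> modulus w <= 1 -> modulus (conjc z * w) < 1.
Proof.
move=> dz w1; rewrite modulusM modulus_conj; apply: le_lt_trans dz.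
by rewrite ler_piMr ?modulus_ge0.
Qed.

Lemma radial_kernel_bound z w : disc z -> disc w -> modulus (radial_kernel z w) <= limn (series (fun n => a n * modulus z ^+ n)).
Proof.
move=> dz dw; apply: kser_bound => //.
by rewrite modulusM modulus_conj ler_piMr ?modulus_ge0// ltW.
Qed.

Lemma kser_conj x : modulus x < 1 -> kser (conjc x) = conjc (kser x).
Proof.
move=> x1; apply: csums_csum; apply: csums_ext (csums_conj (kserP x1)) => n.
by rewrite conjcM conjcX /= oppr0.
Qed.

Lemma cmeas_of_plane : cmeas D (@of_plane R).
Proof. by split; apply: measurable_funTS; [exact: measurable_fst|exact: measurable_snd]. Qed.

Lemma cmeas_radial_kernel z : disc z -> cmeas D (radial_kernel z \o @of_plane R).
Proof.
move=> dz; apply: (@cmeas_csum _ _ _ D (fun n p => (a n)%:C%C * (conjc z * of_plane p) ^+ n)).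
  move=> n; apply: cmeasM; first exact: cmeas_cst.
  by apply: cmeasX; apply: cmeasM; [exact: cmeas_cst|exact: cmeas_of_plane].
by move=> p Dp; apply: kserP; apply: disc_mul => //; exact: ltW.
Qed.

Lemma radial_kernel_analytic z : disc z -> analytic_on_disc (radial_kernel z).
Proof.
move=> dz w dw; apply/cdiffableP.
have -> : radial_kernel z = psum (fun n => (a n)%:C%C * conjc z ^+ n).
  apply/funext => x; rewrite /radial_kernel /kser /psum; congr csum; apply/funext => n.
  by rewrite exprMn mulrA.
apply: (@psum_cdiffable _ _ 1) => //.
have z1 : modulus (conjc z) < 1 by rewrite modulus_conj.
by apply: csummable_le (kser_summable z1) => n; rewrite -[(1%:C)%C]/(1 : C) expr1n mulr1.
Qed.

Let nu0 p : planar_disc p -> 0 <= nu (of_plane p).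
Proof. by case: rnu => -[h _] _ _; exact: h. Qed.

Let mnu : measurable_fun D (fun p => nu (of_plane p)).
Proof. exact: measurable_nu. Qed.

Lemma integrable_nu : (@dA R).-integrable D (fun p => (nu (of_plane p))%:E).
Proof. by case: rnu => -[]. Qed.

Lemma Lq_integrable q f : 0 < q -> Lq q nu f ->
  (@dA R).-integrable D (fun p => (modulus (f (of_plane p)) `^ q * nu (of_plane p))%:E).
Proof.
move=> q0 [mf hf]; apply/integrableP; split.
  apply/measurable_EFinP; apply: measurable_funM => //.
  apply: (measurableT_comp (measurable_powR q)).
  exact: (measurable_modulus (f := f \o @of_plane R)).
have -> : (\int[@dA R]_(p in D) `|(modulus (f (of_plane p)) `^ q * nu (of_plane p))%:E| =
  \int[@dA R]_(p in D) (modulus (f (of_plane p)) `^ q * nu (of_plane p))%:E)%E.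
  apply: eq_integral => p /[!inE] Dp.
  by rewrite /= (ger0_norm (mulr_ge0 (powR_ge0 _ _) (nu0 Dp))).
by apply: lty_poweRy hf; rewrite invr_eq0 gt_eqF.
Qed.

(** Since |f| <= 1 + |f|^q, a function of the weighted space is integrable
    against the finite measure nu dA. *)
Lemma cintble_mul_bounded q f (g : C -> C) c : 1 <= q -> Lq q nu f -> cmeas D (g \o @of_plane R) ->
  (forall w, disc w -> modulus (g w) <= c) ->
  cintble (@dA R) D (fun p => f (of_plane p) * g (of_plane p) * (nu (of_plane p))%:C%C).
Proof.
move=> q1 L2 mg gc; have mD := @measurable_planar_disc R.
have c0 : 0 <= c by apply: le_trans (gc 0 _); [exact: modulus_ge0|rewrite /disc/= modulus0].
have mf : cmeas D (f \o @of_plane R) by case: L2.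
apply: (@cintble_le _ _ _ _ _ mD _ (fun p => c * (nu (of_plane p) + modulus (f (of_plane p)) `^ q * nu (of_plane p)))).
- by apply: cmeasM; [exact: cmeasM|exact: cmeas_real].
- rewrite (_ : EFin \o _ = (fun p => c%:E * ((nu (of_plane p))%:E + (modulus (f (of_plane p)) `^ q * nu (of_plane p))%:E))%E)//.
  apply: integrableZl => //; apply: integrableD => //; first exact: integrable_nu.
  by apply: Lq_integrable => //; exact: lt_le_trans ltr01 q1.
move=> p Dp; rewrite !modulusM modulus_real (ger0_norm (nu0 Dp)).
rewrite -{2}[nu _]mul1r -mulrDl mulrA ler_wpM2r ?nu0//.
have m0 := modulus_ge0 (f (of_plane p)).
apply: (@le_trans _ _ (modulus (f (of_plane p)) * c)); first by rewrite ler_wpM2l// gc.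
rewrite mulrC ler_wpM2l//.
have [m1|/ltW m1] := leP (modulus (f (of_plane p))) 1; first by rewrite (le_trans m1)// lerDl powR_ge0.
by rewrite -[leLHS]powRr1// (le_trans (ler_powR m1 q1))// lerDr.
Qed.

Lemma radial_kernel_bergman z : disc z -> bergman_space nu (radial_kernel z).
Proof.
move=> dz; split; first exact: radial_kernel_analytic.
split; first exact: cmeas_radial_kernel.
rewrite /Lq_norm; apply: poweR_lty.
pose B := limn (series (fun n => a n * modulus z ^+ n)).
have /integrableP[_ h] := @integrableZl _ _ _ _ _ (@measurable_planar_disc R) (B ^+ 2) _ integrable_nu.
apply: le_lt_trans h; apply: ge0_le_integral => //.
- exact: measurable_planar_disc.
- by move=> p Dp; rewrite lee_fin mulr_ge0 ?powR_ge0 ?nu0.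
- apply/measurable_EFinP; apply: measurable_funM => //.
  apply: (measurableT_comp (measurable_powR 2)).
  exact: (measurable_modulus (f := radial_kernel z \o @of_plane R) (cmeas_radial_kernel dz)).
- apply: measurableT_comp => //; apply: emeasurable_funM => //.
  exact/measurable_EFinP.
move=> p Dp; rewrite -EFinM /= lee_fin powR_mulrn ?modulus_ge0//.
rewrite (ger0_norm (mulr_ge0 (sqr_ge0 _) (nu0 Dp))) ler_wpM2r ?nu0// lerXn2r ?nnegrE ?modulus_ge0//.
- by apply: le_trans (radial_kernel_bound dz Dp); exact: modulus_ge0.
- exact: radial_kernel_bound.
Qed.

Lemma cint_real d (T : measurableType d) (m : {measure set T -> \bar R}) (E : set T) (h : T -> R) :
  cint m E (fun x => (h x)%:C%C) = (Rintegral m E h)%:C%C.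
Proof.
apply: complex_eqP => //=; rewrite /Rintegral -[RHS]/(fine 0%:E); congr fine.
by rewrite integral0.
Qed.

(** In polar coordinates Parseval pairs the Taylor coefficients of f with
    those of the kernel on each circle; integrating over the radius turns
    s^(2 n) into the moment that the coefficient cancels. The interchange is
    justified by splitting |z| = x rho: Cauchy's estimate bounds the
    coefficients of f at radius rho, and the kernel series converges at x. *)
Theorem radial_kernel_reproducing f z : bergman_space nu f -> disc z ->
  f z = disc_integral (fun w => f w * conjc (radial_kernel z w) * (nu w)%:C%C).
Proof.
move=> [fan L2] dz; have fd w : disc w -> cdiffable f w by move=> /fan/cdiffableP.
have mz (s t : R) : 0 <= s -> modulus (s%:C%C * ec t) = s.
  by move=> s0; rewrite modulusM modulus_ec mulr1 modulus_real ger0_norm.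
pose b := tcoef f.
have z0 := modulus_ge0 z.
pose BK := limn (series (fun n => a n * modulus z ^+ n)).
have mf : cmeas D (f \o @of_plane R) by case: L2.
have mKc : cmeas D ((fun w => conjc (radial_kernel z w)) \o @of_plane R) by apply: cmeas_conj; exact: cmeas_radial_kernel.
have su s : I01 s -> csummable (fun n => b n * s%:C%C ^+ n).
  by move=> /I01P/andP[s0 s1]; apply: tcoef_summable => //; rewrite /disc/= modulus_real gtr0_norm.
have sk s : I01 s -> csummable (fun n => (a n)%:C%C * conjc z ^+ n * s%:C%C ^+ n).
  move=> /I01P/andP[s0 s1]; have z1 : modulus (conjc z) < 1 by rewrite modulus_conj.
  apply: csummable_le (kser_summable z1) => n.
  rewrite modulusM [modulus (s%:C%C ^+ n)]modulusX modulus_real gtr0_norm// ler_piMr ?modulus_ge0//.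
  by rewrite exprn_ile1// ltW.
have fE s t : I01 s -> trig (fun n => b n * s%:C%C ^+ n) t = f (s%:C%C * ec t).
  move=> Is; have /I01P/andP[s0 s1] := Is; apply: csums_csum.
  have ds : disc (s%:C%C * ec t) by rewrite /disc/= mz// ltW.
  by apply: csums_ext (taylor fd ds) => n; rewrite exprMn mulrA.
have KE s t : I01 s -> trig (fun n => (a n)%:C%C * conjc z ^+ n * s%:C%C ^+ n) t = radial_kernel z (s%:C%C * ec t).
  move=> Is; have /I01P/andP[s0 s1] := Is; apply: csums_csum.
  have ds : modulus (s%:C%C * ec t) <= 1 by rewrite mz// ltW.
  by apply: csums_ext (kserP (disc_mul dz ds)) => n; rewrite !exprMn !mulrA.
rewrite -[RHS]/(cint (@dA R) D (fun p => f (of_plane p) * conjc (radial_kernel z (of_plane p)) * (nu (of_plane p))%:C%C)).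
rewrite (@cint_polar _ _ rnu (fun w => f w * conjc (radial_kernel z w))); last 3 first.
- exact: cmeasM mf mKc.
- apply: (@cintble_mul_bounded 2 f (fun w => conjc (radial_kernel z w)) BK) => // [|w dw]; first by rewrite ler1n.
  by rewrite modulus_conj; exact: radial_kernel_bound.
- move=> s Is.
  apply: (@cintble_bounded _ _ (limn (series (fun n => modulus (b n * s%:C%C ^+ n))) * BK)).
    apply: cmeasM.
      by apply: eq_cmeas (cmeas_trig (su _ Is)) => t _; rewrite fE.
    by apply: (@cmeas_conj _ _ _ _ (fun t => radial_kernel z (s%:C%C * ec t))); apply: eq_cmeas (cmeas_trig (sk _ Is)) => t _; rewrite KE.
  have /I01P/andP[s0 s1] := Is.
  move=> t; rewrite modulusM modulus_conj; apply: ler_pM; rewrite ?modulus_ge0//.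
    by rewrite -fE//; apply: modulus_trig; exact: su.
  by apply: radial_kernel_bound => //; rewrite /disc/= mz// ltW.
set H := (fun s : M => cint (sigma R) setT (fun t => f (s%:C%C * ec t) * conjc (radial_kernel z (s%:C%C * ec t)))).
have Hs s : I01 s -> csums (fun n => b n * (a n)%:C%C * z ^+ n * (s ^+ (2 * n))%:C%C) (H s).
  move=> Is; have -> : H s = cint (@sigma R) [set: M] (fun t => trig (fun n => b n * s%:C%C ^+ n) t *
      conjc (trig (fun n => (a n)%:C%C * conjc z ^+ n * s%:C%C ^+ n) t)).
    apply: eq_cint => t _; exact: (congr2 (fun x y => x * conjc y) (esym (fE s t Is)) (esym (KE s t Is))).
  apply: csums_ext (parseval (su _ Is) (sk _ Is)) => n.
  have cr (x : R) : conjc x%:C%C = x%:C%C by rewrite /= oppr0.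
  rewrite !conjcM !conjcX !cr conjcK mulnC exprM rmorphXn /= rmorphXn/= expr2; ring.
(* |z| = x rho with x, rho < 1: rho for f, x for the kernel *)
pose rho := (1 + modulus z) / 2; have [zr r1] := midpoint z0 dz.
have r0 : 0 < rho by apply: le_lt_trans zr.
pose x := modulus z / rho.
have hx : 0 <= x < 1 by rewrite divr_ge0 ?(ltW r0)//= ltr_pdivrMr// mul1r.
have [|B B0 hB] := tcoef_bound fd (r := rho); first by rewrite r0.
have muI : (mu (@I01 R) < +oo)%E.
  by rewrite ltey_eq fin_num_measure//; exact: measurable_I01.
have [|||||_ hc] := @cint_series _ M R mu (@I01 R) (@measurable_I01 R)
  (fun n s => b n * (a n)%:C%C * z ^+ n * (s ^+ (2 * n))%:C%C) H (fun n => B * (a n * x ^+ n)) muI.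
- move=> n; apply: cmeasM; first exact: cmeas_cst.
  by apply: cmeas_real; apply: measurable_funX.
- by move=> n; rewrite !mulr_ge0 ?a_ge0 ?exprn_ge0//; case/andP: hx.
- move=> n s Is; have := hB n; rewrite -/b; move: (b n) => bn hb.
  have := expr01 (2 * n) Is => /andP[p0 p1].
  have q0 : 0 <= a n * x ^+ n by rewrite mulr_ge0 ?a_ge0 ?exprn_ge0//; case/andP: hx.
  rewrite !modulusM modulus_a modulusX modulus_real.
  have -> : modulus z = x * rho by rewrite /x divfK// gt_eqF.
  rewrite exprMn ger0_norm//.
  rewrite [leLHS](_ : _ = (modulus bn * rho ^+ n) * (a n * x ^+ n) * s ^+ (2 * n)); last by ring.
  apply: (@le_trans _ _ ((modulus bn * rho ^+ n) * (a n * x ^+ n))); last by rewrite ler_wpM2r.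
  by rewrite ler_piMr// mulr_ge0// mulr_ge0 ?modulus_ge0// exprn_ge0// ltW.
- by apply/cvg_ex; eexists; apply: rseriesZ; apply: kcoef_summable.
- exact: Hs.
apply: (csums_unique (taylor fd dz)); apply: csums_ext hc => n.
rewrite cintZ; last 2 first.
- exact: measurable_I01.
- split; first exact: integrable_expr.
  by apply: eq_integrable (integrable0 _ _) => //; exact: measurable_I01.
rewrite cint_real -/(moment mu (2 * n)) -/b.
have j0 := moment_gt0 tail_gt0 (2 * n).
have e1 : (a n)%:C%C * (moment mu (2 * n))%:C%C = 1 :> C.
  by rewrite -rmorphM/= mulVf// gt_eqF.
rewrite -[RHS]mulr1 -e1; move: (b n) (a n)%:C%C (moment _ _)%:C%C => x1 x2 x3; ring.
Qed.

Lemma radial_kernel_sym z w : disc z -> disc w -> conjc (radial_kernel w z) = radial_kernel z w.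
Proof.
move=> dz dw; rewrite /radial_kernel -kser_conj.
  by rewrite conjcM conjcK mulrC.
by apply: disc_mul => //; exact: ltW.
Qed.

Lemma is_reproducing_radial_kernel z : disc z -> is_reproducing_kernel nu z (radial_kernel z).
Proof. by move=> dz; split; [exact: radial_kernel_bergman|move=> f hf; exact: radial_kernel_reproducing]. Qed.

(** Two functions that reproduce at z and w represent each other: B(w) is the
    inner product of B with the kernel at w, whose conjugate is the value at
    z of the kernel at w. *)
Lemma reproducing_unique z B : disc z -> is_reproducing_kernel nu z B ->
  forall w, disc w -> B w = radial_kernel z w.
Proof.
move=> dz [hB repB] w dw; have mD := @measurable_planar_disc R.
rewrite (radial_kernel_reproducing hB dw) -radial_kernel_sym// (repB _ (radial_kernel_bergman dw)).
have [_ L2] := hB.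
pose BK := limn (series (fun n => a n * modulus w ^+ n)).
have ci : cintble (@dA R) D (fun p => B (of_plane p) * conjc (radial_kernel w (of_plane p)) * (nu (of_plane p))%:C%C).
  apply: (@cintble_mul_bounded 2 B (fun x => conjc (radial_kernel w x)) BK) => //; first by rewrite ler1n.
    by apply: (@cmeas_conj _ _ _ _ (radial_kernel w \o @of_plane R)); exact: cmeas_radial_kernel.
  by move=> x dx; rewrite modulus_conj; exact: radial_kernel_bound.
have cr (x : R) : conjc x%:C%C = x%:C%C by rewrite /= oppr0.
rewrite -[LHS]/(cint (@dA R) D (fun p => B (of_plane p) * conjc (radial_kernel w (of_plane p)) * (nu (of_plane p))%:C%C)).
rewrite -[X in conjc X]/(cint (@dA R) D (fun p => radial_kernel w (of_plane p) * conjc (B (of_plane p)) * (nu (of_plane p))%:C%C)).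
rewrite -[LHS]conjcK; congr (conjc _); rewrite -(cint_conj mD ci); apply: eq_cint => p _.
by rewrite !conjcM cr conjcK (mulrC (conjc _)).
Qed.

Theorem bergman_kernelE z w : disc z -> disc w -> bergman_kernel nu z w = radial_kernel z w.
Proof.
move=> dz dw; apply: reproducing_unique => //.
by apply: (@xgetPex _ (fun=> 0) [set B | is_reproducing_kernel nu z B]); exists (radial_kernel z); exact: is_reproducing_radial_kernel.
Qed.

End kernel.

(** * Circular L1 means of the kernel *)

Section contraction.
Context (R : realType).
Variable k : R.
Hypothesis k1 : 1 < k.

Lemma ex_pow_ge x : exists n, x <= k ^+ n.
Proof.
have h n : 1 + n%:R * (k - 1) <= k ^+ n.
  elim: n => [|n ih]; first by rewrite mul0r addr0 expr0.
  have k1' := k1; have n0 : 0 <= n%:R :> R by rewrite ler0n.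
  apply: le_trans (_ : k * (1 + n%:R * (k - 1)) <= _); last by rewrite exprS ler_pM2l// (lt_trans ltr01).
  rewrite -natr1 -subr_ge0 (_ : _ - _ = n%:R * ((k - 1) * (k - 1))); last by ring.
  by rewrite mulr_ge0// mulr_ge0// subr_ge0 ltW.
have k0 : 0 < k - 1 by rewrite subr_gt0 k1.
exists (Num.truncn (`|x| / (k - 1))).+1; apply: le_trans (h _).
have := truncnS_gt (`|x| / (k - 1)); rewrite ltr_pdivrMr// => /ltW h1.
apply: le_trans (ler_norm x) _; apply: le_trans h1 _; by rewrite lerDr.
Qed.

(** The map r |-> 1 - k (1 - r) multiplies the distance to 1 by k > 1, so it
    leaves [0, 1[ after finitely many steps. *)
Lemma shrink_ind (P : R -> Prop) :
  (forall r, 0 <= r < 1 -> 1 < k * (1 - r) -> P r) ->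
  (forall r, 0 <= r < 1 -> k * (1 - r) <= 1 -> P (1 - k * (1 - r)) -> P r) ->
  forall r, 0 <= r < 1 -> P r.
Proof.
move=> base step r hr; have k1' := k1.
have [n] := ex_pow_ge (1 - r)^-1.
have r1 : 0 < 1 - r by case/andP: hr => _; rewrite subr_gt0.
rewrite -[leLHS]div1r ler_pdivrMr//.
elim: n r hr r1 => [|n ih] r hr r1 h.
  apply: base => //; rewrite expr0 mul1r in h.
  by rewrite (lt_le_trans k1)// ler_peMr// (le_trans ler01)// ltW.
have [hk|hk] := ltP 1 (k * (1 - r)); first exact: base.
have k0 : 0 < k by exact: lt_trans ltr01 k1.
have kr0 : 0 < k * (1 - r) by rewrite mulr_gt0.
apply: step => //; apply: ih.
- by rewrite subr_ge0 hk/= ltrBlDl ltrDr.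
- by rewrite subKr.
- by rewrite subKr mulrA -exprSr.
Qed.

End contraction.

Section l1_bound.
Context (R : realType).
Local Notation M := (measurableTypeR R).
Local Notation C := R[i].
Variable mu : {finite_measure set M -> \bar R}.
Local Notation tail := (tail mu).
Local Notation a := (kcoef mu).
Local Notation sg := (@sigma R).
Hypothesis tail_gt0 : forall r, 0 <= r < 1 -> 0 < tail r.
Variable c0 : R.
Hypothesis c01 : 1 < c0.
Hypothesis tail_doubling : forall r, 0 <= r < 1 -> tail r <= c0 * tail ((1 + r) / 2).
Variables (k c : R).
Hypothesis k1 : 1 < k.
Hypothesis c1 : 1 < c.
Hypothesis tail_reverse : forall r, 0 <= r < 1 -> c * tail (1 - (1 - r) / k) <= tail r.

Let F (x : C) : C := psum (fun n => (a n)%:C%C) x.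

Let aM n : modulus (a n)%:C%C = a n.
Proof. by rewrite modulus_real ger0_norm// invr_ge0 moment_ge0. Qed.

Let a0 n : 0 <= a n. Proof. by rewrite invr_ge0 moment_ge0. Qed.

Let Fsum (x : C) : modulus x < 1 -> csummable (fun n => (a n)%:C%C * x ^+ n).
Proof.
move=> x1; apply: (@csummable_le _ _ (fun n => a n * modulus x ^+ n)).
  by move=> n; rewrite modulusM modulusX aM.
by apply: kcoef_summable => //; rewrite modulus_ge0.
Qed.

Let Ftrig x t : modulus x < 1 -> F (x * ec t) = trig (fun n => (a n)%:C%C * x ^+ n) t.
Proof.
move=> x1; apply: csums_csum.
apply: csums_ext (trigP t (Fsum x1)) => n; by rewrite exprMn mulrA.
Qed.

Let cmF x : modulus x < 1 -> cmeas [set: M] (fun t => F (x * ec t)).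
Proof. by move=> x1; apply: eq_cmeas (cmeas_trig (Fsum x1)) => t _; rewrite Ftrig. Qed.

Let FB x t r : modulus x <= r -> r < 1 -> modulus (F (x * ec t)) <= limn (series (fun n => a n * r ^+ n)).
Proof.
move=> xr r1; have r0 : 0 <= r by apply: le_trans xr; exact: modulus_ge0.
have xt : modulus (x * ec t) < 1 by rewrite modulusM modulus_ec mulr1 (le_lt_trans xr).
apply: (csums_bound (csummableP (Fsum xt))); last first.
  by apply: kcoef_summable => //; rewrite r0.
move=> n; rewrite modulusM aM modulusX modulusM modulus_ec mulr1 ler_wpM2l//.
by rewrite lerXn2r ?nnegrE ?modulus_ge0.
Qed.

Let ciF x : modulus x < 1 -> cintble sg [set: M] (fun t => F (x * ec t)).
Proof.
move=> x1; apply: (@cintble_bounded _ _ (limn (series (fun n => a n * modulus x ^+ n)))).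
  exact: cmF.
by move=> t; exact: FB.
Qed.

(** The mean of |F| over the circle through x, for the function F whose
    coefficients are the [kcoef]. *)
Definition L1 (x : C) := Rintegral sg [set: M] (fun t => modulus (F (x * ec t))).

(** Cauchy-Schwarz in additive form, so that only squares have to be
    integrated. *)
Let amgm (w D : C) (L : R) : 0 < L -> w != 0 ->
  modulus D <= 2^-1 * (L * modulus (w^-1) ^+ 2 + L^-1 * modulus (w * D) ^+ 2).
Proof.
move=> L0 w0; have -> : modulus D = modulus w^-1 * modulus (w * D).
  by rewrite -modulusM mulKf.
set x := modulus _; set y := modulus _.
rewrite [leRHS]mulrC ler_pdivlMr//.
have -> : L * x ^+ 2 + L^-1 * y ^+ 2 = L^-1 * ((L * x - y) ^+ 2) + x * y * 2 by field; rewrite gt_eqF.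
by rewrite lerDr mulr_ge0 ?sqr_ge0// invr_ge0 ltW.
Qed.

Section step.
Variables (u : C) (rho : R).
Hypotheses (u1 : modulus u = 1) (rho01 : 0 <= rho < 1) (krho : k * (1 - rho) <= 1).
Let sg0 := 1 - k * (1 - rho).
Let cf n := a n * (rho ^+ n - sg0 ^+ n).
(** Up to the factor u^n, the Taylor coefficients in w of (1 - x w) (F(x w) -
    F(y w)) for x = rho u and y = sg0 u. *)
Let df n := if n is m.+1 then cf n - rho * cf m else 0.

Let rho0 : 0 <= rho. Proof. by case/andP: rho01. Qed.
Let rho1 : rho < 1. Proof. by case/andP: rho01. Qed.
Let sg00 : 0 <= sg0. Proof. by rewrite subr_ge0. Qed.
Let sgrho : rho - sg0 = (k - 1) * (1 - rho). Proof. by rewrite /sg0; ring. Qed.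
Let sg_le : sg0 <= rho.
Proof. by rewrite -subr_ge0 sgrho mulr_ge0// subr_ge0 ltW. Qed.

Let pow_le n : sg0 ^+ n <= rho ^+ n. Proof. by rewrite lerXn2r ?nnegrE. Qed.

Let pow_diff n : rho ^+ n.+1 - sg0 ^+ n.+1 <= n.+1%:R * (rho - sg0) * rho ^+ n.
Proof.
have d0 : 0 <= rho - sg0 by rewrite subr_ge0.
elim: n => [|n ih]; first by rewrite !expr1 mul1r expr0 mulr1.
have -> : rho ^+ n.+2 - sg0 ^+ n.+2 = rho * (rho ^+ n.+1 - sg0 ^+ n.+1) + (rho - sg0) * sg0 ^+ n.+1 by rewrite !exprS; ring.
have h1 := ler_wpM2l rho0 ih.
have h2 := ler_wpM2l d0 (pow_le n.+1).
apply: le_trans (lerD h1 h2) _.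
by rewrite -(natr1 n.+1) !exprS; rewrite le_eqVlt; apply/orP; left; apply/eqP; ring.
Qed.

(** The two factors of the coefficients of F(x w) - F(y w) vary slowly:
    a(n+1) - a(n) is O(a(n+1) / n) and rho^n - sg0^n is O(n (1 - rho) rho^n). *)
Let df_bound E n : (forall m, m.+1%:R * (a m.+1 - a m) <= E * a m.+1) ->
  `|df n.+1| <= (E + 1) * a n.+1 * (rho - sg0) * rho ^+ n.
Proof.
move=> hE; have d0 : 0 <= rho - sg0 by rewrite subr_ge0.
have ai : a n <= a n.+1 by exact: (kcoef_incr tail_gt0 c01 (leqnSn n)).
have -> : df n.+1 = (a n.+1 - a n) * (rho ^+ n.+1 - sg0 ^+ n.+1) + a n * sg0 ^+ n * (rho - sg0).
  by rewrite /df /cf !exprS; ring.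
have p0 : 0 <= rho ^+ n.+1 - sg0 ^+ n.+1 by rewrite subr_ge0.
have q0 : 0 <= sg0 ^+ n by rewrite exprn_ge0.
have r0 : 0 <= rho ^+ n by rewrite exprn_ge0.
have i0 : 0 <= a n.+1 - a n by rewrite subr_ge0.
rewrite ger0_norm; last by rewrite addr_ge0// ?mulr_ge0.
have h1 : (a n.+1 - a n) * (rho ^+ n.+1 - sg0 ^+ n.+1) <= E * a n.+1 * ((rho - sg0) * rho ^+ n).
  apply: le_trans (ler_wpM2l i0 (pow_diff n)) _.
  rewrite (_ : _ * (_ * _ * _) = n.+1%:R * (a n.+1 - a n) * ((rho - sg0) * rho ^+ n)); last by ring.
  by rewrite ler_wpM2r ?mulr_ge0.
have h2 : a n * sg0 ^+ n * (rho - sg0) <= a n.+1 * rho ^+ n * (rho - sg0).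
  by rewrite ler_wpM2r//; apply: ler_pM => //; exact: pow_le.
apply: le_trans (lerD h1 h2) _.
by rewrite le_eqVlt; apply/orP; left; apply/eqP; ring.
Qed.

Let x := rho%:C%C * u.
Let y := sg0%:C%C * u.

Let mx : modulus x = rho. Proof. by rewrite modulusM u1 mulr1 modulus_real ger0_norm. Qed.
Let my : modulus y = sg0. Proof. by rewrite modulusM u1 mulr1 modulus_real ger0_norm. Qed.
Let mx1 : modulus x < 1. Proof. by rewrite mx. Qed.
Let my1 : modulus y < 1. Proof. by rewrite my (le_lt_trans sg_le). Qed.

Variables (E B : R).
Hypothesis hE : forall m, m.+1%:R * (a m.+1 - a m) <= E * a m.+1.
Hypothesis E0 : 0 <= E.
Hypothesis hB : forall x N, 0 <= x < 1 -> \sum_(n < N) a n ^+ 2 * x ^+ n <= B / ((1 - x) * tail x ^+ 2).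

Let v n : C := (df n)%:C%C * u ^+ n.

Let rho_gt0 : 0 < rho.
Proof.
rewrite lt_neqAle rho0 andbT; apply: contraTneq krho => <-.
by rewrite subr0 mulr1 -ltNge.
Qed.

Let mv n : modulus (v n) = `|df n|.
Proof. by rewrite modulusM modulusX u1 expr1n mulr1 modulus_real. Qed.

Let sv : csummable v.
Proof.
have s1 : cvgn (series (fun n => a n * rho ^+ n)) by apply: kcoef_summable => //; rewrite rho0.
apply: (@csummable_le _ _ (fun n => ((E + 1) * (rho - sg0) / rho) * (a n * rho ^+ n))); last first.
  by apply/cvg_ex; eexists; exact: rseriesZ s1.
case=> [|n]; rewrite mv.
  rewrite normr0 mulr_ge0//; last by rewrite mulr_ge0// exprn_ge0.
  by apply: divr_ge0 => //; apply: mulr_ge0; [exact: addr_ge0|rewrite subr_ge0].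
apply: le_trans (df_bound _ hE) _; rewrite le_eqVlt; apply/orP; left; apply/eqP.
by rewrite exprS; field; rewrite gt_eqF.
Qed.

Let wD t : (1 - x * ec t) * (F (x * ec t) - F (y * ec t)) = trig v t.
Proof.
have hx := csumsD (trigP t (Fsum mx1)) (csumsZ (-1) (trigP t (Fsum my1))).
have key (w A1 A2 : C) : (1 - w) * (A1 - A2) = (A1 - A2) + - w * (A1 - A2) by ring.
rewrite !Ftrig// key; set D := trig (fun n => (a n)%:C%C * x ^+ n) t - trig (fun n => (a n)%:C%C * y ^+ n) t.
have DE : trig (fun n => (a n)%:C%C * x ^+ n) t + -1 * trig (fun n => (a n)%:C%C * y ^+ n) t = D by rewrite mulN1r.
rewrite DE in hx; apply/esym/csums_csum.
apply: csums_ext (csumsD hx (csums_shift (csumsZ (- (x * ec t)) hx))) => -[|n].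
  by rewrite /v /df !expr0 !mulr1 addr0 mulN1r subrr.
rewrite /v /df /cf rmorphB/= !rmorphM/= !rmorphB/= !rmorphXn/= /x /y !exprMn !exprS.
set p := sg0%:C%C; set q := rho%:C%C; set r := ec t.
move: (a n)%:C%C (a n.+1)%:C%C (p ^+ n) (q ^+ n) (u ^+ n) (r ^+ n) => a1 a2 b1 b2 b3 b4; ring.
Qed.

Let integrable_trig2 (w : nat -> C) : csummable w ->
  sg.-integrable [set: M] (fun t => (modulus (trig w t) ^+ 2)%:E).
Proof.
move=> sw; have [] := @cintble_bounded _ (fun t => (modulus (trig w t) ^+ 2)%:C%C) (limn (series (fun n => modulus (w n))) ^+ 2).
- apply: cmeas_real; apply: measurable_funX; apply: measurable_modulus; exact: cmeas_trig.
- move=> t; rewrite modulus_real ger0_norm ?sqr_ge0// lerXn2r ?nnegrE ?modulus_ge0//.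
    by apply: le_trans (modulus_trig t sw); exact: modulus_ge0.
  exact: modulus_trig.
by [].
Qed.

Let trig2_bound (w : nat -> C) Y : csummable w -> (forall N, \sum_(n < N) modulus (w n) ^+ 2 <= Y) ->
  Rintegral sg [set: M] (fun t => modulus (trig w t) ^+ 2) <= Y.
Proof.
move=> sw hY; have h := parseval_norm sw.
rewrite -(cvg_lim (@Rhausdorff R) h); apply: limr_le; first by apply/cvg_ex; eexists; exact: h.
by apply: nearW => N; rewrite /series /= big_mkord.
Qed.

Let inv_sum : csummable (fun n => x ^+ n).
Proof.
apply: (@csummable_le _ _ (geometric 1 rho)).
  by move=> n; rewrite modulusX mx /geometric/= mul1r.
by apply: is_cvg_geometric_series; rewrite ger0_norm.
Qed.

Let inv_trig t : (1 - x * ec t)^-1 = trig (fun n => x ^+ n) t.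
Proof.
have xt : modulus (x * ec t) < 1 by rewrite modulusM modulus_ec mulr1.
apply/esym/csums_csum; apply: csums_ext (csums_geometric xt) => n; by rewrite exprMn.
Qed.

Let inv2 : Rintegral sg [set: M] (fun t => modulus (trig (fun n => x ^+ n) t) ^+ 2) <= (1 - rho)^-1.
Proof.
apply: trig2_bound => // N.
have d0 : 0 < 1 - rho by rewrite subr_gt0.
have -> : \sum_(n < N) modulus (x ^+ n) ^+ 2 = \sum_(n < N) (rho ^+ 2) ^+ n.
  by apply: eq_bigr => n _; rewrite modulusX mx -!exprM mulnC.
have q0 m : 0 <= (rho ^+ 2) ^+ m by rewrite exprn_ge0// exprn_ge0.
have h m : (1 - rho) * \sum_(n < m) (rho ^+ 2) ^+ n <= 1 - (rho ^+ 2) ^+ m.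
  elim: m => [|m ih]; first by rewrite big_ord0 expr0 mulr0 subrr.
  rewrite big_ord_recr /= mulrDr [in leRHS]exprS.
  have : 0 <= rho * (1 - rho) * (rho ^+ 2) ^+ m by rewrite mulr_ge0// mulr_ge0// ltW.
  move: ih; rewrite !expr2; move: (\sum_(_ < m) _) ((rho * rho) ^+ m) => S Q; nra.
rewrite -[leRHS]mul1r ler_pdivlMr// mulrC; apply: le_trans (h N) _.
by rewrite lerBlDr lerDl.
Qed.

Let v2 : Rintegral sg [set: M] (fun t => modulus (trig v t) ^+ 2) <=
  (E + 1) ^+ 2 * k ^+ 2 * B * (1 - rho) / tail rho ^+ 2.
Proof.
have d0 : 0 < 1 - rho by rewrite subr_gt0.
have T0 : 0 < tail rho by exact: tail_gt0.
have hr2 : 0 <= rho ^+ 2 < 1.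
  by rewrite exprn_ge0//= exprn_ilt1.
have B0 : 0 <= B.
  have := hB 0 hr2; rewrite big_ord0 pmulr_lge0// invr_gt0 mulr_gt0 ?subr_gt0 ?exprn_gt0 ?tail_gt0//.
  by case/andP: hr2.
apply: trig2_bound => // N.
have k0 : 0 < k by exact: lt_trans ltr01 k1.
(* the factor rho^2 makes up for the exponent n in [df_bound] *)
have h1 n : rho ^+ 2 * modulus (v n) ^+ 2 <= (E + 1) ^+ 2 * (rho - sg0) ^+ 2 * (a n ^+ 2 * (rho ^+ 2) ^+ n).
  case: n => [|n]; rewrite mv.
    by rewrite normr0 expr0n/= mulr0; do 2!apply: mulr_ge0; rewrite ?sqr_ge0// ?mulr_ge0 ?sqr_ge0.
  have := df_bound n hE => hd.
  have b0 : 0 <= (E + 1) * a n.+1 * (rho - sg0) * rho ^+ n.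
    by apply: le_trans hd.
  have : `|df n.+1| ^+ 2 <= ((E + 1) * a n.+1 * (rho - sg0) * rho ^+ n) ^+ 2.
    by rewrite lerXn2r ?nnegrE.
  move=> /(ler_wpM2l (sqr_ge0 rho)) /le_trans; apply.
  rewrite -exprM mulnC exprM exprS le_eqVlt; apply/orP; left; apply/eqP.
  by rewrite -[rho ^+ n.+1]/(rho ^+ n.+1) ?exprS; ring.
have h2 : rho ^+ 2 * \sum_(n < N) modulus (v n) ^+ 2 <= (E + 1) ^+ 2 * (rho - sg0) ^+ 2 * (B / ((1 - rho ^+ 2) * tail (rho ^+ 2) ^+ 2)).
  apply: le_trans (_ : (E + 1) ^+ 2 * (rho - sg0) ^+ 2 * \sum_(n < N) (a n ^+ 2 * (rho ^+ 2) ^+ n) <= _).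
    by rewrite !mulr_sumr; apply: ler_sum => n _; exact: h1.
  by apply: ler_wpM2l; [apply: mulr_ge0; exact: sqr_ge0|exact: hB].
have r2r : rho ^+ 2 <= rho by rewrite expr2 ler_piMl// ltW.
have h3 : B / ((1 - rho ^+ 2) * tail (rho ^+ 2) ^+ 2) <= B / ((1 - rho) * tail rho ^+ 2).
  rewrite ler_wpM2l// lef_pV2 ?posrE; last 2 first.
  - by rewrite mulr_gt0 ?exprn_gt0 ?tail_gt0// subr_gt0; case/andP: hr2.
  - by rewrite mulr_gt0 ?exprn_gt0.
  apply: ler_pM; rewrite ?(ltW d0) ?sqr_ge0// ?lerB//.
  by rewrite lerXn2r ?nnegrE ?tail_ge0// tail_decr.
have h4 : (rho - sg0) ^+ 2 <= k ^+ 2 * rho ^+ 2 * (1 - rho) ^+ 2.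
  rewrite sgrho exprMn ler_wpM2r ?sqr_ge0// -exprMn lerXn2r ?nnegrE ?mulr_ge0 ?(ltW k0) ?subr_ge0 ?(ltW k1)//.
  by move: krho; rewrite mulrBr mulr1; move: (k * rho) => kr; lra.
have r20 : 0 < rho ^+ 2 by rewrite exprn_gt0.
rewrite -(ler_pM2l r20); apply: le_trans h2 _.
apply: le_trans (ler_wpM2l _ h3) _; first by apply: mulr_ge0; exact: sqr_ge0.
apply: le_trans (_ : (E + 1) ^+ 2 * (k ^+ 2 * rho ^+ 2 * (1 - rho) ^+ 2) * (B / ((1 - rho) * tail rho ^+ 2)) <= _).
  rewrite ler_wpM2r//; last by rewrite ler_wpM2l ?sqr_ge0.
  by rewrite divr_ge0// mulr_ge0 ?sqr_ge0// ltW.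
have d1 : 1 - rho != 0 by rewrite gt_eqF.
have T1 : tail rho != 0 by rewrite gt_eqF.
by rewrite le_eqVlt; apply/orP; left; apply/eqP; field; rewrite ?T1 ?d1.
Qed.

(** Moving from radius rho to 1 - k (1 - rho) changes the circular mean by
    O(1 / T(rho)). By [amgm] the difference D of the values is bounded
    through |1 - x w|^-2, of mean at most 1 / (1 - rho), and |(1 - x w) D|^2,
    of mean O((1 - rho) / T(rho)^2) by Parseval and [sum_kcoef_sqr]; the
    weight L balances the two. *)
Lemma diff_L1 : L1 x <= L1 y + 2^-1 * (1 + (E + 1) ^+ 2 * k ^+ 2 * B) / tail rho.
Proof.
have d0 : 0 < 1 - rho by rewrite subr_gt0.
have T0 : 0 < tail rho by exact: tail_gt0.
pose L := (1 - rho) / tail rho; have L0 : 0 < L by rewrite divr_gt0.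
pose A (t : M) := modulus (trig (fun n => x ^+ n) t) ^+ 2.
pose V (t : M) := modulus (trig v t) ^+ 2.
have iA : sg.-integrable [set: M] (EFin \o A) by exact: integrable_trig2.
have iV : sg.-integrable [set: M] (EFin \o V) by exact: integrable_trig2.
have iLA : sg.-integrable [set: M] (EFin \o (fun t => L * A t)).
  by apply: (integrableZl measurableT L iA).
have iLV : sg.-integrable [set: M] (EFin \o (fun t => L^-1 * V t)).
  by apply: (integrableZl measurableT L^-1 iV).
have iS : sg.-integrable [set: M] (EFin \o (fun t => L * A t + L^-1 * V t)).
  by apply: (integrableD measurableT iLA iLV).
have iH : sg.-integrable [set: M] (EFin \o (fun t => 2^-1 * (L * A t + L^-1 * V t))).
  by apply: (integrableZl measurableT 2^-1 iS).
have iy : sg.-integrable [set: M] (EFin \o (fun t => modulus (F (y * ec t)))).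
  by apply: integrable_modulus => //; exact: ciF.
have ix : sg.-integrable [set: M] (EFin \o (fun t => modulus (F (x * ec t)))).
  by apply: integrable_modulus => //; exact: ciF.
have iT : sg.-integrable [set: M] (EFin \o (fun t => modulus (F (y * ec t)) + 2^-1 * (L * A t + L^-1 * V t))).
  by apply: (integrableD measurableT iy iH).
apply: (@le_trans _ _ (Rintegral sg setT (fun t => modulus (F (y * ec t)) + 2^-1 * (L * A t + L^-1 * V t)))).
  apply: le_Rintegral => // t _.
  have w0 : 1 - x * ec t != 0.
    rewrite subr_eq0; apply: contraTneq rho1 => h.
    have := congr1 (@modulus R) h; rewrite modulus1 modulusM modulus_ec mulr1 mx => er.
    by rewrite -er ltxx.
  rewrite -[F (x * ec t)](subrKC (F (y * ec t))).
  apply: le_trans (modulusD _ _) _; rewrite lerD2l.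
  apply: le_trans (amgm _ L0 w0) _.
  by rewrite wD inv_trig.
rewrite (RintegralD measurableT iy iH) -/(L1 y) lerD2l.
rewrite (RintegralZl _ measurableT iS) (RintegralD measurableT iLA iLV).
rewrite (RintegralZl _ measurableT iA) (RintegralZl _ measurableT iV).
rewrite -mulrA ler_pM2l ?invr_gt0//.
apply: le_trans (lerD (ler_wpM2l (ltW L0) inv2) (ler_wpM2l _ v2)) _; first by rewrite invr_ge0 ltW.
have d1 : 1 - rho != 0 by rewrite gt_eqF.
have T1 : tail rho != 0 by rewrite gt_eqF.
by rewrite le_eqVlt /L; apply/orP; left; apply/eqP; field; rewrite ?T1 ?d1.
Qed.

End step.

(** Iterate [diff_L1] towards the centre. Each step costs O(1 / T) and the
    tails grow at least by the factor c > 1 from one step to the next, so the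
    costs form a geometric sum dominated by the first term. *)
Theorem kser_L1 : exists2 A, 0 < A & forall x : C, modulus x < 1 ->
  L1 x <= A / tail (modulus x).
Proof.
have [E E0 hE] := kcoef_diff tail_gt0 c01 tail_doubling.
have [B B0 hB] := sum_kcoef_sqr tail_gt0 c01 tail_doubling.
have k0 : 0 < k by exact: lt_trans ltr01 k1.
pose G := 2^-1 * (1 + (E + 1) ^+ 2 * k ^+ 2 * B).
pose b := limn (series (fun n => a n * (1 - k^-1) ^+ n)).
have kV : 0 < k^-1 < 1 by rewrite invr_gt0 k0 invf_lt1.
have kV' : 0 <= 1 - k^-1 < 1 by case/andP: kV => h1 h2; rewrite subr_ge0 ltW//= ltrBlDl ltrDr.
have c_gt0 : 0 < c by exact: lt_trans ltr01 c1.
have t00 : 0 < tail 0 by apply: tail_gt0; rewrite lexx ltr01.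
have b0 : 0 <= b.
  apply: le_trans (FB (x := 0) 0 _ _) => //; first by exact: modulus_ge0.
  - by rewrite modulus0; case/andP: kV'.
  - by case/andP: kV'.
have cc : 0 < c / (c - 1) by rewrite divr_gt0// subr_gt0.
have G0 : 0 < G.
  by rewrite mulr_gt0// ltr_wpDr// mulr_ge0 ?(ltW B0)// mulr_ge0 ?sqr_ge0.
pose A := b * tail 0 + c / (c - 1) * G.
have A0 : 0 < A by apply: ltr_wpDl; [apply: mulr_ge0 => //; exact: ltW|exact: mulr_gt0].
exists A => // x x1.
have main (u : C) : modulus u = 1 -> forall r, 0 <= r < 1 -> L1 (r%:C%C * u) * tail r <= A.
  move=> u1; apply: (shrink_ind k1) => r hr hk; have /andP[r0 r1] := hr.
    have rk : r <= 1 - k^-1.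
      rewrite lerBrDl -lerBrDr -[leLHS]div1r ler_pdivrMr// mulrC; exact: ltW.
    have mr : modulus (r%:C%C * u) = r by rewrite modulusM u1 mulr1 modulus_real ger0_norm.
    have : L1 (r%:C%C * u) <= b.
      have Eb : b = Rintegral sg [set: M] (fun=> b).
        by rewrite Rintegral_cst// [X in fine X]sigmaT mulr1.
      rewrite [leRHS]Eb; apply: le_Rintegral => //.
      - by apply: integrable_modulus => //; apply: ciF; rewrite mr.
      - by apply: finite_measure_integrable_cst.
      by move=> t _; apply: FB; [rewrite mr|case/andP: kV'].
    move=> hb; apply: (@le_trans _ _ (b * tail 0)); last by rewrite lerDl mulr_ge0// ltW.
    apply: ler_pM => //; rewrite ?tail_ge0 ?tail_decr//.
    by apply: Rintegral_ge0 => t _; exact: modulus_ge0.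
  move=> ih.
  have h := diff_L1 u1 hr hk hE (ltW E0) hB; rewrite -/G in h.
  set s := 1 - k * (1 - r) in ih h.
  have hs : 0 <= s < 1.
    by rewrite subr_ge0 hk/= ltrBlDl ltrDr mulr_gt0// subr_gt0.
  have hT : c * tail r <= tail s.
    have := tail_reverse hs; by rewrite /s subKr (mulrC k) mulfK ?gt_eqF// subKr.
  have Tr : 0 < tail r by exact: tail_gt0.
  have L0 : 0 <= L1 (s%:C%C * u) by apply: Rintegral_ge0 => t _; exact: modulus_ge0.
  have h1 : L1 (r%:C%C * u) * tail r <= L1 (s%:C%C * u) * tail r + G.
    apply: le_trans (ler_wpM2r (ltW Tr) h) _.
    by rewrite mulrDl divfK// gt_eqF.
  have h2 : c * (L1 (s%:C%C * u) * tail r) <= A.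
    by rewrite mulrCA; apply: le_trans ih; rewrite ler_wpM2l.
  apply: le_trans h1 _; rewrite -(ler_pM2l c_gt0) mulrDr.
  apply: le_trans (lerD h2 (lexx _)) _.
  have : c * G <= (c - 1) * A.
    have e1 : (c - 1) * (c / (c - 1) * G) = c * G by field; rewrite gt_eqF// subr_gt0.
    rewrite /A mulrDr e1 lerDr.
    by rewrite mulr_ge0 ?subr_ge0 ?(ltW c1)// mulr_ge0// ltW.
  by rewrite mulrBl mul1r lerBrDl.
have x0 := modulus_ge0 x.
have Tx : 0 < tail (modulus x) by apply: tail_gt0; rewrite x0.
rewrite ler_pdivlMr//.
have [-> |xn0] := eqVneq x 0.
  have := main 1 (modulus1 R) 0; rewrite lexx ltr01 => /(_ isT).
  by rewrite -[(0%:C)%C]/(0 : C) mul0r modulus0.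
have u1 : modulus (x / (modulus x)%:C%C) = 1.
  by rewrite modulusM modulusV modulus_real ger0_norm// divff// gt_eqF// modulus_gt0.
have := main _ u1 (modulus x); rewrite x0 => /(_ x1).
have mC : (modulus x)%:C%C != 0 by rewrite -modulus_gt0 modulus_real normr_gt0 gt_eqF// modulus_gt0.
have xE : (modulus x)%:C%C * (x / (modulus x)%:C%C) = x by rewrite mulrC divfK.
by rewrite xE.
Qed.

End l1_bound.

(** * The integral condition on tails *)

Section tests.
Context (R : realType).
Local Notation M := (measurableTypeR R).
Variable mu : {finite_measure set M -> \bar R}.
Local Notation T := (tail mu).
Hypothesis tail_gt0 : forall r, 0 <= r < 1 -> 0 < T r.
Variables (k c d al : R).
Hypotheses (k1 : 1 < k) (c1 : 1 < c) (d1 : 1 <= d).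
Let up r := 1 - (1 - r) / k.
Hypothesis tail_reverse : forall r, 0 <= r < 1 -> c * T (up r) <= T r.
Hypothesis tail_double : forall r, 0 <= r < 1 -> T r <= d * T (up r).
Hypotheses (al0 : 0 < al) (al1 : al < 1).

Let k0 : 0 < k. Proof. exact: lt_trans ltr01 k1. Qed.
Let c0 : 0 < c. Proof. exact: lt_trans ltr01 c1. Qed.
Let d0 : 0 < d. Proof. exact: lt_le_trans ltr01 d1. Qed.

(** The weight of Schur's test; al is the reciprocal of q or of the conjugate
    exponent. *)
Definition wt s := T s `^ (- al).

Let wtE s : wt s = (T s `^ al)^-1. Proof. exact: powRN. Qed.

Let wt0 s : 0 <= wt s. Proof. exact: powR_ge0. Qed.

Let wt_incr s r : s <= r -> 0 <= r < 1 -> wt s <= wt r.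
Proof.
move=> sr hr; have Tr := tail_gt0 hr; have Ts : 0 < T s by apply: lt_le_trans Tr _; exact: tail_decr.
rewrite !wtE lef_pV2 ?posrE ?powR_gt0//.
by apply: ge0_ler_powR; rewrite ?nnegrE ?tail_ge0// ?tail_decr// ltW.
Qed.

Let wt_scale x s r : 0 < x -> 0 < T s -> 0 < T r -> T s <= x * T r -> wt r <= x `^ al * wt s.
Proof.
move=> x0 Ts Tr h; rewrite !wtE ler_pdivlMr ?powR_gt0// mulrC ler_pdivrMr ?powR_gt0//.
rewrite -powRM ?(ltW x0) ?(ltW Tr)//.
by apply: ge0_ler_powR => //; rewrite ?nnegrE ?mulr_ge0 ?ltW.
Qed.

Let up01 r : 0 <= r < 1 -> [/\ 0 <= up r, up r < 1 & r <= up r].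
Proof.
move=> /andP[r0 r1]; have h : 0 < (1 - r) / k by rewrite divr_gt0// subr_gt0.
have h2 : (1 - r) / k <= 1 - r by rewrite ler_pdivrMr// ler_peMr ?(ltW k1)// subr_ge0 ltW.
by rewrite /up; split; lra.
Qed.

Let Tw x : 0 < x -> x * (x `^ al)^-1 = x `^ (1 - al).
Proof.
move=> x0; rewrite powRB ?powRr1//; last by rewrite gt_eqF// implybT.
exact: ltW.
Qed.

Let piece (a b : R) := (`[a, b[%classic `&` @I01 R) : set M.

Let mpiece a b : measurable (piece a b).
Proof. by apply: measurableI; [exact: measurable_itv|exact: measurable_I01]. Qed.

Let piece_le a b : (mu (piece a b) <= (T a)%:E)%E.
Proof.
rewrite /T /tail fineK; last by rewrite fin_num_measure//; exact: (mpiece a 1).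
apply: le_measure; rewrite ?inE; [exact: mpiece|exact: (mpiece a 1)|].
move=> x [/= + Ix]; rewrite !in_itv/= => /andP[-> _]; split => //.
by case/I01P/andP: Ix.
Qed.

Let mT : measurable_fun [set: M] T.
Proof. by apply: nonincreasing_measurable => // s r; exact: tail_decr. Qed.

Lemma measurable_wt : measurable_fun [set: M] wt.
Proof.
exact: (measurableT_comp (measurable_powR _)).
Qed.

Let mwt A : measurable A -> measurable_fun A (fun s => (wt s)%:E).
Proof. by move=> mA; apply/measurable_EFinP; apply: measurable_funTS; exact: measurable_wt. Qed.

Let minvT (g : R -> R) : measurable_fun [set: M] g -> measurable_fun [set: M] (fun s => (T (g s))^-1).
Proof.
move=> mg; have -> : (fun s => (T (g s))^-1) = (fun s => T (g s) `^ (-1)).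
  by apply/funext => s; rewrite powR_inv1// tail_ge0.
apply: (measurableT_comp (measurable_powR _)); exact: measurableT_comp mT mg.
Qed.

Let one_pow p : 1 `^ p = 1 :> R. Proof. by rewrite powR1. Qed.

Let A1 := d `^ al / (1 - c `^ (- (1 - al))).

Let A1den : 0 < 1 - c `^ (- (1 - al)).
Proof.
rewrite subr_gt0 powRN invf_lt1 ?powR_gt0//.
rewrite -[ltLHS](one_pow (1 - al)); by apply: gt0_ltr_powR; rewrite ?nnegrE ?subr_gt0 ?(ltW c0).
Qed.

Let upn n r := 1 - (1 - r) / k ^+ n.

Let upnS n r : upn n.+1 r = upn n (up r).
Proof. by rewrite /upn /up exprS subKr invfM mulrA. Qed.

Let piece_split a b e : a <= b -> b <= e -> piece a e = piece a b `|` piece b e.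
Proof.
move=> ab be; rewrite /piece -setIUl; congr (_ `&` _).
apply/seteqP; split => x /=; rewrite !in_itv/=.
  by move=> /andP[ax xe]; have [xb|bx] := ltP x b; [left; rewrite ax|right].
by move=> [/andP[-> xb]|/andP[bx ->]]; [rewrite (lt_le_trans xb)|rewrite (le_trans ab)].
Qed.

Let piece_disj a b e : [disjoint piece a b & piece b e].
Proof.
apply/disj_setPS => x [[/= + _] [/= + _]]; rewrite !in_itv/= => /andP[_ xb] /andP[bx _].
by move: xb; rewrite ltNge bx.
Qed.

Let int_piece_le a b (f : R -> R) (C : R) : 0 <= C -> measurable_fun (piece a b) f ->
  (forall s, piece a b s -> 0 <= f s <= C) ->
  (\int[mu]_(s in piece a b) (f s)%:E <= (C * T a)%:E)%E.
Proof.
move=> C0 mf hf; apply: (@le_trans _ _ (\int[mu]_(s in piece a b) (cst C%:E) s)%E).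
  apply: ge0_le_integral => //.
  - by move=> s /hf/andP[h _]; rewrite lee_fin.
  - exact/measurable_EFinP.
  - by move=> s /hf/andP[_ h]; rewrite lee_fin.
rewrite integral_cst; last exact: mpiece.
rewrite EFinM; apply: lee_wpmul2l; [by rewrite lee_fin|exact: piece_le].
Qed.

Lemma wt_upper_pieces n r : 0 <= r < 1 ->
  (\int[mu]_(s in piece r (upn n r)) (wt s)%:E <= (A1 * (T r * wt r))%:E)%E.
Proof.
have A10 : 0 <= A1 by rewrite divr_ge0 ?powR_ge0 ?(ltW A1den).
elim: n r => [|n ih] r hr.
  have -> : piece r (upn 0 r) = set0.
    apply/seteqP; split => // x [/= + _]; rewrite /upn expr0 divr1 subKr in_itv/= => /andP[rx xr].
    by move: xr; rewrite ltNge rx.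
  by rewrite integral_set0 lee_fin mulr_ge0// mulr_ge0// tail_ge0.
have [u0 u1 ru] := up01 hr; have hu : 0 <= up r < 1 by rewrite u0.
have un : up r <= upn n.+1 r.
  rewrite upnS /upn lerBrDr -lerBrDl ler_pdivrMr ?exprn_gt0//.
  by rewrite ler_peMr ?subr_ge0 ?(ltW u1)// exprn_ege1// ltW.
have Tr := tail_gt0 hr; have Tu := tail_gt0 hu.
have dj := piece_disj r (up r) (upn n.+1 r).
have m1 := mpiece r (up r). have m2 := mpiece (up r) (upn n.+1 r).
have mU := mwt (measurableU _ _ m1 m2).
rewrite (piece_split ru un) ge0_integral_setU//; last by move=> s _; rewrite lee_fin.
have p1 : (\int[mu]_(s in piece r (up r)) (wt s)%:E <= (wt (up r) * T r)%:E)%E.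
  apply: int_piece_le => //; first by apply: measurable_funTS; exact: measurable_wt.
  move=> s [/= + _]; rewrite in_itv/= => /andP[_ su].
  by rewrite wt0/= wt_incr// ltW.
have p2 := ih (up r) hu; rewrite -upnS in p2.
apply: le_trans (leeD p1 p2) _; rewrite -EFinD lee_fin.
have h1 : wt (up r) <= d `^ al * wt r by apply: wt_scale => //; exact: tail_double.
have h2 : T (up r) * wt (up r) <= c `^ (- (1 - al)) * (T r * wt r).
  rewrite !wtE !Tw// powRN ler_pdivlMl ?powR_gt0// -powRM ?(ltW Tu) ?(ltW c0)//.
  apply: ge0_ler_powR; rewrite ?nnegrE ?mulr_ge0 ?(ltW Tu) ?(ltW c0) ?(ltW Tr) ?subr_ge0 ?(ltW al1)//.
  exact: tail_reverse.
have h3 := ler_wpM2r (ltW Tr) h1; have h4 := ler_wpM2l A10 h2.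
apply: le_trans (lerD h3 h4) _.
have -> : d `^ al = A1 * (1 - c `^ (- (1 - al))) by rewrite /A1 divfK// gt_eqF.
rewrite le_eqVlt; apply/orP; left; apply/eqP; ring.
Qed.

(** Cut [r, 1[ at the iterates of [up]. The integral of T^-al over a piece is
    at most a constant times T^(1 - al) at its left end, and these decay
    geometrically because T decreases by the factor c. *)
Lemma wt_upper r : 0 <= r < 1 ->
  (\int[mu]_(s in piece r 1) (wt s)%:E <= (A1 * (T r * wt r))%:E)%E.
Proof.
move=> hr; have r1 : 0 < 1 - r by case/andP: hr => _; rewrite subr_gt0.
have E : piece r 1 = \bigcup_n piece r (upn n r).
  apply/seteqP; split => x.
    move=> [/= + Ix]; rewrite in_itv/= => /andP[rx x1].
    have x10 : 0 < 1 - x by rewrite subr_gt0.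
    have [n hn] := ex_pow_ge k1 ((1 - r) / (1 - x) + 1).
    exists n => //; split => //=; rewrite in_itv/= rx /upn ltrBrDr -ltrBrDl ltr_pdivrMr ?exprn_gt0//.
    rewrite -ltr_pdivrMl// mulrC; apply: lt_le_trans hn; by rewrite ltrDl.
  move=> [n _ [/= + Ix]]; rewrite in_itv/= => /andP[rx xu]; split => //=; rewrite in_itv/= rx.
  by case/I01P/andP: Ix.
have nd : nondecreasing_seq (fun n => piece r (upn n r)).
  apply/nondecreasing_seqP => n; rewrite subsetEset => x [/= + Ix]; rewrite in_itv/= => /andP[rx xu].
  split => //=; rewrite in_itv/= rx/=; apply: lt_le_trans xu _.
  rewrite lerD2l lerN2 ler_wpM2l ?(ltW r1)// lef_pV2 ?posrE ?exprn_gt0//.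
  by rewrite exprS ler_peMl ?(ltW k1)// exprn_ge0// ltW.
have h : (\int[mu]_(s in piece r (upn n r)) (wt s)%:E)%E @[n --> \oo] -->
    (\int[mu]_(s in \bigcup_n piece r (upn n r)) (wt s)%:E)%E.
  apply: ge0_nondecreasing_set_cvg_integral => //.
  - by move=> n; apply: mwt; exact: mpiece.
  - by move=> n s _; rewrite lee_fin.
rewrite E -(cvg_lim _ h)//; apply: lime_le; first by apply/cvg_ex; eexists; exact: h.
by apply: nearW => n; exact: wt_upper_pieces.
Qed.

Let A2 := d / (1 - (c^-1) `^ al).

Let A2den : 0 < 1 - (c^-1) `^ al.
Proof.
rewrite subr_gt0 -[ltRHS](one_pow al); by apply: gt0_ltr_powR; rewrite ?nnegrE ?invr_ge0 ?(ltW c0) ?invf_lt1.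
Qed.

Let A2d : d <= A2.
Proof.
rewrite /A2 ler_pdivlMr// -[leRHS]mulr1 ler_wpM2l ?(ltW d0)//.
by rewrite lerBlDr lerDl powR_ge0.
Qed.

(** Towards 0 the tails increase by the factor c at each step, so T^-al
    decreases geometrically; induct with [shrink_ind]. *)
Lemma wt_lower r : 0 <= r < 1 ->
  (\int[mu]_(s in piece 0 r) (wt s * (T s)^-1)%:E <= (A2 * wt r)%:E)%E.
Proof.
have piece_bound a b : 0 <= a -> 0 <= b < 1 ->
    (\int[mu]_(s in piece a b) (wt s * (T s)^-1)%:E <= (wt b * (T b)^-1 * T a)%:E)%E.
  move=> a0 hb; have Tb := tail_gt0 hb.
  apply: int_piece_le.
  - by rewrite mulr_ge0// invr_ge0 ltW.
  - apply: measurable_funTS; apply: measurable_funM; first exact: measurable_wt.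
    exact: (minvT (g := id)).
  move=> s [/= + /I01P/andP[s0 s1]]; rewrite in_itv/= => /andP[_ sb].
  have Ts : 0 < T s by apply: tail_gt0; rewrite ltW.
  rewrite mulr_ge0 ?invr_ge0 ?(ltW Ts)//=; apply: ler_pM; rewrite ?invr_ge0 ?(ltW Ts)//.
    by apply: wt_incr => //; exact: ltW.
  by rewrite lef_pV2 ?posrE// tail_decr// ltW.
move: r; apply: (shrink_ind k1) => r hr hk; have Tr := tail_gt0 hr; have /andP[r0 r1] := hr.
  apply: le_trans (piece_bound 0 r _ hr) _ => //; rewrite lee_fin.
  rewrite -mulrA mulrC ler_wpM2r//; apply: le_trans A2d.
  rewrite mulrC ler_pdivrMr//; apply: le_trans (tail_double _) _; first by rewrite lexx ltr01.
  rewrite ler_pM2l//; apply: tail_decr.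
  rewrite /up subr0 div1r lerBrDl -lerBrDr -[leLHS]div1r ?div1r.
  by rewrite -(ler_pM2l k0) mulfV ?gt_eqF// ltW.
move=> ih; set r' := 1 - k * (1 - r) in ih *.
have kr0 : 0 < k * (1 - r) by rewrite mulr_gt0// subr_gt0.
have hr' : 0 <= r' < 1 by rewrite /r' subr_ge0 hk/= ltrBlDl ltrDr.
have ur : up r' = r by rewrite /up /r' subKr (mulrC k) mulfK ?gt_eqF// subKr.
have [_ _ r'r] := up01 hr'; rewrite ur in r'r.
have /andP[r'0 _] := hr'; have Tr' := tail_gt0 hr'.
have dj := piece_disj 0 r' r.
have m1 := mpiece 0 r'. have m2 := mpiece r' r.
have mU : measurable_fun (piece 0 r' `|` piece r' r) (fun s => (wt s * (T s)^-1)%:E).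
  apply/measurable_EFinP; apply: measurable_funTS; apply: measurable_funM; first exact: measurable_wt.
  exact: (minvT (g := id)).
have int0 s : (0 <= (wt s * (T s)^-1)%:E)%E by rewrite lee_fin mulr_ge0// invr_ge0 tail_ge0.
rewrite (piece_split r'0 r'r) ge0_integral_setU//.
apply: le_trans (leeD ih (piece_bound _ _ r'0 hr)) _; rewrite -EFinD lee_fin.
have h1 : wt r' <= (c^-1) `^ al * wt r.
  apply: wt_scale => //; first by rewrite invr_gt0.
  by rewrite ler_pdivlMl// -{1}ur; exact: tail_reverse.
have h2 : wt r * (T r)^-1 * T r' <= d * wt r.
  rewrite -mulrA mulrC ler_wpM2r// mulrC ler_pdivrMr//.
  by have := tail_double hr'; rewrite ur.
have A20 : 0 <= A2 by apply: le_trans A2d; exact: ltW.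
apply: le_trans (lerD (ler_wpM2l A20 h1) h2) _.
have -> : d = A2 * (1 - (c^-1) `^ al) by rewrite /A2 divfK// gt_eqF.
rewrite le_eqVlt; apply/orP; left; apply/eqP; ring.
Qed.

(** For s < r replace T(r s) by T(s), for s >= r by T(r): monotonicity of
    tails makes both replacements increase the integrand. *)
Theorem tail_test : exists2 A, 0 < A & forall r, 0 <= r < 1 ->
  (\int[mu]_(s in @I01 R) (wt s * (T (r * s))^-1)%:E <= (A * wt r)%:E)%E.
Proof.
have A20 : 0 < A2 by apply: lt_le_trans A2d.
have A10 : 0 <= A1 by rewrite divr_ge0 ?powR_ge0 ?(ltW A1den).
exists (A1 + A2); first by rewrite ltr_wpDl.
move=> r hr; have /andP[r0 r1] := hr; have Tr := tail_gt0 hr.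
have I01E : @I01 R = piece 0 1.
  apply/seteqP; split => x; last by case.
  by move=> Ix; split => //=; rewrite in_itv/=; case/I01P/andP: Ix => /ltW -> ->.
have mint A : measurable A -> measurable_fun A (fun s => (wt s * (T (r * s))^-1)%:E).
  move=> mA; apply/measurable_EFinP; apply: measurable_funTS; apply: measurable_funM; first exact: measurable_wt.
  by apply: minvT; exact: measurable_funM.
have int0 s : (0 <= (wt s * (T (r * s))^-1)%:E)%E by rewrite lee_fin mulr_ge0// invr_ge0 tail_ge0.
have dj := piece_disj 0 r 1.
have m1 := mpiece 0 r. have m2 := mpiece r 1.
have mU := mint _ (measurableU _ _ m1 m2).
rewrite I01E (piece_split r0 (ltW r1)) ge0_integral_setU//.
rewrite (addrC A1) mulrDl EFinD; apply: leeD.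
  apply: le_trans (wt_lower hr); apply: ge0_le_integral => //.
  - exact: mint.
  - apply/measurable_EFinP; apply: measurable_funTS; apply: measurable_funM; first exact: measurable_wt.
    exact: (minvT (g := id)).
  move=> s [_ /I01P/andP[s0 s1]]; rewrite lee_fin ler_wpM2l//.
  have rs : r * s <= s by rewrite ler_piMl// ltW.
  have Ts : 0 < T s by apply: tail_gt0; rewrite ltW.
  by rewrite lef_pV2 ?posrE ?tail_decr// (lt_le_trans Ts)// tail_decr.
apply: (@le_trans _ _ (\int[mu]_(s in piece r 1) ((T r)^-1%:E * (wt s)%:E))%E).
  apply: ge0_le_integral => //.
  - exact: mint.
  - by apply: emeasurable_funM => //; apply: mwt; exact: mpiece.
  move=> s [_ /I01P/andP[s0 s1]]; rewrite -EFinM lee_fin mulrC ler_wpM2r//.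
  have rs : r * s <= r by rewrite ler_piMr// ltW.
  by rewrite lef_pV2 ?posrE ?tail_decr// (lt_le_trans Tr)// tail_decr.
rewrite ge0_integralZl//; last 3 first.
- apply: mwt; exact: mpiece.
- by move=> s _; rewrite lee_fin.
- by rewrite lee_fin invr_ge0 ltW.
apply: le_trans (lee_wpmul2l _ (wt_upper hr)) _; first by rewrite lee_fin invr_ge0 ltW.
by rewrite -EFinM lee_fin mulrCA mulKf// gt_eqF.
Qed.

End tests.

(** * Schur's test *)

Section schur.
Context d (X : measurableType d) (R : realType) (m : {finite_measure set X -> \bar R}).
Variables (k : X * X -> R) (w : X -> R) (p q A : R).
Hypotheses (mk : measurable_fun setT k) (k0 : forall z, 0 <= k z).
Hypotheses (mw : measurable_fun setT w) (w0 : forall x, 0 < w x).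
Hypotheses (p0 : 0 < p) (q0 : 0 < q) (pq : p^-1 + q^-1 = 1) (A0 : 0 < A).
Hypothesis row : forall x, (\int[m]_y (k (x, y) * w y `^ (- q^-1))%:E <= (A * w x `^ (- q^-1))%:E)%E.
Hypothesis col : forall y, (\int[m]_x (k (x, y) * w x `^ (- p^-1))%:E <= (A * w y `^ (- p^-1))%:E)%E.
Variable f : X -> R.
Hypotheses (mf : measurable_fun setT f) (f0 : forall x, 0 <= f x).

Let mk1 x : measurable_fun setT (fun y => k (x, y)).
Proof. by apply: measurableT_comp mk _; exact: pair1_measurable. Qed.

Let mk2 y : measurable_fun setT (fun x => k (x, y)).
Proof. by apply: measurableT_comp mk _; exact: pair2_measurable. Qed.

Let mpow (g : X -> R) a : measurable_fun setT g -> measurable_fun setT (fun x => g x `^ a).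
Proof. by move=> mg; apply: (measurableT_comp (measurable_powR a)). Qed.

Let G x := (\int[m]_y (k (x, y) * f y)%:E)%E.
Let Y x := (\int[m]_y (k (x, y) * (w y `^ p^-1 * f y `^ q))%:E)%E.

Let qV0 : 0 < q^-1. Proof. by rewrite invr_gt0. Qed.
Let pV0 : 0 < p^-1. Proof. by rewrite invr_gt0. Qed.

Let G_ge0 x : (0 <= G x)%E.
Proof. by apply: integral_ge0 => y _; rewrite lee_fin mulr_ge0. Qed.

Let Y_ge0 x : (0 <= Y x)%E.
Proof. by apply: integral_ge0 => y _; rewrite lee_fin !mulr_ge0 ?powR_ge0. Qed.

(** Insert the test function w^(1/(pq)) and its inverse, and use the row
    bound for the factor without f. *)
Let hoelder_row x : (G x <= Y x `^ q^-1 * ((A * w x `^ (- q^-1)) `^ p^-1)%:E)%E.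
Proof.
pose u y := k (x, y) `^ q^-1 * (w y `^ (p^-1 * q^-1) * f y).
pose v y := k (x, y) `^ p^-1 * w y `^ (- (p^-1 * q^-1)).
have mu : measurable_fun setT u.
  apply: measurable_funM; first exact: mpow.
  by apply: measurable_funM => //; exact: mpow.
have mv : measurable_fun setT v by apply: measurable_funM; exact: mpow.
have u_ge0 y : 0 <= u y by rewrite /u !mulr_ge0 ?powR_ge0.
have v_ge0 y : 0 <= v y by rewrite /v !mulr_ge0 ?powR_ge0.
have h := hoelder m mu mv q0 p0; rewrite addrC in h; have {}h := h pq.
have E1 : ('N[m]_1[EFin \o (u \* v)%R] = G x)%E.
  rewrite Lnorm1; apply: eq_integral => y _ /=.
  rewrite (ger0_norm (mulr_ge0 (u_ge0 y) (v_ge0 y))); congr (_%:E).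
  rewrite /u /v mulrACA -powRD; last by rewrite addrC pq oner_eq0.
  rewrite addrC pq powRr1// -[w y `^ _ * f y]mulrC -mulrA -powRD.
    by rewrite subrr powRr0 mulr1.
  by rewrite (gt_eqF (w0 y)) implybT.
have E2 : ('N[m]_q%:E[EFin \o u] = Y x `^ q^-1)%E.
  rewrite unlock; congr (_ `^ _)%E; apply: eq_integral => y _ /=.
  rewrite ger0_norm//; congr (_%:E).
  rewrite /u !powRM ?mulr_ge0 ?powR_ge0// -!powRrM.
  by rewrite mulVf ?gt_eqF// powRr1// -mulrA mulVf ?gt_eqF// mulr1.
have E3 : ('N[m]_p%:E[EFin \o v] <= ((A * w x `^ (- q^-1)) `^ p^-1)%:E)%E.
  rewrite unlock -poweR_EFin; apply: gt0_ler_poweR.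
  - exact: ltW.
  - by rewrite in_itv/= leey andbT; apply: integral_ge0 => y _; rewrite /= ?poweR_EFin lee_fin powR_ge0.
  - by rewrite in_itv/= leey andbT lee_fin mulr_ge0 ?powR_ge0// ltW.
  apply: le_trans (row x); rewrite le_eqVlt; apply/orP; left; apply/eqP.
  apply: eq_integral => y _ /=; rewrite ger0_norm//; congr (_%:E).
  rewrite /v powRM ?powR_ge0// -!powRrM mulVf ?gt_eqF// powRr1//.
  by rewrite mulNr mulrAC mulVf ?gt_eqF// mul1r.
rewrite -E1; apply: le_trans h _; rewrite E2.
by apply: lee_wpmul2l => //; exact: poweR_ge0.
Qed.

Let V x := A `^ (q / p) * w x `^ (- p^-1).
Let W y := w y `^ p^-1 * f y `^ q.

Let V_ge0 x : 0 <= V x. Proof. by rewrite mulr_ge0 ?powR_ge0. Qed.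
Let W_ge0 x : 0 <= W x. Proof. by rewrite mulr_ge0 ?powR_ge0. Qed.
Let mV : measurable_fun setT V.
Proof. by apply: measurable_funM => //; exact: mpow. Qed.
Let mW : measurable_fun setT W.
Proof. by apply: measurable_funM; exact: mpow. Qed.

Let powq x : (G x `^ q <= Y x * (V x)%:E)%E.
Proof.
apply: (@le_trans _ _ ((Y x `^ q^-1 * ((A * w x `^ (- q^-1)) `^ p^-1)%:E) `^ q)%E).
  apply: gt0_ler_poweR; first exact: ltW.
  - by rewrite in_itv/= leey G_ge0.
  - by rewrite in_itv/= leey andbT mule_ge0 ?poweR_ge0// lee_fin powR_ge0.
  - exact: hoelder_row.
rewrite poweRM ?poweR_ge0 ?lee_fin ?powR_ge0// -poweRrM mulVf ?gt_eqF// poweRe1//.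
rewrite poweR_EFin lee_wpmul2l// lee_fin -powRrM powRM ?powR_ge0 ?(ltW A0)// -powRrM /V.
rewrite (mulrC p^-1) mulrA mulNr mulVf ?gt_eqF// mulN1r.
by rewrite lexx.
Qed.

(** Integrate the q-th power of [hoelder_row], exchange the integrals, and
    use the column bound. *)
Theorem schur : (\int[m]_x (\int[m]_y (k (x, y) * f y)%:E) `^ q <=
  (A `^ q)%:E * \int[m]_y (f y `^ q)%:E)%E.
Proof.
pose g (z : X * X) := (k z * W z.2 * V z.1)%:E.
have mg : measurable_fun setT g.
  apply/measurable_EFinP; apply: measurable_funM.
    by apply: measurable_funM => //; apply: measurableT_comp mW _; exact: measurable_snd.
  by apply: measurableT_comp mV _; exact: measurable_fst.
have g0 z : (0 <= g z)%E.
  by rewrite /g lee_fin; apply: mulr_ge0; [exact: mulr_ge0|exact: V_ge0].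
have mY : measurable_fun setT Y.
  apply: (measurable_fun_fubini_tonelli_F (fun z => (k z * W z.2)%:E)).
    apply/measurable_EFinP; apply: measurable_funM => //.
    by apply: measurableT_comp mW _; exact: measurable_snd.
  by move=> z; rewrite lee_fin mulr_ge0.
have mG : measurable_fun setT G.
  apply: (measurable_fun_fubini_tonelli_F (fun z => (k z * f z.2)%:E)).
    apply/measurable_EFinP; apply: measurable_funM => //.
    by apply: measurableT_comp mf _; exact: measurable_snd.
  by move=> z; rewrite lee_fin mulr_ge0.
apply: (@le_trans _ _ (\int[m]_x \int[m]_y g (x, y))%E).
  apply: ge0_le_integral.
  - exact: measurableT.
  - by move=> x _; exact: poweR_ge0.
  - exact: (measurableT_comp (measurable_poweR q) mG).
  - exact: measurable_fun_fubini_tonelli_F.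
  move=> x _; apply: le_trans (powq x) _; rewrite le_eqVlt; apply/orP; left; apply/eqP.
  rewrite -ge0_integralZr//.
  - by apply/measurable_EFinP; apply: measurable_funM.
  - by move=> y _; rewrite lee_fin; apply: mulr_ge0 => //; exact: W_ge0.
  - by rewrite lee_fin.
rewrite fubini_tonelli//.
rewrite -ge0_integralZl//; last 3 first.
- by apply/measurable_EFinP; exact: mpow.
- by move=> y _; rewrite lee_fin powR_ge0.
- by rewrite lee_fin powR_ge0.
apply: ge0_le_integral.
- exact: measurableT.
- by move=> y _; apply: integral_ge0.
- exact: measurable_fun_fubini_tonelli_G.
- by apply: emeasurable_funM => //; apply/measurable_EFinP; exact: mpow.
move=> y _.
have -> : (\int[m]_x g (x, y) = (W y * A `^ (q / p))%:E * \int[m]_x (k (x, y) * w x `^ (- p^-1))%:E)%E.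
  rewrite -ge0_integralZl//.
  - by apply: eq_integral => x _; rewrite /g /V -EFinM; congr (_%:E); rewrite /=; ring.
  - by apply/measurable_EFinP; apply: measurable_funM => //; exact: mpow.
  - by move=> x _; rewrite lee_fin mulr_ge0 ?powR_ge0.
  - by rewrite lee_fin mulr_ge0 ?powR_ge0.
apply: le_trans (lee_wpmul2l _ (col y)) _; first by rewrite lee_fin mulr_ge0 ?powR_ge0.
rewrite -!EFinM lee_fin le_eqVlt; apply/orP; left; apply/eqP.
have e1 : A `^ (q / p) * A = A `^ q.
  have p_1 : p^-1 = 1 - q^-1 by rewrite -pq addrK.
  rewrite -{2}[A]powRr1 ?(ltW A0)// -powRD; last by rewrite (gt_eqF A0) implybT.
  congr (_ `^ _); rewrite p_1 mulrBr mulr1 mulfV ?gt_eqF// subrK//.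
have e2 : w y `^ p^-1 * w y `^ (- p^-1) = 1.
  by rewrite -powRD ?subrr ?powRr0// (gt_eqF (w0 y)) implybT.
rewrite /W -e1 (_ : _ * _ * _ * _ = (w y `^ p^-1 * w y `^ (- p^-1)) * (A `^ (q / p) * A * f y `^ q)).
  by rewrite e2 mul1r.
ring.
Qed.

End schur.

(** * From the function hat to tails *)

Section tail_hat.
Context (R : realType).
Local Notation M := (measurableTypeR R).
Local Notation leb := (@lebesgue_measure R).
Variable nu : R[i] -> R.
Hypothesis rnu : radial_weight nu.
Local Notation mu := (rmeas rnu).
Local Notation T := (tail mu).
Let v (s : R) := nu (s%:C)%C.

Definition fhat r := fine (hat nu r).

Lemma hat_fin r : 0 <= r < 1 -> hat nu r = (fhat r)%:E.
Proof.
case: rnu => _ _ /[apply] /andP[h0 h1]; rewrite /fhat fineK//.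
by rewrite ge0_fin_numE// ltW.
Qed.

Lemma fhat_gt0 r : 0 <= r < 1 -> 0 < fhat r.
Proof. by move=> hr; have := hat_fin hr; case: rnu => _ _ /(_ r hr)/andP[+ _] => /[swap] ->; rewrite lte_fin. Qed.

Let sub01 r : 0 <= r -> (`]r, 1[%classic : set R) `<=` @I01 R.
Proof. by move=> r0 x; rewrite /I01 /= !in_itv/= => /andP[rx ->]; rewrite (le_lt_trans r0). Qed.

Lemma tail_integral r : 0 <= r -> (T r)%:E = (\int[leb]_(s in `]r, 1%R[) (rdens nu s)%:E)%E.
Proof.
move=> r0; rewrite /T /tail fineK; last first.
  apply: fin_num_measure; apply: measurableI; [exact: measurable_itv|exact: measurable_I01].
rewrite /rmeas /= /fdensity /density -setIA setIid.
have mr : measurable_fun (`]r, 1[%classic : set M) (fun s => (rdens nu s)%:E).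
  by apply/measurable_EFinP; apply: measurable_funS (measurable_rdens rnu) => //; [exact: measurable_I01|exact: sub01].
move: r0; rewrite le_eqVlt => /predU1P[r0|r0].
  congr integral; rewrite -r0; apply/seteqP; split => x; first by case.
  by move=> h; split => //; move: h; rewrite /I01 /= !in_itv/= => /andP[/ltW -> ->].
have -> : (`[r, 1[%classic `&` @I01 R)%classic = `[r, 1[%classic :> set M.
  apply/seteqP; split => x; first by case.
  by move=> h; split => //; move: h; rewrite /I01 /= !in_itv/= => /andP[h ->]; rewrite (lt_le_trans r0).
by rewrite -integral_itv_obnd_cbnd.
Qed.

Lemma tail_le_hat r : 0 <= r < 1 -> T r <= 2 * fhat r.
Proof.
move=> hr; have /andP[r0 r1] := hr.
rewrite -lee_fin tail_integral// EFinM -hat_fin// hatE//.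
have mv : measurable_fun (`]r, 1[%classic : set M) v.
  by apply: measurable_funS (measurable_v rnu); [exact: measurable_I01|exact: sub01].
have v0 s : `]r, 1[%classic s -> 0 <= v s by move=> /(sub01 r0)/(v_ge0 rnu).
rewrite -ge0_integralZl//; last exact/measurable_EFinP.
apply: ge0_le_integral => //.
- by move=> s /(sub01 r0)/(rdens_ge0 rnu); rewrite lee_fin.
- by apply/measurable_EFinP; apply: measurable_funS (measurable_rdens rnu) => //; [exact: measurable_I01|exact: sub01].
- by apply: emeasurable_funM => //; exact/measurable_EFinP.
move=> s hs; rewrite -EFinM lee_fin /rdens -mulrA ler_wpM2l// ler_piMl ?v0//.
by have := sub01 r0 hs => /I01P/andP[_ /ltW].
Qed.

Lemma hat_le_tail r : 2^-1 <= r -> r < 1 -> fhat r <= T r.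
Proof.
move=> rh r1; have r0 : 0 <= r by apply: le_trans rh; rewrite invr_ge0.
have hr : 0 <= r < 1 by rewrite r0.
rewrite -lee_fin tail_integral// -hat_fin// hatE//.
apply: ge0_le_integral => //.
- by move=> s /(sub01 r0)/(v_ge0 rnu); rewrite lee_fin.
- by apply/measurable_EFinP; apply: measurable_funS (measurable_v rnu) => //; [exact: measurable_I01|exact: sub01].
- by apply/measurable_EFinP; apply: measurable_funS (measurable_rdens rnu) => //; [exact: measurable_I01|exact: sub01].
move=> s hs; rewrite lee_fin /rdens.
rewrite -[leLHS]mul1r ler_wpM2r//; first by have := sub01 r0 hs => /(v_ge0 rnu).
move: hs; rewrite /= in_itv/= => /andP[rs _]; move: (le_lt_trans rh rs) => h; lra.
Qed.

Lemma fhat_decr r s : 0 <= r -> r <= s -> s < 1 -> fhat s <= fhat r.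
Proof.
move=> r0 rs s1; have hr : 0 <= r < 1 by rewrite r0 (le_lt_trans rs).
have hs : 0 <= s < 1 by rewrite (le_trans r0).
rewrite -lee_fin -!hat_fin// !hatE ?(le_trans r0)//.
apply: ge0_subset_integral => //.
- by apply/measurable_EFinP; apply: measurable_funS (measurable_v rnu) => //; [exact: measurable_I01|exact: sub01].
- by move=> x /(sub01 r0)/(v_ge0 rnu); rewrite lee_fin.
by move=> x /=; rewrite !in_itv/= => /andP[sx ->]; rewrite (le_lt_trans rs).
Qed.

Section classD.
Hypothesis hD : classD nu.

(** Tails and hat agree up to the factor 2 away from 0, and below 1/2 both
    are bounded and bounded away from 0. The factor 2 spoils the constant c >
    1 of the reverse inequality, so that one is iterated until its constant
    exceeds 4 C. *)
Lemma classD_tail : exists c0 k c d, [/\ 1 < c0, 1 < k, 1 < c & 1 <= d] /\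
  [/\ forall r, 0 <= r < 1 -> 0 < T r,
      forall r, 0 <= r < 1 -> T r <= c0 * T ((1 + r) / 2),
      forall r, 0 <= r < 1 -> c * T (1 - (1 - r) / k) <= T r &
      forall r, 0 <= r < 1 -> T r <= d * T (1 - (1 - r) / k)].
Proof.
case: hD => -[_ [C C1 hC]] [_ [K0 [c [K1 c1 hK]]]].
have C0 : 0 < C by exact: lt_trans ltr01 C1.
have up01 (x r : R) : 1 <= x -> 0 <= r < 1 -> 0 <= 1 - (1 - r) / x < 1.
  move=> x1 /andP[r0 r1]; have x0 : 0 < x by exact: lt_le_trans ltr01 x1.
  rewrite subr_ge0 ler_pdivrMr// mul1r ltrBlDl ltrDr divr_gt0 ?subr_gt0// andbT.
  by apply: le_trans x1; rewrite lerBlDl lerDr.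
have half01 (r : R) : 0 <= r < 1 -> 0 <= (1 + r) / 2 < 1.
  by move=> /andP[r0 r1]; apply/andP; split; lra.
have hC' (r : R) : 0 <= r < 1 -> fhat r <= C * fhat ((1 + r) / 2).
  by move=> hr; have := hC r hr; rewrite !hat_fin ?half01// -EFinM lee_fin.
have hK' (r : R) : 0 <= r < 1 -> c * fhat (1 - (1 - r) / K0) <= fhat r.
  by move=> hr; have := hK r hr; rewrite !hat_fin ?up01 ?(ltW K1)// -EFinM lee_fin.
have hatT (r : R) : 0 <= r < 1 -> fhat r <= C * T r.
  move=> /andP[r0 r1]; have [rh|rh] := leP 2^-1 r.
    apply: le_trans (hat_le_tail rh r1) _; by rewrite ler_peMl ?tail_ge0// ltW.
  apply: le_trans (fhat_decr (lexx _) r0 r1) _.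
  have h0 : 0 <= (0 : R) < 1 by rewrite lexx ltr01.
  apply: le_trans (hC' 0 h0) _; rewrite addr0 div1r ler_pM2l//.
  apply: le_trans (hat_le_tail _ _) _; rewrite ?lexx ?invf_lt1 ?ltr1n//.
  by apply: tail_decr; exact: ltW.
have Tpos (r : R) : 0 <= r < 1 -> 0 < T r.
  by move=> hr; have := lt_le_trans (fhat_gt0 hr) (hatT r hr); rewrite pmulr_rgt0.
have C2 : 1 < 2 * C ^+ 2 by have := C1; nra.
have dbl (r : R) : 0 <= r < 1 -> T r <= 2 * C ^+ 2 * T ((1 + r) / 2).
  move=> hr; apply: le_trans (tail_le_hat hr) _; rewrite -mulrA ler_pM2l//.
  apply: le_trans (hC' r hr) _; rewrite expr2 -mulrA ler_pM2l//; apply: hatT; exact: half01.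
have [m hm] := ex_pow_ge c1 (4 * C).
have K0m n : 1 <= K0 ^+ n by rewrite exprn_ege1// ltW.
have iterK n (r : R) : 0 <= r < 1 -> c ^+ n * fhat (1 - (1 - r) / K0 ^+ n) <= fhat r.
  elim: n r => [|n ih] r hr; first by rewrite !expr0 divr1 subKr mul1r.
  have hu := up01 _ _ (ltW K1) hr; have := ih _ hu; rewrite subKr -mulrA -invfM -exprS => h.
  have c0 : 0 < c by exact: lt_trans ltr01 c1.
  by apply: le_trans (hK' r hr); rewrite exprS -mulrA ler_pM2l.
have k1 : 1 < K0 ^+ m.+1 by rewrite exprn_egt1.
have [j hj] := ex_pow2_ge (K0 ^+ m.+1).
exists (2 * C ^+ 2), (K0 ^+ m.+1), 2, ((2 * C ^+ 2) ^+ j); split.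
  by split=> //; rewrite ?ltr1n// exprn_ege1// ltW.
split => // r hr.
  have hu := up01 _ _ (K0m m.+1) hr.
  have h1 := tail_le_hat hu. have h2 := iterK m.+1 r hr. have h3 := hatT r hr.
  have F0 := fhat_gt0 hu.
  have c4 : 4 * C <= c ^+ m.+1.
    by apply: le_trans hm _; rewrite exprS ler_peMl ?exprn_ge0// ltW// (lt_trans ltr01).
  have h4 := ler_wpM2r (ltW F0) c4.
  rewrite -(ler_pM2l C0); apply: le_trans h3.
  apply: le_trans (le_trans h4 h2); move: h1; set x := T _; set y := fhat _ => h1.
  have := ler_wpM2l (ltW C0) h1; lra.
have iter2 n (s : R) : 0 <= s < 1 -> T s <= (2 * C ^+ 2) ^+ n * T (1 - (1 - s) / 2 ^+ n).
  elim: n s => [|n ih] s hs; first by rewrite !expr0 divr1 subKr mul1r.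
  apply: le_trans (dbl s hs) _; have := ih _ (half01 s hs).
  have -> : 1 - (1 - (1 + s) / 2) / 2 ^+ n = 1 - (1 - s) / 2 ^+ n.+1.
    by rewrite exprS; field; rewrite expf_neq0.
  by move=> h; rewrite [(2 * C ^+ 2) ^+ n.+1]exprS -[leRHS]mulrA ler_pM2l// (lt_trans ltr01).
apply: le_trans (iter2 j r hr) _; rewrite ler_wpM2l ?exprn_ge0 ?(ltW (lt_trans ltr01 C2))//.
apply: tail_decr; rewrite lerD2l lerN2 ler_wpM2l//; first by case/andP: hr => _ /ltW; rewrite subr_ge0.
by rewrite lef_pV2 ?posrE ?exprn_gt0// (lt_trans ltr01 K1).
Qed.

End classD.
End tail_hat.

(** * Row integrals of the kernel *)

Section kernel_rows.
Context (R : realType).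
Local Notation C := R[i].
Local Notation M := (measurableTypeR R).
Variable nu : C -> R.
Hypothesis rnu : radial_weight nu.
Local Notation mu := (rmeas rnu).
Local Notation T := (tail mu).
Local Notation D := (@planar_disc R : set (M * M)).
Local Notation a := (kcoef mu).
Variables c0 k c d : R.
Hypotheses (c01 : 1 < c0) (k1 : 1 < k) (c1 : 1 < c) (d1 : 1 <= d).
Hypothesis tail_gt0 : forall r, 0 <= r < 1 -> 0 < T r.
Hypothesis tail_doubling : forall r, 0 <= r < 1 -> T r <= c0 * T ((1 + r) / 2).
Hypothesis tail_reverse : forall r, 0 <= r < 1 -> c * T (1 - (1 - r) / k) <= T r.
Hypothesis tail_double : forall r, 0 <= r < 1 -> T r <= d * T (1 - (1 - r) / k).

Lemma ge0_rmeas_integral (f : M -> \bar R) : measurable_fun [set: M] f -> (forall s, 0 <= f s)%E ->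
  (\int[mu]_s f s = \int[mu]_(s in @I01 R) f s)%E.
Proof.
move=> mf f0; rewrite (@ge0_negligible_integral _ _ _ mu setT (~` @I01 R))//.
- by rewrite setTD setCK.
- by have mI : measurable (@I01 R) := @measurable_I01 R; exact: measurableC.
- exact: rmeas_setC.
Qed.

Lemma cmeas_kser_circle (x : C) : modulus x < 1 -> cmeas [set: M] (fun t => kser rnu (x * ec t)).
Proof.
move=> x1; have := @cmeas_trig R (fun n => (a n)%:C%C * x ^+ n) (kser_summable tail_gt0 x1).
by apply: eq_cmeas => t _; rewrite /trig /kser /psum; congr csum; apply/funext => n; rewrite exprMn mulrA.
Qed.

Lemma kser_circle_integral (x : C) : modulus x < 1 ->
  (\int[@sigma R]_t (modulus (kser rnu (x * ec t)))%:E = (L1 mu x)%:E)%E.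
Proof.
move=> x1.
have mx t : modulus (x * ec t) = modulus x by rewrite modulusM modulus_ec mulr1.
have cm := cmeas_kser_circle x1.
have ci : cintble (@sigma R) setT (fun t => kser rnu (x * ec t)).
  apply: (cintble_bounded cm (c := limn (series (fun n => a n * modulus x ^+ n)))) => t.
  by apply: kser_bound; rewrite ?mx.
have := integrable_fin_num measurableT (integrable_modulus measurableT ci).
by move=> h; rewrite /L1 /Rintegral fineK.
Qed.

(** In polar coordinates the angular integral is a circular mean, at most A /
    T(|z| s) by [kser_L1]; the radial integral of this bound is [tail_test]. *)
Lemma row_bound al : 0 < al < 1 -> exists2 A, 0 < A & forall z : C, disc z ->
  (\int[@dA R]_(p in D) ((modulus (radial_kernel rnu z (of_plane p)) * wt mu al (modulus (of_plane p)))%:E *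
     (nu (of_plane p))%:E) <= (A * wt mu al (modulus z))%:E)%E.
Proof.
move=> /andP[al0 al1].
have [A0 A00 hA0] := kser_L1 tail_gt0 c01 tail_doubling k1 c1 tail_reverse.
have [A1 A10 hA1] := tail_test tail_gt0 k1 c1 d1 tail_reverse tail_double al0 al1.
exists (A0 * A1); first exact: mulr_gt0.
move=> z dz; have z0 := modulus_ge0 z.
have hz : 0 <= modulus z < 1 by rewrite z0.
have mD := @measurable_planar_disc R.
have mw : measurable_fun [set: M * M] (fun p => wt mu al (modulus (of_plane p))).
  exact: (measurableT_comp (measurable_wt _ _) (@measurable_modulus_of_plane R)).
pose f (p : M * M) := (modulus (radial_kernel rnu z (of_plane p)) * wt mu al (modulus (of_plane p)))%:E.
have f0 p : (0 <= f p)%E by rewrite lee_fin mulr_ge0 ?modulus_ge0 ?powR_ge0.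
have mf : measurable_fun D f.
  apply/measurable_EFinP; apply: measurable_funM.
    exact: (measurable_modulus (f := radial_kernel rnu z \o @of_plane R) (cmeas_radial_kernel tail_gt0 dz)).
  exact: measurable_funTS.
rewrite (disc_integral_polar rnu mf)//.
have mF : measurable_fun [set: M * M] (fun p => (f \_ D) (cpoint p)).
  apply: measurableT_comp; last exact: (@measurable_cpoint R).
  exact/(measurable_restrictT _ _).1.
have F0 p : (0 <= (f \_ D) (cpoint p))%E by rewrite patchE; case: ifPn.
rewrite fubini_tonelli1//.
rewrite ge0_rmeas_integral; last 2 first.
- exact: (measurable_fun_fubini_tonelli_F (fun p => (f \_ D) (cpoint p))).
- by move=> s; apply: integral_ge0.
have zs s : I01 s -> modulus (conjc z * s%:C%C) = modulus z * s.
  by move=> /I01P/andP[s0 _]; rewrite modulusM modulus_conj modulus_real gtr0_norm.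
have zs1 s : I01 s -> modulus z * s < 1.
  by move=> /I01P/andP[s0 s1]; rewrite (le_lt_trans _ dz)// ler_piMr// ltW.
have inner s : I01 s -> (fubini_F (@sigma R) (fun p => (f \_ D) (cpoint p)) s =
    (L1 mu (conjc z * s%:C%C) * wt mu al s)%:E)%E.
  move=> Is; have /I01P/andP[s0 s1] := Is.
  rewrite EFinM -kser_circle_integral ?zs ?zs1//.
  rewrite -ge0_integralZr//; last 3 first.
  - have x1 : modulus (conjc z * s%:C%C) < 1 by rewrite zs ?zs1.
    apply/measurable_EFinP; exact: (measurable_modulus (cmeas_kser_circle x1)).
  - by move=> t _; rewrite lee_fin modulus_ge0.
  - by rewrite lee_fin powR_ge0.
  apply: eq_integral => t _; rewrite patchE ifT; last by rewrite inE; exact: cpoint_disc.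
  have e1 : modulus (of_plane (cpoint (s, t))) = s by exact: (modulus_polar t (ltW s0)).
  have e2 : radial_kernel rnu z (of_plane (cpoint (s, t))) = kser rnu (conjc z * s%:C%C * ec t).
    by rewrite /radial_kernel cpointE mulrA.
  by rewrite /f e1 e2 EFinM.
apply: (@le_trans _ _ (\int[mu]_(s in @I01 R) (A0%:E * (wt mu al s * (T (modulus z * s))^-1)%:E))%E).
  have mwT : measurable_fun [set: M] (fun s => (wt mu al s * (T (modulus z * s))^-1)%:E).
    apply/measurable_EFinP; apply: measurable_funM; first exact: measurable_wt.
    have -> : (fun s => (T (modulus z * s))^-1) = (fun s => T (modulus z * s) `^ (-1)).
      by apply/funext => s; rewrite powR_inv1// tail_ge0.
    apply: (measurableT_comp (measurable_powR _)).
    apply: (@measurableT_comp _ _ _ _ _ _ T _ (fun s : M => modulus z * s)); last exact: measurable_funM.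
    by apply: nonincreasing_measurable => // s r; exact: tail_decr.
  apply: ge0_le_integral => //.
  - exact: measurable_I01.
  - by move=> s _; exact: integral_ge0.
  - apply: measurable_funTS; exact: (measurable_fun_fubini_tonelli_F (fun p => (f \_ D) (cpoint p))).
  - by apply: emeasurable_funM => //; exact: measurable_funTS.
  move=> s Is; rewrite inner// -EFinM lee_fin mulrA [A0 * _]mulrC -mulrA mulrC.
  have := hA0 (conjc z * s%:C%C); rewrite zs// => /(_ (zs1 _ Is)) h.
  by rewrite ler_wpM2l ?powR_ge0.
rewrite ge0_integralZl//; last 4 first.
- exact: measurable_I01.
- apply/measurable_EFinP; apply: measurable_funTS; apply: measurable_funM; first exact: measurable_wt.
  have -> : (fun s => (T (modulus z * s))^-1) = (fun s => T (modulus z * s) `^ (-1)).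
    by apply/funext => s; rewrite powR_inv1// tail_ge0.
  apply: (measurableT_comp (measurable_powR _)).
  apply: (@measurableT_comp _ _ _ _ _ _ T _ (fun s : M => modulus z * s)); last exact: measurable_funM.
  by apply: nonincreasing_measurable => // s r; exact: tail_decr.
- by move=> s _; rewrite lee_fin mulr_ge0 ?powR_ge0// invr_ge0 tail_ge0.
- by rewrite lee_fin ltW.
by rewrite -mulrA EFinM; apply: lee_wpmul2l; [rewrite lee_fin ltW|exact: hA1].
Qed.

End kernel_rows.

(** * Boundedness of the maximal projection *)

Section maximal_projection.
Context (R : realType).
Local Notation C := R[i].
Local Notation M := (measurableTypeR R).
Variable nu : C -> R.
Hypothesis rnu : radial_weight nu.
Local Notation mu := (rmeas rnu).
Local Notation T := (tail mu).
Local Notation D := (@planar_disc R : set (M * M)).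
Local Notation a := (kcoef mu).
Variables c0 k c d : R.
Hypotheses (c01 : 1 < c0) (k1 : 1 < k) (c1 : 1 < c) (d1 : 1 <= d).
Hypothesis tail_gt0 : forall r, 0 <= r < 1 -> 0 < T r.
Hypothesis tail_doubling : forall r, 0 <= r < 1 -> T r <= c0 * T ((1 + r) / 2).
Hypothesis tail_reverse : forall r, 0 <= r < 1 -> c * T (1 - (1 - r) / k) <= T r.
Hypothesis tail_double : forall r, 0 <= r < 1 -> T r <= d * T (1 - (1 - r) / k).

Fact nu_disc_ge0 (p : M * M) : D p -> 0 <= nu (of_plane p).
Proof. by case: rnu => -[h _] _ _; exact: h. Qed.

Let mD := @measurable_planar_disc R.
Let mDD : measurable (D `*` D). Proof. exact: measurableX. Qed.

Definition dnu : {finite_measure set (M * M)%type -> \bar R} :=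
  fdensity mD (integrable_nu rnu) nu_disc_ge0.

Lemma ge0_integral_dnu (f : M * M -> \bar R) : measurable_fun setT f -> (forall p, 0 <= f p)%E ->
  (\int[dnu]_p f p = \int[@dA R]_(p in D) (f p * (nu (of_plane p))%:E))%E.
Proof. by move=> mf f0; rewrite ge0_integral_density// setTI. Qed.

(** The modulus of the kernel, extended by zero so that measurability and
    Schur's test are stated on the whole plane. *)
Definition absK : (M * M) * (M * M) -> R :=
  (fun z => modulus (radial_kernel rnu (of_plane z.1) (of_plane z.2))) \_ (D `*` D).

(** The indicator makes the function positive on the whole plane, as Schur's
    test demands. *)
Definition schur_wt (x : M * M) : R := T (modulus (of_plane x)) + \1_(~` D) x.

Lemma absKE x y : D x -> D y -> absK (x, y) = modulus (radial_kernel rnu (of_plane x) (of_plane y)).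
Proof. by move=> Dx Dy; rewrite /absK patchE ifT// inE. Qed.

Lemma absK_out x y : ~ D x -> absK (x, y) = 0.
Proof. by move=> Dx; rewrite /absK patchE ifF//; apply/negbTE; rewrite notin_setE => -[]. Qed.

Lemma absK_ge0 z : 0 <= absK z.
Proof. by rewrite /absK patchE; case: ifPn => // _; exact: modulus_ge0. Qed.

Lemma absK_sym x y : absK (x, y) = absK (y, x).
Proof.
have [Dx|Dx] := pselect (D x); last first.
  rewrite absK_out//; rewrite /absK patchE ifF//; apply/negbTE; rewrite notin_setE => -[]//.
have [Dy|Dy] := pselect (D y); last first.
  rewrite [RHS]absK_out//; rewrite /absK patchE ifF//; apply/negbTE; rewrite notin_setE => -[]//.
have e := radial_kernel_sym tail_gt0 Dx Dy; rewrite (absKE Dx Dy) (absKE Dy Dx) -e; exact: modulus_conj.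
Qed.

Lemma measurable_absK : measurable_fun setT absK.
Proof.
apply/(measurable_restrictT _ _).1 => //.
apply: (@measurable_modulus _ _ _ (D `*` D)).
have m1 : cmeas (D `*` D) (fun z => of_plane z.1 : C).
  split; apply: measurable_funTS.
    by apply: measurableT_comp; [exact: measurable_fst|exact: measurable_fst].
  by apply: measurableT_comp; [exact: measurable_snd|exact: measurable_fst].
have m2 : cmeas (D `*` D) (fun z => of_plane z.2 : C).
  split; apply: measurable_funTS.
    by apply: measurableT_comp; [exact: measurable_fst|exact: measurable_snd].
  by apply: measurableT_comp; [exact: measurable_snd|exact: measurable_snd].
apply: (@cmeas_csum _ _ _ _ (fun n z => (a n)%:C%C * (conjc (of_plane z.1) * of_plane z.2) ^+ n)).
  move=> n; apply: cmeasM; first exact: cmeas_cst.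
  by apply: cmeasX; apply: cmeasM => //; apply: (cmeas_conj m1).
move=> z [D1 D2]; apply: kserP => //; apply: disc_mul => //; exact: ltW.
Qed.

Let disc01 x : D x -> 0 <= modulus (of_plane x) < 1.
Proof. by move=> Dx; rewrite modulus_ge0. Qed.

Lemma schur_wt_in x : D x -> schur_wt x = T (modulus (of_plane x)).
Proof. by move=> Dx; rewrite /schur_wt indicE memNset ?addr0. Qed.

Lemma schur_wt_gt0 x : 0 < schur_wt x.
Proof.
have [Dx|Dx] := pselect (D x); first by rewrite schur_wt_in ?tail_gt0 ?disc01.
by rewrite /schur_wt indicE mem_set// ltr_wpDl ?tail_ge0.
Qed.

Lemma measurable_schur_wt : measurable_fun setT schur_wt.
Proof.
apply: measurable_funD; last by apply: measurable_indic; exact: measurableC.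
apply: (@measurableT_comp _ _ _ _ _ _ T); last exact: (@measurable_modulus_of_plane R).
by apply: nonincreasing_measurable => // s r; exact: tail_decr.
Qed.

Let measurable_absK1 x : measurable_fun setT (fun y => absK (x, y)).
Proof. by apply: measurableT_comp measurable_absK _; exact: pair1_measurable. Qed.

Lemma schur_row al : 0 < al < 1 -> exists2 A, 0 < A & forall x,
  (\int[dnu]_y (absK (x, y) * schur_wt y `^ (- al))%:E <= (A * schur_wt x `^ (- al))%:E)%E.
Proof.
move=> hal.
have [A A0 hA] := row_bound c01 k1 c1 d1 tail_gt0 tail_doubling tail_reverse tail_double hal.
exists A => // x.
have [Dx|Dx] := pselect (D x); last first.
  under eq_integral do rewrite absK_out// mul0r.
  by rewrite integral0 lee_fin mulr_ge0 ?powR_ge0// ltW.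
rewrite ge0_integral_dnu.
- have -> : schur_wt x `^ (- al) = wt mu al (modulus (of_plane x)) by rewrite /wt (schur_wt_in Dx).
  apply: le_trans (hA _ Dx); rewrite le_eqVlt; apply/orP; left; apply/eqP.
  by apply: eq_integral => y /[!inE] Dy; rewrite (absKE Dx Dy) (schur_wt_in Dy).
- apply/measurable_EFinP; apply: measurable_funM => //.
  apply: (measurableT_comp (measurable_powR _)); exact: measurable_schur_wt.
- by move=> y; rewrite lee_fin mulr_ge0 ?powR_ge0 ?absK_ge0.
Qed.

Variable q : R.
Hypothesis q1 : 1 < q.

Let q0 : 0 < q. Proof. exact: lt_trans ltr01 q1. Qed.
Let qV : 0 < q^-1 < 1. Proof. by rewrite invr_gt0 q0 invf_lt1. Qed.

Lemma absK_schur : exists2 A, 0 < A & forall F : M * M -> R, measurable_fun setT F -> (forall x, 0 <= F x) ->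
  (\int[dnu]_x (\int[dnu]_y (absK (x, y) * F y)%:E) `^ q <= (A `^ q)%:E * \int[dnu]_y (F y `^ q)%:E)%E.
Proof.
have /andP[qV0 qV1] := qV.
pose p := (1 - q^-1)^-1.
have pV : p^-1 = 1 - q^-1 by rewrite invrK.
have hp : 0 < p^-1 < 1 by rewrite pV subr_gt0 qV1/= ltrBlDr ltrDl.
have p0 : 0 < p by rewrite -invr_gt0; case/andP: hp.
have [A A0 hA] := schur_row qV. have [B B0 hB] := schur_row hp.
exists (A + B); first exact: addr_gt0.
move=> F mF F0.
apply: (@schur _ _ _ dnu absK schur_wt p q (A + B)) => //.
- exact: measurable_absK.
- exact: absK_ge0.
- exact: measurable_schur_wt.
- exact: schur_wt_gt0.
- by rewrite pV subrK.
- exact: addr_gt0.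
- move=> x; apply: le_trans (hA x) _; rewrite lee_fin ler_wpM2r ?powR_ge0// lerDl ltW//.
- move=> y; under eq_integral do rewrite absK_sym.
  apply: le_trans (hB y) _; rewrite lee_fin ler_wpM2r ?powR_ge0// lerDr ltW//.
Qed.

Let BE z w : disc z -> disc w -> bergman_kernel nu z w = radial_kernel rnu z w.
Proof. exact: bergman_kernelE. Qed.

Lemma P_plus_cintble f z : Lq q nu f -> disc z ->
  cintble (@dA R) D (fun p => f (of_plane p) * P_plus_kernel nu z (of_plane p)).
Proof.
move=> hf dz.
have := @cintble_mul_bounded R nu rnu q f (fun w => (modulus (radial_kernel rnu z w))%:C%C)
  (limn (series (fun n => a n * modulus z ^+ n))) (ltW q1) hf.
have mg : cmeas D ((fun w => (modulus (radial_kernel rnu z w))%:C%C) \o @of_plane R).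
  apply: cmeas_real; exact: (measurable_modulus (f := radial_kernel rnu z \o @of_plane R) (cmeas_radial_kernel tail_gt0 dz)).
move=> /(_ mg) ci.
have hb w : disc w -> modulus (modulus (radial_kernel rnu z w))%:C%C <= limn (series (fun n => a n * modulus z ^+ n)).
  by move=> dw; rewrite modulus_real ger0_norm ?modulus_ge0//; exact: radial_kernel_bound.
apply: (eq_cintble mD _ (ci hb)) => p Dp.
by rewrite /P_plus_kernel (BE dz Dp) rmorphM/= mulrA.
Qed.

(** Split h in its positive and negative parts and apply Tonelli's theorem to
    each. *)
Lemma measurable_kernel_integral (h : M * M -> R) : measurable_fun D h ->
  measurable_fun D (fun x => Rintegral (@dA R) D (fun y => h y * (absK (x, y) * nu (of_plane y)))).
Proof.
move=> mh.
pose E (g : M * M -> R) x := (\int[dnu]_y (absK (x, y) * (g \_ D) y)%:E)%E.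
have mE (g : M * M -> R) : measurable_fun D g -> (forall y, 0 <= g y) -> measurable_fun setT (E g).
  move=> mg g0.
  apply: (measurable_fun_fubini_tonelli_F (fun z => (absK z * (g \_ D) z.2)%:E)).
    apply/measurable_EFinP; apply: measurable_funM; first exact: measurable_absK.
    by apply: (@measurableT_comp _ _ _ _ _ _ (g \_ D)); [exact/(measurable_restrictT _ _).1|exact: measurable_snd].
  by move=> z; rewrite lee_fin mulr_ge0 ?absK_ge0// patchE; case: ifP.
have EE (g : M * M -> R) x : measurable_fun D g -> (forall y, 0 <= g y) ->
    (\int[@dA R]_(y in D) (g y * (absK (x, y) * nu (of_plane y)))%:E = E g x)%E.
  move=> mg g0; rewrite /E ge0_integral_dnu; last 2 first.
  - apply/measurable_EFinP; apply: measurable_funM; first exact: measurable_absK1.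
    exact/(measurable_restrictT _ _).1.
  - by move=> y; rewrite lee_fin mulr_ge0 ?absK_ge0// patchE; case: ifP.
  apply: eq_integral => y Dy; rewrite patchE Dy -EFinM; congr (_%:E); rewrite mulrA; congr (_ * _); exact: mulrC.
pose hp y := Num.max (h y) 0. pose hn y := Num.max (- h y) 0.
have mhp : measurable_fun D hp by apply: measurable_maxr.
have mhn : measurable_fun D hn by apply: measurable_maxr => //; exact: measurable_funN.
have hp0 y : 0 <= hp y by rewrite le_max lexx orbT.
have hn0 y : 0 <= hn y by rewrite le_max lexx orbT.
rewrite (_ : (fun x => _) = (fun x => fine (E hp x - E hn x)%E)); last first.
  apply/funext => x; rewrite /Rintegral integralE -!EE//; congr (fine (_ - _)%E).
    apply: eq_integral => y /[!inE] Dy; rewrite funeposE -[0%E]/(0%:E) -EFin_max.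
    by rewrite maxr_pMl ?mul0r ?mulr_ge0 ?absK_ge0 ?nu_disc_ge0.
  apply: eq_integral => y /[!inE] Dy; rewrite funenegE -[0%E]/(0%:E) -EFinN -EFin_max.
  by rewrite maxr_pMl ?mul0r ?mulNr ?mulr_ge0 ?absK_ge0 ?nu_disc_ge0.
apply: measurable_funTS; apply: measurableT_comp; first exact: fine_measurable.
by apply: emeasurable_funB; exact: mE.
Qed.

Lemma P_plus_measurable f : Lq q nu f -> measurable_on_disc (kernel_operator (P_plus_kernel nu) f).
Proof.
move=> [[m1 m2] _].
have Rr (z : C) x : complex.Re (z * x%:C%C) = complex.Re z * x by case: z => u v /=; ring.
have Ir (z : C) x : complex.Im (z * x%:C%C) = complex.Im z * x by case: z => u v /=; ring.
split.
- apply: eq_measurable_fun (measurable_kernel_integral m1) => x /[!inE] Dx.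
  rewrite /kernel_operator /disc_integral /=; apply: eq_Rintegral => y /[!inE] Dy.
  by rewrite /P_plus_kernel BE// Rr absKE.
- apply: eq_measurable_fun (measurable_kernel_integral m2) => x /[!inE] Dx.
  rewrite /kernel_operator /disc_integral /=; apply: eq_Rintegral => y /[!inE] Dy.
  by rewrite /P_plus_kernel BE// Ir absKE.
Qed.

Lemma P_plus_pointwise f x : Lq q nu f -> D x ->
  ((modulus (kernel_operator (P_plus_kernel nu) f (of_plane x)))%:E <=
   \int[dnu]_y (absK (x, y) * ((fun y => modulus (f (of_plane y))) \_ D) y)%:E)%E.
Proof.
move=> hf Dx; have ci := P_plus_cintble hf Dx.
have mf : measurable_fun D (fun y : M * M => modulus (f (of_plane y))).
  by apply: (measurable_modulus (f := f \o @of_plane R)); case: hf.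
rewrite ge0_integral_dnu; last 2 first.
- apply/measurable_EFinP; apply: measurable_funM; first exact: measurable_absK1.
  exact/(measurable_restrictT _ _).1.
- by move=> y; rewrite lee_fin mulr_ge0 ?absK_ge0// patchE; case: ifP => // _; exact: modulus_ge0.
apply: (@le_trans _ _ (Rintegral (@dA R) D (fun y => modulus (f (of_plane y) * P_plus_kernel nu (of_plane x) (of_plane y))))%:E).
  rewrite lee_fin; exact: (modulus_cint mD ci).
have im := integrable_fin_num mD (integrable_modulus mD ci).
rewrite /Rintegral fineK// le_eqVlt; apply/orP; left; apply/eqP.
apply: eq_integral => y /[!inE] Dy; rewrite patchE mem_set// -EFinM; congr (_%:E).
have n0 := nu_disc_ge0 Dy; have k0 := absK_ge0 (x, y).
rewrite modulusM /P_plus_kernel BE// modulus_real -absKE// ger0_norm ?mulr_ge0//.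
rewrite mulrA; congr (_ * _); exact: mulrC.
Qed.

(** The modulus of the operator applied to f is at most the positive operator
    with kernel [absK] applied to |f|, to which [absK_schur] applies. *)
Theorem P_plus_bounded : bounded_on_Lq q nu (P_plus_kernel nu).
Proof.
have [A A0 hA] := absK_schur; exists A; [exact: A0|move=> f hf].
pose P := kernel_operator (P_plus_kernel nu) f.
pose F := (fun y => modulus (f (of_plane y))) \_ D.
pose G x := (\int[dnu]_y (absK (x, y) * F y)%:E)%E.
have mf : measurable_fun D (fun y : M * M => modulus (f (of_plane y))).
  by apply: (measurable_modulus (f := f \o @of_plane R)); case: hf.
have mF : measurable_fun setT F by exact/(measurable_restrictT _ _).1.
have F0 y : 0 <= F y by rewrite /F patchE; case: ifP => // _; exact: modulus_ge0.
have mP := P_plus_measurable hf.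
have mmP : measurable_fun D (fun y : M * M => modulus (P (of_plane y))).
  by apply: (measurable_modulus (f := P \o @of_plane R)); case: mP.
have G0 x : (0 <= G x)%E by apply: integral_ge0 => y _; rewrite lee_fin mulr_ge0 ?absK_ge0.
have mG : measurable_fun setT (fun x => G x `^ q)%E.
  apply: (measurableT_comp (measurable_poweR q)).
  apply: (measurable_fun_fubini_tonelli_F (fun z => (absK z * F z.2)%:E)).
    apply/measurable_EFinP; apply: measurable_funM; first exact: measurable_absK.
    by apply: (@measurableT_comp _ _ _ _ _ _ F); [exact: mF|exact: measurable_snd].
  by move=> z; rewrite lee_fin mulr_ge0 ?absK_ge0.
pose N := (\int[@dA R]_(p in D) (modulus (f (of_plane p)) `^ q * nu (of_plane p))%:E)%E.
have N0 : (0 <= N)%E by apply: integral_ge0 => p Dp; rewrite lee_fin mulr_ge0 ?powR_ge0 ?nu_disc_ge0.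
have FN : (\int[dnu]_y (F y `^ q)%:E = N)%E.
  rewrite ge0_integral_dnu.
  - by apply: eq_integral => y Dy; rewrite /F patchE Dy EFinM.
  - by apply/measurable_EFinP; apply: (measurableT_comp (measurable_powR q)).
  - by move=> y; rewrite lee_fin powR_ge0.
have key : (\int[@dA R]_(p in D) (modulus (P (of_plane p)) `^ q * nu (of_plane p))%:E <= (A `^ q)%:E * N)%E.
  rewrite -FN; apply: le_trans (hA F mF F0); rewrite -/G ge0_integral_dnu//; last by move=> p; exact: poweR_ge0.
  apply: ge0_le_integral => //.
  - by move=> p Dp; rewrite lee_fin mulr_ge0 ?powR_ge0 ?nu_disc_ge0.
  - apply/measurable_EFinP; apply: measurable_funM; last exact: measurable_nu.
    exact: (measurableT_comp (measurable_powR q)).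
  - apply: emeasurable_funM; first exact: measurable_funTS.
    by apply/measurable_EFinP; exact: measurable_nu.
  move=> p Dp; rewrite EFinM lee_wpmul2r ?lee_fin ?nu_disc_ge0// -poweR_EFin.
  apply: gt0_ler_poweR; rewrite ?in_itv/= ?leey ?andbT ?lee_fin ?modulus_ge0 ?(ltW q0)//.
    exact: G0.
  exact: P_plus_pointwise.
have norm : (Lq_norm q nu P <= A%:E * Lq_norm q nu f)%E.
  have -> : (A%:E * Lq_norm q nu f = ((A `^ q)%:E * N) `^ q^-1)%E.
    rewrite poweRM// ?lee_fin ?powR_ge0// poweR_EFin -powRrM mulfV ?gt_eqF// powRr1 ?(ltW A0)//.
  apply: gt0_ler_poweR; last exact: key; rewrite ?in_itv/= ?leey ?andbT ?invr_ge0; first exact: ltW.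
    by apply: integral_ge0 => p Dp; rewrite lee_fin mulr_ge0 ?powR_ge0 ?nu_disc_ge0.
  by rewrite mule_ge0// lee_fin powR_ge0.
split.
- by move=> z dz; exact: P_plus_cintble.
- split; first exact: mP.
  apply: le_lt_trans norm _; rewrite lte_mul_pinfty ?lee_fin ?(ltW A0)//.
  by case: hf.
- exact: norm.
Qed.

End maximal_projection.

Theorem classD_bounded (R : realType) (q : R) (nu : R[i] -> R) : 1 < q -> classD nu ->
  bounded_on_Lq q nu (P_plus_kernel nu).
Proof.
move=> q1 hD; have rnu : radial_weight nu by case: hD => -[].
have [c0 [k [c [d [[h1 h2 h3 h4] [h5 h6 h7 h8]]]]]] := classD_tail rnu hD.
exact: (P_plus_bounded h1 h2 h3 h4 h5 h6 h7 h8 q1).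
Qed.

(** * Lower bounds for the standard kernel *)

Section kernel_lower_bound.
Context (R : realType).
Local Notation C := R[i].

(** The assumption says that the angle acos x is at most 1 / a; then a times
    it is at most 1, and cos decreases on [0, pi]. *)
Lemma le_cos_acos (a x : R) : 1 <= a -> cos a^-1 <= x -> x <= 1 -> cos 1 <= cos (a * acos x).
Proof.
move=> a1 cx x1; have a0 : 0 < a by exact: lt_le_trans ltr01 a1.
have pi2 := @pi_ge2 R.
have aV0 : 0 <= a^-1 by rewrite invr_ge0 ltW.
have aV1 : a^-1 <= 1 by rewrite invf_le1.
have x_1 : -1 <= x <= 1.
  rewrite x1 andbT (le_trans _ cx)// (@le_trans _ _ 0)// ?lerN10//.
  have := @pihalf_ge1 R => h; apply: cos_ge0_pihalf; apply/andP; split; lra.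
have p0 := acos_ge0 x_1. have ppi := acos_lepi x_1.
have cpi : cos (acos x) = x by case: (acos_def x_1).
have le1 : acos x <= a^-1.
  rewrite leNgt; apply/negP => h.
  have : cos (acos x) < cos a^-1.
    rewrite ltr_cos// in_itv/= ?p0 ?ppi// aV0/=; apply: le_trans aV1 _; lra.
  by rewrite cpi ltNge cx.
have ap0 : 0 <= a * acos x by rewrite mulr_ge0// ltW.
have ap1 : a * acos x <= 1 by rewrite -ler_pdivlMl// mulr1.
have [->//|ne] := eqVneq (a * acos x) 1.
have lt1 : a * acos x < 1 by rewrite lt_neqAle ne.
apply: ltW; rewrite ltr_cos// in_itv/= ?ap0 ?ler01//=; lra.
Qed.

(** If the argument of b is at most 1 / a, then that of b^a is at most 1, so
    b^-a stays in a fixed sector around the positive axis. *)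
Lemma Re_inv_Cpow (a : R) (b : C) : 1 <= a -> b != 0 -> cos a^-1 * modulus b <= complex.Re b ->
  cos 1 / modulus b `^ a <= complex.Re (Cpow b a)^-1.
Proof.
move=> a1 b0 hb; have m0 : 0 < modulus b by rewrite modulus_gt0.
set x := complex.Re b / modulus b.
have x1 : x <= 1.
  by rewrite ler_pdivrMr// mul1r (le_trans (ler_norm _))// Re_modulus.
have cx : cos a^-1 <= x by rewrite ler_pdivlMr.
have h := le_cos_acos a1 cx x1.
have e : cos (a * Carg b) = cos (a * acos x) by rewrite /Carg; case: ifP => // _; rewrite mulrN cosN.
have mp : 0 < modulus b `^ a by rewrite powR_gt0.
have -> : complex.Re (Cpow b a)^-1 = cos (a * Carg b) / modulus b `^ a.
  rewrite /Cpow; set t := a * Carg b; set m := modulus b `^ a in mp *.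
  have -> : (m%:C * (cos t +i* sin t))^-1%C = ((m^-1 * cos t) +i* (- (m^-1 * sin t)))%C.
    apply: (mulfI (_ : (m%:C * (cos t +i* sin t))%C != 0)).
      rewrite mulf_neq0//; apply/eqP => -[]; first by move/eqP; rewrite gt_eqF.
      move=> c0 s0; have := cos2Dsin2 t; rewrite c0 s0 expr0n/= addr0 => /eqP.
      by rewrite eq_sym oner_eq0.
    rewrite mulfV; last first.
      rewrite mulf_neq0//; apply/eqP => -[]; first by move/eqP; rewrite gt_eqF.
      move=> c0 s0; have := cos2Dsin2 t; rewrite c0 s0 expr0n/= addr0 => /eqP.
      by rewrite eq_sym oner_eq0.
    have d1 : m != 0 by rewrite gt_eqF.
    apply: complex_eqP => /=; last by field.
    by have := cos2Dsin2 t; rewrite !expr2 => <-; field.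
  by rewrite /= mulrC.
by rewrite e ler_pM2r ?invr_gt0.
Qed.

Definition sector (ka s1 s2 : R) : set C :=
  [set z | s1 <= modulus z < s2 /\ `|complex.Im z| <= ka * complex.Re z].

(** The product z conj(w) is almost positive, so 1 - z conj(w) is within 4 ka
    of 1 - |z| |w|, which lies between d / 4 and 3 d / 2. *)
Lemma sector_kernel_base (ka d : R) (z w : C) : 0 < ka -> ka <= d / 4 -> d <= 1 ->
  sector ka (1 - d) 1 z -> sector ka (1 - d / 2) (1 - d / 4) w ->
  let b := 1 - z * conjc w in
  [/\ d / 4 <= complex.Re b, `|complex.Im b| <= 2 * ka & modulus b <= 3 * d].
Proof.
move=> ka0 kad d1 [/andP[zl zu] zi] [/andP[wl wu] wi] b.
have x0 : 0 <= complex.Re z by rewrite -(pmulr_rge0 _ ka0) (le_trans _ zi).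
have u0 : 0 <= complex.Re w by rewrite -(pmulr_rge0 _ ka0) (le_trans _ wi).
have xz : complex.Re z <= 1 by rewrite (le_trans (ler_norm _))// (le_trans (Re_modulus z))// ltW.
have uw : complex.Re w <= 1.
  rewrite (le_trans (ler_norm _))// (le_trans (Re_modulus w))// ltW// (lt_trans wu)//; lra.
have mE : modulus (z * conjc w) = modulus z * modulus w by rewrite modulusM modulus_conj.
have z0 := modulus_ge0 z. have w0 := modulus_ge0 w.
have Rp : complex.Re (z * conjc w) = complex.Re z * complex.Re w + complex.Im z * complex.Im w.
  by case: (z) (w) => [p1 p2] [p3 p4] /=; ring.
have Ip : complex.Im (z * conjc w) = complex.Im z * complex.Re w - complex.Re z * complex.Im w.
  by case: (z) (w) => [p1 p2] [p3 p4] /=; ring.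
have Rb : complex.Re b = 1 - complex.Re (z * conjc w) by rewrite /b ReD ReN.
have Ib : complex.Im b = - complex.Im (z * conjc w) by rewrite /b ImD ImN add0r.
have hR := le_trans (ler_norm _) (Re_modulus (z * conjc w)); rewrite mE in hR.
have mb := modulus_ReIm b. have mzw := modulus_ReIm (z * conjc w).
rewrite mE in mzw.
move: mb mzw hR zl zu zi wl wu wi x0 u0 xz uw z0 w0; rewrite Rb Ib normrN Rp Ip.
move: (modulus z) (modulus w) (modulus b) (complex.Re z) (complex.Im z) (complex.Re w) (complex.Im w).
move=> mz mw mb x y u v h1 h2 h3 zl zu zi wl wu wi x0 u0 x1 u1 z0 w0.
have zw : mz * mw <= mw by rewrite ler_piMl// ltW.
have I1 : `|y * u - x * v| <= 2 * ka.
  have xu : x * u <= 1 by rewrite mulr_ile1.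
  have e1 : `|y| * u <= ka * x * u by rewrite ler_wpM2r.
  have e2 : x * `|v| <= x * (ka * u) by rewrite ler_wpM2l.
  have e3 : ka * (x * u) <= ka by rewrite ger_pMr.
  apply: le_trans (ler_normB _ _) _; rewrite !normrM (ger0_norm u0) (ger0_norm x0); lra.
have P0 : 0 <= x * u + y * v.
  have e1 : `|y * v| <= (ka * x) * (ka * u) by rewrite normrM ler_pM.
  have xu : 0 <= x * u by rewrite mulr_ge0.
  have k2 : ka * ka <= 1 by rewrite mulr_ile1 ?(ltW ka0)//; lra.
  have e3 : (ka * ka) * (x * u) <= x * u by rewrite ler_piMl.
  have := ler_norm (- (y * v)); rewrite normrN; lra.
have R1 : d / 4 <= 1 - (x * u + y * v) by lra.
split=> //.
rewrite (ger0_norm P0) in h2; rewrite ger0_norm in h1; last by lra.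
have low : (1 - d) * (1 - d / 2) <= mz * mw by rewrite ler_pM// subr_ge0; lra.
have dd : 0 <= d * d by exact: sqr_ge0.
lra.
Qed.

End kernel_lower_bound.

(** * Sectors and the standard kernel on them *)

Section sector_measure.
Context (R : realType).
Local Notation C := R[i].
Local Notation M := (measurableTypeR R).
Local Notation leb := (@lebesgue_measure R).
Local Notation D := (@planar_disc R : set (M * M)).

Definition psector (ka s1 s2 : R) : set (M * M) := @of_plane R @^-1` sector ka s1 s2.

Definition aperture (ka : R) : set M := [set t | `|sin t| <= ka * cos t].

Let mcos : measurable_fun [set: M] (@cos R).
Proof. apply: continuous_measurable_fun; exact: continuous_cos. Qed.
Let msin : measurable_fun [set: M] (@sin R).
Proof. apply: continuous_measurable_fun; exact: continuous_sin. Qed.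

Lemma measurable_psector ka s1 s2 : measurable (psector ka s1 s2).
Proof.
have -> : psector ka s1 s2 = (fun p : M * M => modulus (of_plane p)) @^-1` `[s1, s2[ `&`
    (fun p : M * M => ka * p.1 - `|p.2|) @^-1` `[0, +oo[.
  apply/seteqP; split => p /=; rewrite !in_itv/= andbT subr_ge0; by case.
apply: measurableI; rewrite -[X in measurable X]setTI.
  exact: (@measurable_modulus_of_plane R).
suff : measurable_fun [set: M * M] (fun p : M * M => ka * p.1 - `|p.2|) by apply.
apply: measurable_funB; first by apply: measurable_funM => //; exact: measurable_fst.
by apply: measurableT_comp => //; exact: measurable_snd.
Qed.

Lemma measurable_aperture ka : measurable (aperture ka).
Proof.
have -> : aperture ka = (fun t : M => ka * cos t - `|sin t|) @^-1` `[0, +oo[.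
  by apply/seteqP; split => t /=; rewrite !in_itv/= andbT subr_ge0.
rewrite -[X in measurable X]setTI.
suff : measurable_fun [set: M] (fun t : M => ka * cos t - `|sin t|) by apply.
by apply: measurable_funB; [exact: measurable_funM|exact: measurableT_comp].
Qed.

(** The interval [0, atan ka] belongs to the aperture. *)
Lemma sigma_aperture_gt0 ka : 0 < ka -> (0 < @sigma R (aperture ka))%E.
Proof.
move=> ka0; have pi0 := @pi_gt0 R.
have h0 : 0 < atan ka by rewrite -(@atan0 R) lt_atan.
have h1 := @atan_ltpi2 R ka.
have ch (t : R) : 0 <= t <= atan ka -> 0 < cos t.
  by move=> /andP[t0 t1]; apply: cos_gt0_pihalf; apply/andP; split; lra.
have sub : `[0, atan ka]%classic `<=` aperture ka.
  move=> t /=; rewrite in_itv/= => ht; have /andP[t0 t1] := ht.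
  have c1 : 0 < cos (atan ka) by apply: ch; rewrite lexx ltW.
  have s0 : 0 <= sin t by apply: sin_ge0_pi; apply/andP; split; lra.
  have s1 : 0 <= sin (atan ka - t) by apply: sin_ge0_pi; apply/andP; split; lra.
  rewrite /aperture /= ger0_norm// -(ler_pM2l c1); move: s1; rewrite sinB subr_ge0 => s1.
  apply: le_trans s1 _.
  have -> : sin (atan ka) = ka * cos (atan ka).
    by rewrite -{2}(atanK ka) /tan divfK// gt_eqF.
  by rewrite le_eqVlt; apply/orP; left; apply/eqP; ring.
have mI : measurable (`[0, atan ka]%classic : set M) by exact: measurable_itv.
have := le_measure (@sigma R) _ _ sub; rewrite !inE => /(_ mI (measurable_aperture ka)).
apply: lt_le_trans.
rewrite /sigma /= /fdensity /density.
have -> : (`[0, atan ka] `&` @circ R)%classic = `[0, atan ka]%classic :> set M.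
  apply/seteqP; split => t; first by case.
  by move=> h; split=> //; move: h; rewrite /circ /= !in_itv/= => /andP[t0 t1]; apply/andP; split; lra.
rewrite (integral_cst _ mI (2 * pi)^-1%:E).
rewrite [X in (_ * X)%E]lebesgue_measure_itv/= lte_fin h0 -EFinB subr0 -EFinM lte_fin.
by rewrite mulr_gt0// invr_gt0 mulr_gt0.
Qed.

(** The sector contains a rectangle of sides d / 8 and ka / 2. *)
Lemma dA_psector (ka d : R) : 0 < ka -> ka <= d / 8 -> d <= 1 ->
  ((d * ka / (16 * pi))%:E <= @dA R (psector ka (1 - d / 2) (1 - d / 4)))%E.
Proof.
move=> ka0 kad d1; have pi0 := @pi_gt0 R.
pose X : set M := `[1 - d / 2, 1 - 3 * d / 8]%classic. pose Y : set M := `[0, ka / 2]%classic.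
have mX : measurable X by exact: measurable_itv.
have mY : measurable Y by exact: measurable_itv.
have sub : X `*` Y `<=` psector ka (1 - d / 2) (1 - d / 4).
  move=> [x y] [] /=; rewrite /X /Y /= !in_itv/= => /andP[x1 x2] /andP[y1 y2].
  have x0 : 0 <= x by lra.
  have l := ler_norm x. have := Re_modulus (of_plane (x, y)); rewrite /= => h1.
  have := modulus_ReIm (of_plane (x, y)); rewrite /= (ger0_norm x0) (ger0_norm y1) => h2.
  split=> /=; first by apply/andP; split; lra.
  rewrite ger0_norm//; apply: le_trans y2 _; rewrite ler_pM2l//; lra.
have mXY : measurable (X `*` Y) by exact: measurableX.
have := le_measure (@dA R) _ _ sub; rewrite !inE => /(_ mXY (measurable_psector _ _ _)).
have e : (@dA R (X `*` Y) = (pi^-1)%:E * (leb X * leb Y))%E.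
  by rewrite -(product_measure1E leb leb mX mY).
move=> h; apply: le_trans h; apply: (@le_trans _ _ ((pi^-1)%:E * (leb X * leb Y))%E); last by rewrite -e.
rewrite [leb X]lebesgue_measure_itv/= [leb Y]lebesgue_measure_itv/= !lte_fin.
rewrite ifT; last by lra.
rewrite ifT; last by lra.
rewrite -!EFinB -!EFinM lee_fin le_eqVlt; apply/orP; left; apply/eqP.
by rewrite invfM; move: (pi^-1 : R) => y; field.
Qed.

Variable nu : C -> R.
Hypothesis rnu : radial_weight nu.
Local Notation mu := (rmeas rnu).

Lemma integral_psector (ka s1 s2 : R) : 
  (\int[@dA R]_(p in D) ((\1_(psector ka s1 s2) p)%:E * (nu (of_plane p))%:E) =
   @sigma R (aperture ka) * mu (`[s1, s2[%classic `&` @I01 R))%E.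
Proof.
have mS := measurable_psector ka s1 s2. have mA := measurable_aperture ka.
have mI := @measurable_I01 R.
have ms : measurable (`[s1, s2[%classic : set M) by exact: measurable_itv.
pose f (p : M * M) : \bar R := (\1_(psector ka s1 s2) p)%:E.
have mf : measurable_fun D f.
  by apply/measurable_EFinP; apply: measurable_funTS; exact: measurable_indic.
rewrite (disc_integral_polar rnu mf); last by move=> p _; rewrite lee_fin.
have mF : measurable_fun [set: M * M] (fun p => (f \_ D) (cpoint p)).
  apply: measurableT_comp; last exact: (@measurable_cpoint R).
  by apply/(measurable_restrictT _ _).1 => //; exact: measurable_planar_disc.
have F0 p : (0 <= (f \_ D) (cpoint p))%E by rewrite patchE; case: ifPn => // _; rewrite lee_fin.
rewrite fubini_tonelli1//.
rewrite ge0_rmeas_integral; last 2 first.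
- exact: (measurable_fun_fubini_tonelli_F (fun p => (f \_ D) (cpoint p))).
- by move=> s; apply: integral_ge0.
rewrite (_ : mu _ = \int[mu]_(s in @I01 R) (\1_`[s1, s2[ s)%:E)%E; last by rewrite integral_indic.
rewrite -ge0_integralZl//; last by apply/measurable_EFinP; apply: measurable_funTS; exact: measurable_indic.
apply: eq_integral => s /[!inE] Is; have /I01P/andP[s0 s1'] := Is.
have -> : (@sigma R (aperture ka) = \int[@sigma R]_t (\1_(aperture ka) t)%:E)%E by rewrite integral_indic// setIT.
rewrite -ge0_integralZr//; last by apply/measurable_EFinP; exact: measurable_indic.
apply: eq_integral => t _; rewrite patchE ifT; last by rewrite inE; exact: cpoint_disc.
rewrite /f -EFinM; congr (_%:E); rewrite !indicE -natrM mulnb; congr (_%:R); congr nat_of_bool.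
apply/idP/andP; rewrite !inE.
  move=> [h1 h2]; have e1 : modulus (of_plane (cpoint (s, t))) = s by exact: (modulus_polar t (ltW s0)).
  split; last by rewrite /= in_itv/= -e1.
  move: h2; rewrite /= normrM (gtr0_norm s0) mulrCA ler_pM2l//.
move=> [h1 h2]; have e1 : modulus (of_plane (cpoint (s, t))) = s by exact: (modulus_polar t (ltW s0)).
split; first by move: h2; rewrite /= in_itv/= e1.
by rewrite /= normrM (gtr0_norm s0) mulrCA ler_pM2l.
Qed.

End sector_measure.

Section kernel_lower.
Context (R : realType).
Local Notation C := R[i].
Variable eta : R.
Hypothesis eta1 : -1 < eta.
Let a := 2 + eta.
Let a1 : 1 < a. Proof. by have h := eta1; rewrite /a; lra. Qed.
Let a0 : 0 < a. Proof. exact: lt_trans ltr01 a1. Qed.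

(** The aperture: proportional to d, with a factor small enough for
    [Re_inv_Cpow] at exponent 2 + eta. *)
Definition kappa (d : R) := (1 - cos (2 + eta)^-1) / 8 * d.

Let aV : 0 < a^-1 < 1. Proof. by rewrite invr_gt0 a0 invf_lt1. Qed.

Lemma cos_inv01 : 0 <= cos (2 + eta)^-1 < 1.
Proof.
have /andP[h0 h1] := aV; have pi2 := @pi_ge2 R; have ph := @pihalf_ge1 R.
apply/andP; split; first by apply: cos_ge0_pihalf; apply/andP; split; rewrite -/a; lra.
rewrite -[ltRHS](@cos0 R) ltr_cos// in_itv/= ?lexx ?(ltW (@pi_gt0 R))//.
rewrite -/a; apply/andP; split; lra.
Qed.

Lemma kappa_gt0 d : 0 < d -> 0 < kappa d.
Proof. by move=> d0; rewrite /kappa mulr_gt0// divr_gt0// subr_gt0; case/andP: cos_inv01. Qed.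

Lemma kappa_le d : 0 < d -> kappa d <= d / 8.
Proof.
move=> d0; have /andP[h0 h1] := cos_inv01; rewrite /kappa.
have : 0 <= cos (2 + eta)^-1 * d by rewrite mulr_ge0// ltW.
lra.
Qed.

(** Both numerator and denominator have the size that d dictates: 1 - |w|^2
    lies between d / 4 and d, and |1 - z conj(w)| is at most 3 d; the
    argument is controlled by the choice of [kappa]. *)
Lemma P_kernel_lower : exists2 B, 0 < B & forall (d : R) (z w : C), 0 < d -> d <= 1 ->
  sector (kappa d) (1 - d) 1 z -> sector (kappa d) (1 - d / 2) (1 - d / 4) w ->
  B / d ^+ 2 <= complex.Re (P_kernel eta z w).
Proof.
have c1 := @cos1_gt0 R.
pose B := (eta + 1) * 4^-1 `^ `|eta| * cos 1 / 3 `^ a.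
have e1 : 0 < eta + 1 by have h := eta1; lra.
have B0 : 0 < B by rewrite divr_gt0 ?mulr_gt0 ?powR_gt0.
exists B => // d z w d0 d1 hz hw.
have ka0 := kappa_gt0 d0. have kle := kappa_le d0.
have kle4 : kappa d <= d / 4 by lra.
have [Rb Ib mb] := sector_kernel_base ka0 kle4 d1 hz hw.
have [/andP[wl wu] _] := hw.
rewrite /P_kernel -/a; set b := (1 - z * conjc w) in Rb Ib mb *.
have Rb0 : 0 < complex.Re b by apply: lt_le_trans Rb; rewrite divr_gt0.
have b0 : b != 0 by apply/eqP => b0; move: Rb0; rewrite b0 ltxx.
have hb : cos a^-1 * modulus b <= complex.Re b.
  have /andP[h0 h1] := cos_inv01; have h := modulus_ReIm b; rewrite (gtr0_norm Rb0) in h.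
  move: (complex.Re b) (complex.Im b) (modulus b) Rb Ib Rb0 h => x y m Rb Ib Rb0 h.
  move: h0 h1 Ib; rewrite /kappa -/a; move: (cos a^-1) => cc h0 h1 Ib.
  have f1 : (1 - cc) * (d / 4) <= (1 - cc) * x by rewrite ler_wpM2l// subr_ge0 ltW.
  have f2 : cc * m <= cc * (x + (1 - cc) * x) by rewrite ler_wpM2l//; lra.
  have f3 : 0 <= (1 - cc) * (1 - cc) * x by rewrite mulr_ge0 ?(ltW Rb0)// mulr_ge0// subr_ge0 ltW.
  lra.
have mb0 : 0 < modulus b by rewrite modulus_gt0.
have h1 := Re_inv_Cpow (ltW a1) b0 hb.
have -> : complex.Re (((eta + 1) * (1 - modulus w ^+ 2) `^ eta)%:C / Cpow b a)%C =
   (eta + 1) * (1 - modulus w ^+ 2) `^ eta * complex.Re (Cpow b a)^-1.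
  by case: ((Cpow b a)^-1) => x y /=; ring.
pose x := (1 - modulus w ^+ 2) / d.
have x1 : 4^-1 <= x <= 1.
  rewrite /x ler_pdivlMr// ler_pdivrMr// mul1r.
  move: wl wu; have := modulus_ge0 w; move: (modulus w) => m m0 wl wu.
  have f1 : 0 <= (1 - m) * m by rewrite mulr_ge0// subr_ge0; lra.
  have f2 : 0 <= (1 - m) * (1 - m) by exact: sqr_ge0.
  by apply/andP; split; lra.
have /andP[xl xu] := x1; have x0 : 0 < x by apply: lt_le_trans xl; rewrite invr_gt0.
have wx : 1 - modulus w ^+ 2 = d * x by rewrite /x mulrC divfK// gt_eqF.
have h2 : 4^-1 `^ `|eta| * d `^ eta <= (1 - modulus w ^+ 2) `^ eta.
  rewrite wx powRM ?(ltW d0) ?(ltW x0)// [leRHS]mulrC ler_wpM2r ?powR_ge0//.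
  apply: (@le_trans _ _ (x `^ `|eta|)).
    by apply: ge0_ler_powR => //; rewrite nnegrE// ?invr_ge0// ltW.
  by apply: ger_powR; rewrite ?x0// ler_norm.
have h3 : modulus b `^ a <= 3 `^ a * (d ^+ 2 * d `^ eta).
  have -> : d ^+ 2 * d `^ eta = d `^ a.
    by rewrite -powR_mulrn ?(ltW d0)// -powRD// (gt_eqF d0) implybT.
  rewrite -powRM// ?(ltW d0)//; apply: ge0_ler_powR; rewrite ?nnegrE ?mulr_ge0 ?(ltW a0) ?(ltW d0) ?(ltW mb0)//.
have h4 : cos 1 / (3 `^ a * (d ^+ 2 * d `^ eta)) <= complex.Re (Cpow b a)^-1.
  apply: le_trans h1; rewrite ler_pM2l// lef_pV2 ?posrE ?powR_gt0//.
  by rewrite !mulr_gt0 ?powR_gt0// exprn_gt0.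
have p3 : 0 < 3 `^ a :> R by rewrite powR_gt0.
have pd : 0 < d `^ eta by rewrite powR_gt0.
have h5 : 0 <= 4^-1 `^ `|eta| * d `^ eta by rewrite mulr_ge0 ?powR_ge0.
have h6 : 0 <= cos 1 / (3 `^ a * (d ^+ 2 * d `^ eta)).
  apply: divr_ge0; first exact: ltW.
  by rewrite (mulr_ge0 (ltW p3))// (mulr_ge0 _ (ltW pd))// sqr_ge0.
have h7 := ler_wpM2l (ltW e1) (ler_pM h5 h6 h2 h4).
rewrite -[leRHS]mulrA; apply: le_trans h7.
rewrite /B le_eqVlt; apply/orP; left; apply/eqP.
move: (3 `^ a) (d `^ eta) (4^-1 `^ `|eta|) (cos 1) p3 pd => y1 y2 y3 y4 p3 pd.
by field; rewrite (gt_eqF p3) (gt_eqF d0) (gt_eqF pd).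
Qed.

End kernel_lower.

(** * Comparison of tails when P_eta is bounded *)

Section necessity.
Context (R : realType).
Local Notation C := R[i].
Local Notation M := (measurableTypeR R).
Local Notation D := (@planar_disc R : set (M * M)).
Variable nu : C -> R.
Hypothesis rnu : radial_weight nu.
Local Notation mu := (rmeas rnu).
Local Notation T := (tail mu).
Variables q eta : R.
Hypotheses (q1 : 1 < q) (eta1 : -1 < eta).
Hypothesis bnd : bounded_on_Lq q nu (P_kernel eta).

Let q0 : 0 < q. Proof. exact: lt_trans ltr01 q1. Qed.
Let mD := @measurable_planar_disc R.

Let nu0 (p : M * M) : D p -> 0 <= nu (of_plane p).
Proof. exact: nu_disc_ge0. Qed.

Let mnu : measurable_fun D (fun p => nu (of_plane p)).
Proof. exact: measurable_nu. Qed.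

Definition sector_indic (ka s1 s2 : R) (z : C) : C := ((\1_(sector ka s1 s2) z)%:C)%C.

Lemma Lq_sector_indic ka s1 s2 :
  (\int[@dA R]_(p in D) (modulus (sector_indic ka s1 s2 (of_plane p)) `^ q * nu (of_plane p))%:E =
   @sigma R (aperture ka) * mu (`[s1, s2[%classic `&` @I01 R))%E.
Proof.
rewrite -integral_psector; apply: eq_integral => p _; rewrite -EFinM; congr (_ * _)%:E.
rewrite /sector_indic modulus_real ger0_norm// indicE [in RHS]indicE.
have -> : (p \in psector ka s1 s2) = (of_plane p \in sector ka s1 s2).
  by apply/idP/idP; rewrite !inE.
by case: (_ \in _); rewrite ?powR1// powR0// gt_eqF.
Qed.

Let fin_sigma A : measurable A -> @sigma R A \is a fin_num.
Proof. by move=> mA; exact: fin_num_measure. Qed.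

Let mpiece s1 s2 : measurable (`[s1, s2[%classic `&` @I01 R : set M).
Proof. by apply: measurableI; [exact: measurable_itv|exact: measurable_I01]. Qed.

Lemma sector_indic_Lq ka s1 s2 : Lq q nu (sector_indic ka s1 s2).
Proof.
have mS := measurable_psector ka s1 s2.
split.
  split; last exact: measurable_cst.
  apply: (eq_measurable_fun (\1_(psector ka s1 s2) : _ -> R)).
    by move=> p _; rewrite /sector_indic /= !indicE; congr (nat_of_bool _)%:R.
  by apply: measurable_funTS; exact: measurable_indic.
rewrite /Lq_norm Lq_sector_indic; apply: poweR_lty.
rewrite ltey_eq fin_numM// ?fin_sigma//; first exact: measurable_aperture.
by rewrite fin_num_measure.
Qed.

Lemma sector_disc ka s1 s2 (z : C) : s2 <= 1 -> sector ka s1 s2 z -> disc z.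
Proof. by move=> h [/andP[_ zs] _]; exact: lt_le_trans h. Qed.

(** The sector has area of order d^2 and the kernel is at least of order 1 /
    d^2 on it. *)
Lemma P_sector_lower : exists2 B, 0 < B & forall (d : R) (z : C), 0 < d -> d <= 1 ->
  sector (kappa eta d) (1 - d) 1 z ->
  B <= complex.Re (kernel_operator (P_kernel eta) (sector_indic (kappa eta d) (1 - d / 2) (1 - d / 4)) z).
Proof.
have [B B0 hB] := P_kernel_lower eta1; have pi0 := @pi_gt0 R.
have c1 : 0 < 1 - cos (2 + eta)^-1 by rewrite subr_gt0; case/andP: (cos_inv01 eta1).
exists (B * ((1 - cos (2 + eta)^-1) / 8 / (16 * pi))).
  by rewrite mulr_gt0// divr_gt0 ?mulr_gt0// divr_gt0.
move=> d z d0 d1 hz.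
have ka0 := kappa_gt0 eta1 d0. have kle := kappa_le eta1 d0.
set ka := kappa eta d in hz ka0 kle *.
set f := sector_indic _ _ _.
have dz := sector_disc (lexx _) hz.
have [cc _ hcc] := bnd.
have [/(_ z dz)[ire _] _ _] := hcc _ (sector_indic_Lq ka (1 - d / 2) (1 - d / 4)).
have mS := measurable_psector ka (1 - d / 2) (1 - d / 4).
have fin := integrable_fin_num mD ire.
have SD : psector ka (1 - d / 2) (1 - d / 4) `<=` D.
  by move=> p /sector_disc; apply; lra.
have fE w : sector ka (1 - d / 2) (1 - d / 4) w -> f w = 1.
  by move=> hw; rewrite /f /sector_indic indicE mem_set.
have fE0 w : ~ sector ka (1 - d / 2) (1 - d / 4) w -> f w = 0.
  by move=> hw; rewrite /f /sector_indic indicE memNset.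
have pos w : 0 <= complex.Re (f w * P_kernel eta z w).
  have [hw|hw] := pselect (sector ka (1 - d / 2) (1 - d / 4) w); last by rewrite fE0// mul0r.
  by rewrite fE// mul1r; apply: le_trans (hB d z w d0 d1 hz hw); rewrite divr_ge0 ?sqr_ge0// ltW.
rewrite /kernel_operator /disc_integral /= /Rintegral -lee_fin fineK//.
apply: (@le_trans _ _ (\int[@dA R]_(p in psector ka (1 - d / 2) (1 - d / 4)) (cst (B / d ^+ 2)%:E p))%E).
  rewrite integral_cst//.
  apply: (@le_trans _ _ ((B / d ^+ 2)%:E * (d * ka / (16 * pi))%:E)%E); last first.
    apply: lee_wpmul2l; first by rewrite lee_fin divr_ge0 ?sqr_ge0// ltW.
    exact: dA_psector.
  rewrite -EFinM lee_fin le_eqVlt; apply/orP; left; apply/eqP; rewrite /ka /kappa.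
  rewrite [(16 * pi)^-1]invfM; move: (pi^-1 : R) (cos _) => y1 y2; field; by rewrite (gt_eqF d0).
have mre := measurable_int _ ire.
apply: (@le_trans _ _ (\int[@dA R]_(p in psector ka (1 - d / 2) (1 - d / 4))
    (complex.Re (f (of_plane p) * P_kernel eta z (of_plane p)))%:E)%E).
  apply: ge0_le_integral => //.
  - by move=> p _; rewrite lee_fin divr_ge0 ?sqr_ge0// ltW.
  - exact: measurable_funS mre.
  move=> p hp; rewrite lee_fin fE// mul1r; exact: hB.
apply: ge0_subset_integral => //.
by move=> p _; rewrite lee_fin pos.
Qed.

(** Test the norm inequality on the indicator of the sector 1 - d / 2 <= |w|
    < 1 - d / 4: its image is bounded below on the sector |z| >= 1 - d of the
    same aperture, so the common angular factor cancels from the two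
    nu-measures. *)
Lemma tail_middle : exists2 c : R, 0 < c & forall d, 0 < d -> d <= 1 ->
  T (1 - d) <= c * (T (1 - d / 2) - T (1 - d / 4)).
Proof.
have [B B0 hB] := P_sector_lower; have [c c0 hc] := bnd.
exists ((c / B) `^ q); first by rewrite powR_gt0// divr_gt0.
move=> d d0 d1.
have ka0 := kappa_gt0 eta1 d0.
set ka := kappa eta d in ka0 *.
set f := sector_indic ka (1 - d / 2) (1 - d / 4).
have hf := sector_indic_Lq ka (1 - d / 2) (1 - d / 4).
have [_ [mP _] hn] := hc _ hf.
set P := kernel_operator (P_kernel eta) f in mP hn.
have mA := measurable_aperture ka.
set m := fine (@sigma R (aperture ka)).
have mE : @sigma R (aperture ka) = m%:E by rewrite fineK// fin_sigma.
have m0 : 0 < m by rewrite -lte_fin -mE sigma_aperture_gt0.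
have mmP : measurable_fun D (fun y : M * M => modulus (P (of_plane y))).
  by apply: (measurable_modulus (f := P \o @of_plane R)); case: mP.
have NT : mu (`[(1 - d / 2)%R, (1 - d / 4)%R[%classic `&` @I01 R) = (T (1 - d / 2) - T (1 - d / 4))%:E.
  have -> : T (1 - d / 2) = fine (mu (`[(1 - d / 2)%R, (1 - d / 4)%R[%classic `&` @I01 R)) + T (1 - d / 4).
    rewrite /T /tail -fineD ?fin_num_measure// -measureU//.
      congr (fine (mu _)); rewrite -setIUl; congr (_ `&` _).
      apply/seteqP; split => x /=; rewrite !in_itv/=.
        move=> /andP[h1 h2]; have [xb|bx] := ltP x (1 - d / 4); first by left; rewrite h1.
        by right.
      move=> [/andP[-> h]|/andP[h ->]]; first by rewrite (lt_le_trans h)//; lra.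
      by rewrite andbT (le_trans _ h)//; lra.
    apply/seteqP; split => // x [[/= + _] [/= + _]]; rewrite !in_itv/= => /andP[_ xb] /andP[bx _].
    by move: xb; rewrite ltNge bx.
  by rewrite addrK fineK// fin_num_measure.
have lower : ((B `^ q)%:E * (m * T (1 - d))%:E <=
    \int[@dA R]_(p in D) (modulus (P (of_plane p)) `^ q * nu (of_plane p))%:E)%E.
  have -> : ((m * T (1 - d))%:E = @sigma R (aperture ka) * mu (`[(1 - d)%R, 1%R[%classic `&` @I01 R))%E.
    rewrite EFinM -mE; congr (_ * _)%E; rewrite /tail fineK//; exact: fin_num_measure.
  rewrite -integral_psector -ge0_integralZl//; last 3 first.
  - apply: emeasurable_funM; last exact/measurable_EFinP.
    by apply/measurable_EFinP; apply: measurable_funTS; apply: measurable_indic; exact: measurable_psector.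
  - by move=> p Dp; rewrite mule_ge0// lee_fin ?nu0.
  - by rewrite lee_fin powR_ge0.
  apply: ge0_le_integral => //.
  - by move=> p Dp; rewrite !mule_ge0// lee_fin ?powR_ge0 ?nu0.
  - apply: emeasurable_funM => //; apply: emeasurable_funM; last exact/measurable_EFinP.
    by apply/measurable_EFinP; apply: measurable_funTS; apply: measurable_indic; exact: measurable_psector.
  - apply/measurable_EFinP; apply: measurable_funM => //.
    exact: (measurableT_comp (measurable_powR q)).
  move=> p Dp; rewrite -!EFinM lee_fin mulrA ler_wpM2r ?nu0//.
  have [hp|hp] := pselect (psector ka (1 - d) 1 p); last by rewrite indicE memNset// mulr0 powR_ge0.
  rewrite indicE mem_set// mulr1; apply: ge0_ler_powR; rewrite ?nnegrE ?modulus_ge0 ?(ltW q0) ?(ltW B0)//.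
  apply: le_trans (hB d _ d0 d1 hp) _; apply: le_trans (ler_norm _) _; exact: Re_modulus.
have up : (\int[@dA R]_(p in D) (modulus (P (of_plane p)) `^ q * nu (of_plane p))%:E <=
    (c `^ q)%:E * (m * (T (1 - d / 2) - T (1 - d / 4)))%:E)%E.
  move: hn; rewrite /Lq_norm Lq_sector_indic mE NT -EFinM; set I := (\int[_]_(_ in _) _)%E.
  have I0 : (0 <= I)%E by apply: integral_ge0 => p Dp; rewrite lee_fin mulr_ge0 ?powR_ge0 ?nu0.
  set J := m * _; have J0 : 0 <= J.
    by rewrite mulr_ge0 ?(ltW m0)// subr_ge0 tail_decr//; lra.
  move=> h.
  have := @gt0_ler_poweR R q (ltW q0) (I `^ q^-1)%E (c%:E * J%:E `^ q^-1)%E.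
  rewrite !in_itv/= !leey !andbT poweR_ge0 mule_ge0 ?poweR_ge0 ?lee_fin ?(ltW c0) ?powR_ge0// => /(_ isT isT h).
  by rewrite powRM ?powR_ge0 ?(ltW c0)// -poweRrM -powRrM mulVf ?(gt_eqF q0)// poweRe1// powRr1.
have := le_trans lower up; rewrite -!EFinM lee_fin.
set t1 := T (1 - d); set t2 := _ - _; rewrite mulrCA [leRHS]mulrCA ler_pM2l// => h.
rewrite powRM ?(ltW c0) ?invr_ge0 ?(ltW B0)// -powR_inv1 ?(ltW B0)// -powRrM mulN1r powRN.
by rewrite mulrAC ler_pdivlMr ?powR_gt0// mulrC.
Qed.

End necessity.

(** * From tails back to the class D *)

Section tail_classD.
Context (R : realType).
Variable nu : R[i] -> R.
Hypothesis rnu : radial_weight nu.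
Local Notation T := (tail (rmeas rnu)).
Variable c : R.
Hypothesis c0 : 0 < c.
Hypothesis middle : forall d, 0 < d -> d <= 1 -> T (1 - d) <= c * (T (1 - d / 2) - T (1 - d / 4)).

Let mid (r : R) : 0 <= r < 1 -> 0 < 1 - r /\ 1 - r <= 1.
Proof. by move=> /andP[r0 r1]; split; lra. Qed.

Let T_half (r : R) : 0 <= r < 1 -> T r <= c * T ((1 + r) / 2).
Proof.
move=> hr; have [d0 d1] := mid hr; have := middle d0 d1.
rewrite subKr (_ : 1 - (1 - r) / 2 = (1 + r) / 2); last by lra.
move=> h; apply: le_trans h _; rewrite ler_pM2l// gerBl; exact: tail_ge0.
Qed.

Let T_quarter (r : R) : 0 <= r < 1 -> (1 + c^-1) * T (1 - (1 - r) / 4) <= T r.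
Proof.
move=> hr; have [d0 d1] := mid hr; have := middle d0 d1; rewrite subKr.
have h1 : T (1 - (1 - r) / 2) <= T r by apply: tail_decr; lra.
have h2 : T (1 - (1 - r) / 4) <= T r by apply: tail_decr; lra.
rewrite -ler_pdivrMl// => h3.
have h4 : c^-1 * T (1 - (1 - r) / 4) <= c^-1 * T r by rewrite ler_pM2l// invr_gt0.
lra.
Qed.

Let g1 : 1 < 1 + c^-1. Proof. by rewrite ltrDl invr_gt0. Qed.

Let pow4 n : 1 <= 4 ^+ n :> R. Proof. by rewrite exprn_ege1// ler1n. Qed.

Let up01 n (r : R) : 0 <= r < 1 -> 0 <= 1 - (1 - r) / 4 ^+ n < 1.
Proof.
move=> hr; have [d0 d1] := mid hr; have p0 : 0 < 4 ^+ n :> R by rewrite exprn_gt0.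
by rewrite subr_ge0 ler_pdivrMr// mul1r (le_trans d1)//= ltrBlDr ltrDl divr_gt0.
Qed.

Let T_iter n (r : R) : 0 <= r < 1 -> (1 + c^-1) ^+ n * T (1 - (1 - r) / 4 ^+ n) <= T r.
Proof.
have g0 : 0 < 1 + c^-1 by exact: lt_trans ltr01 g1.
elim: n r => [|n ih] r hr; first by rewrite !expr0 divr1 subKr mul1r.
have := T_quarter hr; apply: le_trans; rewrite exprS -mulrA ler_pM2l//.
have := ih _ (up01 1 hr); rewrite expr1 subKr -mulrA -invfM -exprS//.
Qed.

(** The assumption contains T(r) <= c T((1 + r) / 2), and also (1 + 1 / c)
    T(1 - (1 - r) / 4) <= T(r), by monotonicity of T. The passage from tails
    to hat costs a factor 2, which the first inequality absorbs in its
    constant and the second one after iteration; near 0 the first one follows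
    from 0 < hat < oo. *)
Lemma tail_classD : classD nu.
Proof.
have half01 (r : R) : 0 <= r < 1 -> 0 <= (1 + r) / 2 < 1.
  by move=> /andP[r0 r1]; apply/andP; split; lra.
have z01 : 0 <= (0 : R) < 1 by rewrite lexx ltr01.
have t01 : 0 <= (3 / 4 : R) < 1 by apply/andP; split; lra.
have f0 := fhat_gt0 rnu z01. have f3 := fhat_gt0 rnu t01.
have c00 := c0.
split; split=> //.
  have p0 : 0 < fhat nu 0 / fhat nu (3 / 4) by rewrite divr_gt0.
  exists (1 + 2 * c + fhat nu 0 / fhat nu (3 / 4)); first by lra.
  move=> r hr; have hr2 := half01 r hr; have /andP[r0 r1] := hr.
  rewrite (hat_fin rnu hr) (hat_fin rnu hr2) -EFinM lee_fin.
  have F0 := fhat_gt0 rnu hr2.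
  have [rh|rh] := leP 2^-1 r.
    have h1 := hat_le_tail rnu rh r1. have h2 := T_half hr. have h3 := tail_le_hat rnu hr2.
    have h4 : c * T ((1 + r) / 2) <= c * (2 * fhat nu ((1 + r) / 2)) by rewrite ler_pM2l.
    have h5 : 0 <= fhat nu 0 / fhat nu (3 / 4) * fhat nu ((1 + r) / 2) by rewrite mulr_ge0// ltW.
    move: (fhat nu ((1 + r) / 2)) (_ / fhat nu (3 / 4)) F0 h3 h4 h5 => y k3 F0 h3 h4 h5; lra.
  have h1 := fhat_decr rnu (lexx 0) r0 r1.
  have h2 : fhat nu (3 / 4) <= fhat nu ((1 + r) / 2).
    by case/andP: hr2 => h0 _; apply: (fhat_decr rnu h0); lra.
  have h3 : 0 <= 2 * c * fhat nu ((1 + r) / 2) by rewrite !mulr_ge0// ltW.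
  have h4 : fhat nu 0 <= fhat nu 0 / fhat nu (3 / 4) * fhat nu ((1 + r) / 2).
    by rewrite mulrAC ler_pdivlMr// ler_pM2l.
  move: (fhat nu ((1 + r) / 2)) (_ / fhat nu (3 / 4)) F0 h3 h4 => y k3 F0 h3 h4; lra.
have [n hn] := ex_pow_ge g1 4.
exists (4 ^+ n.+1), 2; split; rewrite ?exprn_egt1 ?ltr1n//.
move=> r hr; have hu := up01 n.+1 hr; have /andP[u0 u1] := hu.
rewrite (hat_fin rnu hr) (hat_fin rnu hu) -EFinM lee_fin.
have uh : 2^-1 <= 1 - (1 - r) / 4 ^+ n.+1.
  have [d0 d1] := mid hr.
  have : (1 - r) / 4 ^+ n.+1 <= 4^-1.
    rewrite ler_pdivrMr ?exprn_gt0// exprS mulKf ?pnatr_eq0//; exact: le_trans (pow4 n).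
  lra.
have h1 := hat_le_tail rnu uh u1. have h2 := T_iter n.+1 hr. have h3 := tail_le_hat rnu hr.
have t0 := tail_ge0 (rmeas rnu) (1 - (1 - r) / 4 ^+ n.+1).
have h4 : 4 <= (1 + c^-1) ^+ n.+1.
  by apply: le_trans hn _; rewrite exprS ler_peMl ?exprn_ge0// ?(ltW g1)// ltW// (lt_trans ltr01).
have h5 := ler_wpM2r t0 h4.
lra.
Qed.

End tail_classD.

Theorem classB_classD (R : realType) (q : R) (nu : R[i] -> R) : 1 < q ->
  radial_weight nu -> classB q nu -> classD nu.
Proof.
move=> q1 rnu [eta eta1 [_ bnd]].
have [c c0 hc] := tail_middle rnu q1 eta1 bnd.
exact: (tail_classD c0 hc).
Qed.

Theorem proposition6 (R : realType) (q : R) (hq : 1 < q) :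
  (forall nu : R[i] -> R, radial_weight nu -> classB q nu -> classD nu) /\
  (forall nu : R[i] -> R, classD nu -> bounded_on_Lq q nu (P_plus_kernel nu)).
Proof. by split => nu; [exact: classB_classD|exact: classD_bounded]. Qed.
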